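(* Let $\mathfrak M_1$ be the Farey AF algebra and $E(\mathfrak M_1)=(E(\mathfrak M_1),0,{}^*,\oplus)$ its Elliott involutive monoid. Then: (a) $E(\mathfrak M_1)$ is singly generated (as an involutive monoid, i.e. as an algebra with operations $0,{}^*,\oplus$). (b) For any two generators $[p]$ and $[q]$ of $E(\mathfrak M_1)$, the map $[p]\mapsto[q]$ extends uniquely to an automorphism of $E(\mathfrak M_1)$. (c) If $[p]$ is a generator of $E(\mathfrak M_1)$, then the only other generator is $[1_{\mathfrak M_1}-p]$.
   Context: An AF algebra is the norm closure of the union of an ascending sequence of finite-dimensional C*-algebras all having the same unit. An AF$\ell$ algebra is an AF algebra whose Murray–von Neumann order on equivalence classes of projections is a lattice. For an AF$\ell$ algebra $\mathfrak B$, the Elliott involutive monoid $E(\mathfrak B)=(E(\mathfrak B),0,{}^*,\oplus)$ is the set of Murray–von Neumann equivalence classes $[p]$ of projections of $\mathfrak B$, with $\oplus$ the unique associative, commutative, monotone extension of Elliott's partial addition ($[p]+[q]=[p+q]$ for orthogonal $p,q$) such that $[1_{\mathfrak B}-p]$ is the least $[q]$ with $[p]+[q]=[1_{\mathfrak B}]$, and with involution $[p]^*=[1_{\mathfrak B}-p]$. Equivalently, $E(\mathfrak B)$ is isomorphic to the unit interval $[0,u]$ of the unital lattice-ordered group $(K_0(\mathfrak B),u=[1_{\mathfrak B}])$ with $x^*=u-x$ and $x\oplus y=(x+y)\wedge u$. Let $M_1$ be the unital lattice-ordered abelian group of all continuous piecewise linear functions $f:[0,1]\to\mathbb R$ with finitely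 many linear pieces, each having integer coefficients, with pointwise operations and distinguished unit the constant function $1$. The Farey AF algebra $\mathfrak M_1$ is the (unique up to isomorphism) AF algebra whose unital ordered $K_0$-group is isomorphic to $(M_1,1)$; it is an AF$\ell$ algebra. *)

(* Defs.v *)
From HB Require Import structures.
From mathcomp Require Import all_boot all_order all_algebra.
From mathcomp Require Import all_classical all_reals all_analysis.
From mathcomp Require Import complex.

Set Implicit Arguments.
Unset Strict Implicit.
Unset Printing Implicit Defensive.

Import Order.TTheory GRing.Theory Num.Theory numFieldNormedType.Exports.

Local Open Scope classical_set_scope.
Local Open Scope quotient_scope.
Local Open Scope ring_scope.

(* Unital C*-algebras over R[i], with 1 != 0 inherited from algType.  The norm
   is a field of this mixin rather than that of completeNormedModType R[i]:
   Hierarchy Builder rejects the join of NormedModule and Algebra, because it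
   would have to sit below the already declared NumDomain. *)
HB.mixin Record Algebra_isCstar (R : realType) A of GRing.Algebra R[i] A := {
  cnorm : A -> R;
  star : A -> A;
  cnorm0_eq0 : forall x, cnorm x = 0 -> x = 0;
  cnormD_le : forall x y, cnorm (x + y) <= cnorm x + cnorm y;
  cnormZ : forall (c : R[i]) x, cnorm (c *: x) = complex.Re `|c| * cnorm x;
  cnormM_le : forall x y, cnorm (x * y) <= cnorm x * cnorm y;
  cnorm_complete : forall u : nat -> A,
    (forall e : R, 0 < e -> exists N : nat, forall m n : nat,
      (N <= m)%N -> (N <= n)%N -> cnorm (u m - u n) < e) ->
    exists l : A, forall e : R, 0 < e -> exists N : nat, forall n : nat,
      (N <= n)%N -> cnorm (u n - l) < e;
  starK : involutive star;
  starD : {morph star : x y / x + y};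
  starZ : forall (c : R[i]) x, star (c *: x) = conjc c *: star x;
  starM : forall x y, star (x * y) = star y * star x;
  cnorm_starM : forall x, cnorm (star x * x) = cnorm x ^+ 2
}.

#[short(type="cstarAlgType")]
HB.structure Definition CstarAlgebra (R : realType) :=
  {A of Algebra_isCstar R A & GRing.Algebra R[i] A}.

Section AF.
Variables (R : realType) (A : cstarAlgType R).

(* Norm-closedness need not be required: a finite-dimensional subspace is
   closed, so these are the finite-dimensional C*-subalgebras containing 1. *)
Record findim_cstar_subalg (F : set A) : Prop := FindimCstarSubalg {
  fd_one : F 1;
  fd_add : forall x y, F x -> F y -> F (x + y);
  fd_scale : forall (c : R[i]) x, F x -> F (c *: x);
  fd_mul : forall x y, F x -> F y -> F (x * y);
  fd_star : forall x, F x -> F (star x);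
  fd_dim : exists (n : nat) (b : 'I_n -> A), forall x, F x ->
    exists c : 'I_n -> R[i], x = \sum_(i < n) c i *: b i
}.

Definition is_AF : Prop := exists F : nat -> set A,
  [/\ forall n, findim_cstar_subalg (F n),
      forall n, F n `<=` F n.+1 &
      forall (x : A) (e : R), 0 < e ->
        exists n y, F n y /\ cnorm (x - y) < e].

End AF.

Section Star.
Variables (R : realType) (A : cstarAlgType R).

Lemma star0 : star (0 : A) = 0.
Proof. by apply: (@addrI _ (star 0)); rewrite -starD !addr0. Qed.

Lemma star1 : star (1 : A) = 1.
Proof. by rewrite -[LHS]mul1r -[X in X * _]starK -starM mul1r starK. Qed.

Lemma starN (x : A) : star (- x) = - star x.
Proof. by apply: (@addrI _ (star x)); rewrite -starD !subrr star0. Qed.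

Lemma star_sum (I : Type) (r : seq I) (F : I -> A) :
  star (\sum_(i <- r) F i) = \sum_(i <- r) star (F i).
Proof. exact: (big_morph _ (@starD _ A) star0). Qed.

Definition star_mx m n (M : 'M[A]_(m, n)) : 'M[A]_(n, m) :=
  \matrix_(i, j) star (M j i).

Lemma star_mxK m n : cancel (@star_mx m n) (@star_mx n m).
Proof. by move=> M; apply/matrixP => i j; rewrite !mxE starK. Qed.

Lemma star_mxM m n k (M : 'M[A]_(m, n)) (N : 'M[A]_(n, k)) :
  star_mx (M *m N) = star_mx N *m star_mx M.
Proof.
apply/matrixP => i j; rewrite !mxE star_sum; apply: eq_bigr => l _.
by rewrite starM !mxE.
Qed.

Lemma star_mx0 m n : star_mx (0 : 'M[A]_(m, n)) = 0.
Proof. by apply/matrixP => i j; rewrite !mxE star0. Qed.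

Lemma star_mx1 n : star_mx (1%:M : 'M[A]_n) = 1%:M.
Proof.
by apply/matrixP => i j; rewrite !mxE eq_sym; case: eqP; rewrite ?star1 ?star0.
Qed.

Lemma star_block_mx m1 m2 n1 n2 (a : 'M[A]_(m1, n1)) (b : 'M[A]_(m1, n2))
    (c : 'M[A]_(m2, n1)) (d : 'M[A]_(m2, n2)) :
  star_mx (block_mx a b c d) =
  block_mx (star_mx a) (star_mx c) (star_mx b) (star_mx d).
Proof.
apply/matrixP => i j; rewrite mxE.
by case: (split_ordP i) => i' ->; case: (split_ordP j) => j' ->;
  rewrite ?(block_mxEul, block_mxEur, block_mxEdl, block_mxEdr) mxE.
Qed.

End Star.

Section Projections.
Variables (R : realType) (A : cstarAlgType R).

Record projection := Projection {
  proj_val : A;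
  projP : star proj_val = proj_val /\ proj_val * proj_val = proj_val
}.

HB.instance Definition _ := gen_eqMixin projection.
HB.instance Definition _ := gen_choiceMixin projection.

Lemma proj0_subproof : star (0 : A) = 0 /\ (0 : A) * 0 = 0.
Proof. by rewrite star0 mul0r. Qed.
Definition proj0 := Projection proj0_subproof.

Lemma proj1_subproof : star (1 : A) = 1 /\ (1 : A) * 1 = 1.
Proof. by rewrite star1 mul1r. Qed.
Definition proj1 := Projection proj1_subproof.

Lemma projC_subproof (p : projection) :
  let c : A := 1 - proj_val p in star c = c /\ c * c = c.
Proof.
case: p => p [/= ps pp]; split; first by rewrite starD star1 starN ps.
by rewrite mulrBl mul1r mulrBr mulr1 pp subrr subr0.
Qed.
Definition projC (p : projection) := Projection (projC_subproof p).

(* Murray-von Neumann equivalence. *)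
Definition mvn (p q : projection) : Prop :=
  exists v : A, star v * v = proj_val p /\ v * star v = proj_val q.

Lemma mvn_refl p : mvn p p.
Proof. by exists (proj_val p); case: p => p [/= -> ->]. Qed.

Lemma mvn_sym p q : mvn p q -> mvn q p.
Proof. by move=> [v [h1 h2]]; exists (star v); rewrite starK. Qed.

Lemma mvn_trans q p r : mvn p q -> mvn q r -> mvn p r.
Proof.
move=> [v [vp vq]] [w [wq wr]]; exists (w * v); rewrite starM; split.
  rewrite mulrA -(mulrA (star v)) wq -vq mulrA vp -mulrA vp.
  by case: (projP p).
rewrite mulrA -(mulrA w) vq -wq mulrA wr -mulrA wr.
by case: (projP r).
Qed.

Definition mvnb : rel projection := fun p q => `[< mvn p q >].

Lemma mvnb_equiv : equiv_class_of mvnb.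
Proof.
split.
- by move=> p; apply/asboolP; exact: mvn_refl.
- by move=> p q; apply/asboolP/asboolP; exact: mvn_sym.
- move=> q p r /asboolP h1 /asboolP h2.
  by apply/asboolP; exact: mvn_trans h2.
Qed.

Canonical mvn_equiv_rel := EquivRelPack mvnb_equiv.

Definition mvn_class := {eq_quot mvn_equiv_rel}.

Definition mvn_cl (p : projection) : mvn_class := \pi_mvn_class p.

Lemma mvn_clP p q : mvn_cl p = mvn_cl q <-> mvn p q.
Proof.
split; first by move/eqP; rewrite eqmodE => /asboolP.
by move=> h; apply/eqP; rewrite eqmodE; apply/asboolP.
Qed.

(* For projections, p <= q in A means q p = p. *)
Definition mvn_le (x y : mvn_class) : Prop :=
  exists p q : projection,
    [/\ x = mvn_cl p, y = mvn_cl q & proj_val q * proj_val p = proj_val p].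

End Projections.

Record inv_monoid_ops (T : Type) := InvMonoidOps {
  im_zero : T;
  im_star : T -> T;
  im_add : T -> T -> T
}.

Section InvolutiveMonoids.
Variables (T : Type) (E : inv_monoid_ops T).

Definition inv_submonoid (S : set T) : Prop :=
  [/\ S (im_zero E),
      forall x, S x -> S (im_star E x) &
      forall x y, S x -> S y -> S (im_add E x y)].

Definition im_generator (x : T) : Prop :=
  forall S : set T, inv_submonoid S -> S x -> S = setT.

Definition im_automorphism (h : T -> T) : Prop :=
  [/\ bijective h,
      h (im_zero E) = im_zero E,
      {morph h : x / im_star E x} &
      {morph h : x y / im_add E x y}].

End InvolutiveMonoids.

(* E is the Elliott involutive monoid structure on the Murray-von Neumann
   classes of A.  The axioms determine the sum uniquely when A is an AF algebra
   whose order mvn_le is a lattice. *)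
Record is_elliott_monoid (R : realType) (A : cstarAlgType R)
    (E : inv_monoid_ops (mvn_class A)) : Prop := IsElliottMonoid {
  elliott_zero : im_zero E = mvn_cl (proj0 A);
  elliott_star : forall p : projection A,
    im_star E (mvn_cl p) = mvn_cl (projC p);
  elliott_addA : associative (im_add E);
  elliott_addC : commutative (im_add E);
  elliott_add_mono : forall x y z : mvn_class A,
    mvn_le x y -> mvn_le (im_add E x z) (im_add E y z);
  (* r is the projection p + q of two orthogonal projections *)
  elliott_add_ortho : forall p q r : projection A,
    proj_val p * proj_val q = 0 -> proj_val r = proj_val p + proj_val q ->
    im_add E (mvn_cl p) (mvn_cl q) = mvn_cl r;
  elliott_starP : forall p : projection A,
    im_add E (mvn_cl p) (mvn_cl (projC p)) = mvn_cl (proj1 A);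
  elliott_star_least : forall p q : projection A,
    im_add E (mvn_cl p) (mvn_cl q) = mvn_cl (proj1 A) ->
    mvn_le (mvn_cl (projC p)) (mvn_cl q)
}.

(* The monoid V(A) of Murray-von Neumann classes of projections in matrix
   algebras over A; matrices of different sizes are compared through
   rectangular partial isometries. *)
Section MatrixProjections.
Variables (R : realType) (A : cstarAlgType R).

Record mxprojection := MxProjection {
  mxp_dim : nat;
  mxp_val :> 'M[A]_mxp_dim;
  mxprojP : star_mx mxp_val = mxp_val /\ mxp_val *m mxp_val = mxp_val
}.

HB.instance Definition _ := gen_eqMixin mxprojection.
HB.instance Definition _ := gen_choiceMixin mxprojection.

Definition mxmvn (p q : mxprojection) : Prop :=
  exists v : 'M[A]_(mxp_dim q, mxp_dim p),
    star_mx v *m v = p /\ v *m star_mx v = q.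

Lemma mxmvn_refl p : mxmvn p p.
Proof. by exists p; case: p => n p [/= -> ->]. Qed.

Lemma mxmvn_sym p q : mxmvn p q -> mxmvn q p.
Proof. by move=> [v [h1 h2]]; exists (star_mx v); rewrite star_mxK. Qed.

Lemma mxmvn_trans q p r : mxmvn p q -> mxmvn q r -> mxmvn p r.
Proof.
move=> [v [vp vq]] [w [wq wr]]; exists (w *m v); rewrite star_mxM; split.
  rewrite mulmxA -(mulmxA (star_mx v)) wq -vq mulmxA vp -mulmxA vp.
  by case: (mxprojP p).
rewrite mulmxA -(mulmxA w) vq -wq mulmxA wr -mulmxA wr.
by case: (mxprojP r).
Qed.

Definition mxmvnb : rel mxprojection := fun p q => `[< mxmvn p q >].

Lemma mxmvnb_equiv : equiv_class_of mxmvnb.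
Proof.
split.
- by move=> p; apply/asboolP; exact: mxmvn_refl.
- by move=> p q; apply/asboolP/asboolP; exact: mxmvn_sym.
- move=> q p r /asboolP h1 /asboolP h2.
  by apply/asboolP; exact: mxmvn_trans h2.
Qed.

Canonical mxmvn_equiv_rel := EquivRelPack mxmvnb_equiv.

Definition Vmon := {eq_quot mxmvn_equiv_rel}.
HB.instance Definition _ := Choice.on Vmon.

Definition Vcl (p : mxprojection) : Vmon := \pi_Vmon p.

Lemma VclP p q : Vcl p = Vcl q <-> mxmvn p q.
Proof.
split; first by move/eqP; rewrite eqmodE => /asboolP.
by move=> h; apply/eqP; rewrite eqmodE; apply/asboolP.
Qed.

Lemma Vcl_repr (x : Vmon) : Vcl (repr x) = x.
Proof. exact: reprK. Qed.

Lemma mxp_sum_subproof (p q : mxprojection) :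
  let s := block_mx (mxp_val p) 0 0 (mxp_val q) in star_mx s = s /\ s *m s = s.
Proof.
case: p q => m p [ps pp] [n q [qs qq]] /=.
by rewrite star_block_mx !star_mx0 ps qs mulmx_block
  !(mulmx0, mul0mx, addr0, add0r) pp qq.
Qed.

Definition mxp_sum p q := MxProjection (mxp_sum_subproof p q).

Lemma mxp_zero_subproof :
  star_mx (0 : 'M[A]_0) = 0 /\ (0 : 'M[A]_0) *m (0 : 'M[A]_0) = 0.
Proof. by rewrite star_mx0 mul0mx. Qed.

Definition mxp_zero := MxProjection mxp_zero_subproof.

Lemma mxp_one_subproof :
  star_mx (1%:M : 'M[A]_1) = 1%:M /\ (1%:M : 'M[A]_1) *m (1%:M : 'M[A]_1) = 1%:M.
Proof. by rewrite star_mx1 mul1mx. Qed.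

Definition mxp_one := MxProjection mxp_one_subproof.

Lemma mxmvn_sum p p' q q' :
  mxmvn p p' -> mxmvn q q' -> mxmvn (mxp_sum p q) (mxp_sum p' q').
Proof.
move=> [v [vp vp']] [w [wq wq']]; exists (block_mx v 0 0 w) => /=.
by rewrite star_block_mx !star_mx0 !mulmx_block
  !(mulmx0, mul0mx, addr0, add0r) vp vp' wq wq'.
Qed.

Lemma mxmvn_sumC p q : mxmvn (mxp_sum p q) (mxp_sum q p).
Proof.
case: (mxprojP p) (mxprojP q) => [ps pp] [qs qq].
exists (block_mx 0 (mxp_val q) (mxp_val p) 0) => /=.
by rewrite star_block_mx !star_mx0 !mulmx_block
  !(mulmx0, mul0mx, addr0, add0r) ps qs pp qq.
Qed.

Lemma mxmvn_sum0 p : mxmvn (mxp_sum mxp_zero p) p.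
Proof.
case: (mxprojP p) => [ps pp].
exists (row_mx 0 (mxp_val p) : 'M[A]_(mxp_dim p, 0 + mxp_dim p)) => /=.
have -> : star_mx (row_mx 0 (mxp_val p) : 'M[A]_(mxp_dim p, 0 + mxp_dim p)) =
          col_mx 0 (mxp_val p).
  apply/matrixP => i j; rewrite mxE; case: (split_ordP i) => i' ->.
    by case: i'.
  by rewrite row_mxEr col_mxEd -[in RHS]ps mxE.
split; last by rewrite mul_row_col mul0mx add0r.
by rewrite mul_col_row !(mulmx0, mul0mx) pp.
Qed.

Lemma mxmvn_cast p q (e : mxp_dim q = mxp_dim p) :
  mxp_val p = castmx (e, e) (mxp_val q) -> mxmvn p q.
Proof.
case: p q e => m p hp [n q hq] /= e; case: _ / e p hp => p hp /= pq.
by exists q; rewrite /= pq; case: hq => -> ->.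
Qed.

Lemma mxmvn_sumA p q r :
  mxmvn (mxp_sum p (mxp_sum q r)) (mxp_sum (mxp_sum p q) r).
Proof.
pose e := esym (addnA (mxp_dim p) (mxp_dim q) (mxp_dim r)).
apply: (@mxmvn_cast (mxp_sum p (mxp_sum q r)) (mxp_sum (mxp_sum p q) r) e).
have := @block_mxA _ _ _ _ _ _ _
  (mxp_val p) 0 0 0 (mxp_val q) 0 0 0 (mxp_val r).
by rewrite /= !row_mx0 !col_mx0.
Qed.

Definition Vadd (x y : Vmon) : Vmon := Vcl (mxp_sum (repr x) (repr y)).

Lemma Vadd_cl p q : Vadd (Vcl p) (Vcl q) = Vcl (mxp_sum p q).
Proof. by apply/VclP/mxmvn_sum; apply/VclP; exact: Vcl_repr. Qed.

Lemma VaddA : associative Vadd.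
Proof.
move=> x y z; rewrite -(Vcl_repr x) -(Vcl_repr y) -(Vcl_repr z) !Vadd_cl.
exact/VclP/mxmvn_sumA.
Qed.

Lemma VaddC : commutative Vadd.
Proof. by move=> x y; apply/VclP/mxmvn_sumC. Qed.

Lemma Vadd0 : left_id (Vcl mxp_zero) Vadd.
Proof.
by move=> x; rewrite -(Vcl_repr x) Vadd_cl; exact/VclP/mxmvn_sum0.
Qed.

HB.instance Definition _ := GRing.isNmodule.Build Vmon VaddA VaddC Vadd0.

End MatrixProjections.

(* The Grothendieck group of a commutative monoid; (a, b) stands for a - b. *)
Section Grothendieck.
Variable M : nmodType.

Definition groth_relb : rel (M * M) :=
  fun x y => `[< exists r : M, x.1 + y.2 + r = y.1 + x.2 + r >].

Lemma groth_relb_equiv : equiv_class_of groth_relb.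
Proof.
split.
- by move=> x; apply/asboolP; exists 0.
- by move=> x y; apply/asboolP/asboolP => -[r h]; exists r.
- move=> [b1 b2] [a1 a2] [c1 c2] /asboolP[r /= h1] /asboolP[s /= h2].
  apply/asboolP; exists (b1 + b2 + r + s) => /=.
  have -> : a1 + c2 + (b1 + b2 + r + s) = (a1 + b2 + r) + (b1 + c2 + s).
    by rewrite (AC (2*4) ((1*4*5)*(3*2*6))).
  by rewrite h1 h2 (AC (3*3) ((4*2)*(1*5*3*6))).
Qed.

Canonical groth_equiv_rel := EquivRelPack groth_relb_equiv.

Definition groth := {eq_quot groth_equiv_rel}.
HB.instance Definition _ := Choice.on groth.

Definition gcl (x : M * M) : groth := \pi_groth x.

Lemma gclP x y : gcl x = gcl y <-> exists r, x.1 + y.2 + r = y.1 + x.2 + r.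
Proof.
split; first by move/eqP; rewrite eqmodE => /asboolP.
by move=> h; apply/eqP; rewrite eqmodE; apply/asboolP.
Qed.

Lemma gcl_repr (x : groth) : gcl (repr x) = x.
Proof. exact: reprK. Qed.

Definition gadd (x y : groth) : groth :=
  gcl ((repr x).1 + (repr y).1, (repr x).2 + (repr y).2).
Definition gopp (x : groth) : groth := gcl ((repr x).2, (repr x).1).

Lemma gadd_cl x y : gadd (gcl x) (gcl y) = gcl (x.1 + y.1, x.2 + y.2).
Proof.
have /gclP[r hr] := gcl_repr (gcl x); have /gclP[s hs] := gcl_repr (gcl y).
apply/gclP; exists (r + s) => /=.
set a := repr (gcl x) in hr *; set b := repr (gcl y) in hs *.
rewrite (AC ((2*2)*2) ((1*3*5)*(2*4*6))) /= hr hs.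
by rewrite (AC (3*3) ((1*4)*(2*5)*(3*6))).
Qed.

Lemma gopp_cl x : gopp (gcl x) = gcl (x.2, x.1).
Proof.
have /gclP[r hr] := gcl_repr (gcl x); apply/gclP; exists r => /=.
by rewrite addrC [RHS]addrC (addrC _ x.1) (addrC x.2) addrC -hr addrC.
Qed.

Lemma gaddA : associative gadd.
Proof.
move=> x y z; rewrite -(gcl_repr x) -(gcl_repr y) -(gcl_repr z) !gadd_cl /=.
by rewrite !addrA.
Qed.

Lemma gaddC : commutative gadd.
Proof.
by move=> x y; rewrite -(gcl_repr x) -(gcl_repr y) !gadd_cl /=; congr gcl;
  congr pair; rewrite addrC.
Qed.

Lemma gadd0 : left_id (gcl (0, 0)) gadd.
Proof.
by move=> x; rewrite -(gcl_repr x) gadd_cl !add0r; case: (repr x).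
Qed.

Lemma gaddN : left_inverse (gcl (0, 0)) gopp gadd.
Proof.
move=> x; rewrite -(gcl_repr x) gopp_cl gadd_cl /=; apply/gclP; exists 0 => /=.
by rewrite !addr0 add0r addrC.
Qed.

HB.instance Definition _ := GRing.isZmodule.Build groth gaddA gaddC gadd0 gaddN.

Definition groth_in (a : M) : groth := gcl (a, 0).

End Grothendieck.

Section K0.
Variables (R : realType) (A : cstarAlgType R).

Definition K0 := groth (Vmon A).

Definition K0_ge0 (x : K0) : Prop := exists a : Vmon A, x = groth_in a.

Definition K0_unit : K0 := groth_in (Vcl (mxp_one A)).

End K0.

Section M1.
Variable R : realType.

Definition unit_interval : set R := `[0, 1]%classic.

Definition M1 : set (unit_interval -> R) := [set f |
  continuous f /\
  exists (n : nat) (t : nat -> R),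
    [/\ t 0%N = 0, t n = 1, forall i, (i < n)%N -> t i <= t i.+1 &
        forall i, (i < n)%N -> exists a b : int,
          forall x : unit_interval, t i <= set_val x <= t i.+1 ->
            f x = a%:~R * set_val x + b%:~R]].

(* phi is an isomorphism of unital ordered groups from (K0 A, K0_unit A) onto
   (M1, 1); this determines A up to isomorphism. *)
Definition is_farey_algebra (A : cstarAlgType R) : Prop :=
  is_AF A /\
  exists phi : K0 A -> (unit_interval -> R),
    [/\ {morph phi : x y / x + y},
        injective phi,
        range phi = M1,
        forall x, K0_ge0 x <-> (forall t, 0 <= phi x t) &
        phi (K0_unit A) = (fun=> 1)].

End M1.

(* Main.v *)
Require Import Defs.
From HB Require Import structures.
From mathcomp Require Import all_boot all_order all_algebra.
From mathcomp Require Import all_classical all_reals all_analysis.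
From mathcomp Require Import complex ring lra.

(* K_0 of an AF algebra is cancellative: a Murray-von Neumann equivalence of two
   projections of M_n(A) can be perturbed into M_n(F) for a finite-dimensional F,
   where the complements of equivalent projections are equivalent. The class of a
   projection is therefore determined by its image in K_0, and [p] |-> phi [p]
   identifies E(A) with the functions of M_1 with values in [0, 1], the axioms of the
   Elliott monoid forcing x + y to be min(x + y, 1).

   The identity function generates this algebra by McNaughton's theorem in one
   variable. Conversely a generator g is injective, because id lies in the algebra it
   generates, hence strictly monotone; its integer slopes are then all >= 1 in absolute
   value, and since g maps [0, 1] to itself, g = id or g = 1 - id. The only nontrivial
   automorphism is composition with t |-> 1 - t. *)

Set Implicit Arguments.
Unset Strict Implicit.
Unset Printing Implicit Defensive.

Import Order.TTheory GRing.Theory Num.Theory numFieldNormedType.Exports.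
Local Open Scope ring_scope.

(** Equality in K_0 only says that two projections become equivalent after a common projection is
    added, possibly in larger matrices, so cancellation has to be proved in matrix algebras over
    [A]. These carry here just the entrywise norm [mx_norm1], which is submultiplicative, complete
    and star-invariant but not a C*-norm. Properness, that [st x * x = 0] forces [x = 0], is
    therefore used only inside finite-dimensional pieces. The perturbation steps rely on a Banach
    norm alone: projections may have norm above 1, and inverse square roots come from an iteration
    instead of functional calculus. In finite dimension the decomposition into matrix blocks is
    replaced by the trace of the regular representation, integral on idempotents and faithful, which
    allows a partial isometry to be chosen maximal. Matrices over [A] are scaled by [A], so complex
    scalars enter as a central ring morphism [sc], which serves [A] and its matrix algebras
    alike. *)

Record star_algebra (C : numClosedFieldType) (B : nzRingType)
    (sc : {rmorphism C -> B}) (st : B -> B) : Prop := StarAlgebra {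
  scC : forall c x, x * sc c = sc c * x;
  stK : involutive st;
  stD : {morph st : x y / x + y};
  stM : forall x y, st (x * y) = st y * st x;
  st_sc : forall c, st (sc c) = sc c^*
}.

Record star_subalgebra (C : numClosedFieldType) (B : nzRingType)
    (sc : {rmorphism C -> B}) (st : B -> B) (S : B -> Prop) : Prop :=
  StarSubalgebra {
  sub_sc : forall c, S (sc c);
  subD : forall x y, S x -> S y -> S (x + y);
  subM : forall x y, S x -> S y -> S (x * y);
  sub_st : forall x, S x -> S (st x)
}.

Definition finite_span (C : numClosedFieldType) (B : nzRingType)
    (sc : {rmorphism C -> B}) (S : B -> Prop) :=
  exists (I : finType) (b : I -> B), forall x, S x ->
    exists c : I -> C, x = \sum_i sc (c i) * b i.

(** * Finite-dimensional star-algebras *)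

Section StarAlgebra.
Variables (C : numClosedFieldType) (B : nzRingType).
Variables (sc : {rmorphism C -> B}) (st : B -> B).
Hypothesis alg : star_algebra sc st.

Lemma st0 : st 0 = 0.
Proof. by apply: (@addrI _ (st 0)); rewrite -(stD alg) !addr0. Qed.

Lemma st1 : st 1 = 1.
Proof. by rewrite -(rmorph1 sc) (st_sc alg) conjC1. Qed.

Lemma stN x : st (- x) = - st x.
Proof. by apply: (@addrI _ (st x)); rewrite -(stD alg) !subrr st0. Qed.

Lemma stB x y : st (x - y) = st x - st y.
Proof. by rewrite (stD alg) stN. Qed.

Lemma st_sum I (r : seq I) P F :
  st (\sum_(i <- r | P i) F i) = \sum_(i <- r | P i) st (F i).
Proof. exact: (big_morph _ (stD alg) st0). Qed.

Lemma stZ c x : st (sc c * x) = sc c^* * st x.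
Proof. by rewrite (stM alg) (st_sc alg) (scC alg). Qed.

Lemma scK c x : c != 0 -> sc c^-1 * (sc c * x) = x.
Proof. by move=> c0; rewrite mulrA -rmorphM mulVf// rmorph1 mul1r. Qed.

Section Sub.
Variable S : B -> Prop.
Hypothesis subS : star_subalgebra sc st S.

Lemma sub1 : S 1. Proof. by rewrite -(rmorph1 sc); exact: sub_sc subS _. Qed.
Lemma sub0 : S 0. Proof. by rewrite -(rmorph0 sc); exact: sub_sc subS _. Qed.
Lemma subZ c x : S x -> S (sc c * x).
Proof. by apply: subM subS _ _ _; exact: sub_sc subS _. Qed.
Lemma subN x : S x -> S (- x).
Proof. by move=> /(@subZ (-1)); rewrite rmorphN1 mulN1r. Qed.
Lemma subB x y : S x -> S y -> S (x - y).
Proof. by move=> Sx Sy; apply: (subD subS Sx); exact: subN. Qed.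
Lemma sub_sum I (r : seq I) (P : pred I) F :
  (forall i, P i -> S (F i)) -> S (\sum_(i <- r | P i) F i).
Proof.
by move=> SF; apply: big_ind => //; [exact: sub0 | exact: subD subS].
Qed.

Definition free_family k (b : 'I_k -> B) :=
  forall c : 'I_k -> C, \sum_i sc (c i) * b i = 0 -> forall i, c i = 0.

(** The spanning family may lie outside [S], so the basis is a free family inside [S] of maximal
    length. The length is bounded because coordinates of a longer family in the spanning one form a
    matrix with a nonzero kernel vector. *)
Lemma finite_span_basis : finite_span sc S ->
  exists (d : nat) (b : 'I_d -> B), [/\ forall i, S (b i), free_family b &
    forall x, S x -> exists c : 'I_d -> C, x = \sum_i sc (c i) * b i].
Proof.
move=> [I [b0 b0P]].
pose P k := `[< exists b : 'I_k -> B, (forall i, S (b i)) /\ free_family b >].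
have P0 : exists k, P k.
  exists 0%N; apply/asboolP; exists (fun=> 0); split; first by case.
  by move=> c _ [].
have Pb k : P k -> (k <= #|I|)%N.
  move=> /asboolP[b [Sb fb]]; rewrite leqNgt; apply/negP => kI.
  have /choice[m mP] : forall i, exists c : I -> C, b i = \sum_j sc (c j) * b0 j.
    by move=> i; exact: b0P.
  pose M : 'M[C]_(k, #|I|) := \matrix_(i, j) m i (enum_val j).
  have : kermx M != 0.
    rewrite kermx_eq0 /row_free; apply: contraL kI => /eqP<-.
    by rewrite -leqNgt; exact: rank_leq_col.
  move=> /rowV0Pn[u /sub_kermxP uM u0].
  have : forall i, u 0 i = 0.
    apply: fb; under eq_bigr => i _ do rewrite mP mulr_sumr.
    rewrite exchange_big /=; apply: big1 => j _.
    under eq_bigr => i _ do rewrite mulrA -rmorphM.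
    rewrite -mulr_suml -rmorph_sum.
    have /matrixP/(_ 0 (enum_rank j)) := uM; rewrite !mxE => uMj.
    rewrite -[X in sc X](_ : 0 = _) ?rmorph0 ?mul0r// -[LHS]uMj.
    by apply: eq_bigr => i _; rewrite mxE enum_rankK.
  by move=> u00; case/eqP: u0; apply/rowP => i; rewrite u00 mxE.
case: (ex_maxnP P0 Pb) => d /asboolP[b [Sb fb]] dmax.
exists d, b; split=> // x Sx.
(* [insub] fails exactly at the last index, so [b'] is [b] followed by [x]. *)
pose b' (i : 'I_d.+1) := oapp b x (insub (val i)).
have b'w j : b' (widen_ord (leqnSn d) j) = b j by rewrite /b' /= valK.
have b'm : b' ord_max = x by rewrite /b' insubN //= ltnn.
have : ~ free_family b'.
  move=> fb'; suff : P d.+1 by move=> /dmax; rewrite ltnn.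
  apply/asboolP; exists b'; split=> // i; rewrite /b'.
  by case: (insub _).
move=> /existsNP[c /not_implyP[cb /existsNP[i ci]]].
move: cb; rewrite big_ord_recr /= b'm; under eq_bigr => j _ do rewrite b'w.
set cm := c ord_max; have [c0|c0] := eqVneq cm 0.
  rewrite c0 rmorph0 mul0r addr0 => /fb cj; case: ci.
  have [id|di] := ltnP i d.
    by rewrite -(cj (Ordinal id)); congr c; exact/val_inj.
  rewrite -c0; congr c; apply/val_inj/eqP; rewrite eqn_leq di andbT.
  by rewrite -ltnS; exact: ltn_ord.
move=> /eqP; rewrite addrC addr_eq0 => /eqP cx.
exists (fun j => - cm^-1 * c (widen_ord (leqnSn d) j)).
rewrite -[LHS](scK x c0) cx mulrN -mulNr -rmorphN mulr_sumr.
by apply: eq_bigr => j _; rewrite mulrA -rmorphM.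
Qed.
End Sub.
End StarAlgebra.

(** A rank factorization [M = Y *m X] of an idempotent satisfies [X *m Y = 1%:M], and both products
    have the same trace. *)
Lemma mxtrace_idempotent (F : fieldType) n (M : 'M[F]_n) :
  M *m M = M -> \tr M = (\rank M)%:R.
Proof.
move=> MM; have /row_freeP[r rK] := row_base_free M.
have /row_fullP[c cK] := col_base_full M.
move: (row_base M) (col_base M) (mulmx_base M) r rK c cK => X Y ME r rK c cK.
rewrite -[in LHS]ME mxtrace_mulC; suff -> : X *m Y = 1%:M by rewrite mxtrace1.
have : c *m (Y *m X *m (Y *m X)) *m r = c *m (Y *m X) *m r by rewrite ME MM.
by rewrite !mulmxA cK !mul1mx -!mulmxA rK mulmx1.
Qed.

(** * The regular representation and its trace *)

Section Regular.
Variables (C : numClosedFieldType) (B : nzRingType).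
Variables (sc : {rmorphism C -> B}) (st : B -> B).
Hypothesis alg : star_algebra sc st.
Variable S : B -> Prop.
Hypothesis subS : star_subalgebra sc st S.
Variables (d : nat) (b : 'I_d -> B).
Hypotheses (Sb : forall i, S (b i)) (fb : free_family sc b).
Hypothesis spanb :
  forall x, S x -> exists c : 'I_d -> C, x = \sum_i sc (c i) * b i.

Definition lin_comb (u : 'rV[C]_d) : B := \sum_i sc (u 0 i) * b i.

Lemma lin_combD u v : lin_comb (u + v) = lin_comb u + lin_comb v.
Proof.
rewrite -big_split; apply: eq_bigr => i _.
by rewrite mxE rmorphD mulrDl.
Qed.

Lemma lin_combZ c u : lin_comb (c *: u) = sc c * lin_comb u.
Proof.
by rewrite mulr_sumr; apply: eq_bigr => i _; rewrite mxE rmorphM mulrA.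
Qed.

Lemma lin_comb0 : lin_comb 0 = 0.
Proof. by rewrite /lin_comb big1// => i _; rewrite mxE rmorph0 mul0r. Qed.

Lemma lin_comb_eq0 u : lin_comb u = 0 -> u = 0.
Proof. by move=> /fb u0; apply/rowP => i; rewrite u0 mxE. Qed.

Lemma lin_comb_inj : injective lin_comb.
Proof.
move=> u v uv; apply/eqP; rewrite -subr_eq0; apply/eqP/lin_comb_eq0.
by rewrite -scaleN1r lin_combD lin_combZ rmorphN1 mulN1r uv subrr.
Qed.

Lemma lin_comb_sum I (r : seq I) (F : I -> 'rV[C]_d) :
  lin_comb (\sum_(i <- r) F i) = \sum_(i <- r) lin_comb (F i).
Proof.
exact: (big_morph _ lin_combD lin_comb0).
Qed.

Definition basis_coord (x : B) : 'rV[C]_d :=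
  xget 0 (fun u : 'rV_d => x = lin_comb u).

Lemma basis_coordK x : S x -> lin_comb (basis_coord x) = x.
Proof.
move=> /spanb[c xE]; rewrite /basis_coord.
case: xgetP => [u _ //|/(_ (\row_i c i))[]].
by rewrite xE; apply: eq_bigr => i _; rewrite mxE.
Qed.

(** Matrices act on row vectors from the right, so [lmx] reverses products; the trace does not see
    this. *)
Definition lmx (x : B) : 'M[C]_d := \matrix_(i < d) basis_coord (x * b i).

Lemma lmxP x u : S x -> lin_comb (u *m lmx x) = x * lin_comb u.
Proof.
move=> Sx; rewrite mulmx_sum_row lin_comb_sum [in RHS]/lin_comb mulr_sumr.
apply: eq_bigr => i _.
rewrite lin_combZ rowK basis_coordK; last exact: (subM subS).
by rewrite !mulrA (scC alg).
Qed.

Lemma lmx_uniq x M : S x -> (forall u, lin_comb (u *m M) = x * lin_comb u) -> lmx x = M.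
Proof.
move=> Sx MP; apply/row_matrixP => i; apply: lin_comb_inj.
by rewrite !rowE lmxP// MP.
Qed.

Lemma lmx_inj0 x : S x -> lmx x = 0 -> x = 0.
Proof.
move=> Sx x0; have := lmxP (basis_coord 1) Sx; rewrite x0 mulmx0.
rewrite basis_coordK ?mulr1; last exact: (sub1 subS).
by move=> <-; exact: lin_comb0.
Qed.

Lemma lmxM x y : S x -> S y -> lmx (x * y) = lmx y *m lmx x.
Proof.
move=> Sx Sy; apply: lmx_uniq => [|u]; first exact: (subM subS).
by rewrite mulmxA !lmxP// mulrA.
Qed.

Lemma lmxD x y : S x -> S y -> lmx (x + y) = lmx x + lmx y.
Proof.
move=> Sx Sy; apply: lmx_uniq => [|u]; first exact: (subD subS).
by rewrite mulmxDr lin_combD !lmxP// mulrDl.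
Qed.

Lemma lmxZ c x : S x -> lmx (sc c * x) = c *: lmx x.
Proof.
move=> Sx; apply: lmx_uniq => [|u]; first exact: (subZ subS).
by rewrite -scalemxAr lin_combZ !lmxP// mulrA.
Qed.

(** On an idempotent this trace is the rank of a matrix, hence a natural number that vanishes only
    at 0. *)
Definition rtr (x : B) : C := \tr (lmx x).

Lemma rtrD x y : S x -> S y -> rtr (x + y) = rtr x + rtr y.
Proof. by move=> Sx Sy; rewrite /rtr lmxD// linearD. Qed.

Lemma rtrZ c x : S x -> rtr (sc c * x) = c * rtr x.
Proof. by move=> Sx; rewrite /rtr lmxZ// linearZ. Qed.

Lemma rtr0 : rtr 0 = 0.
Proof.
by have := rtrZ 0 (sub0 subS); rewrite mulr0 mul0r.
Qed.

Lemma rtr_sum I (r : seq I) (P : pred I) F : (forall i, P i -> S (F i)) ->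
  rtr (\sum_(i <- r | P i) F i) = \sum_(i <- r | P i) rtr (F i).
Proof.
move=> SF; suff [] : S (\sum_(i <- r | P i) F i) /\
  rtr (\sum_(i <- r | P i) F i) = \sum_(i <- r | P i) rtr (F i) by [].
elim/big_rec2: _ => [|i y1 y2 Pi [Sy <-]].
  by split; [exact: (sub0 subS) | exact: rtr0].
by split; [apply: (subD subS) => //; exact: SF | rewrite rtrD//; exact: SF].
Qed.

Lemma rtrC x y : S x -> S y -> rtr (x * y) = rtr (y * x).
Proof. by move=> Sx Sy; rewrite /rtr !lmxM// mxtrace_mulC. Qed.

Lemma rtr_idem p : S p -> p * p = p -> rtr p = (\rank (lmx p))%:R.
Proof. by move=> Sp pp; apply: mxtrace_idempotent; rewrite -lmxM// pp. Qed.

Lemma rtr_idem_ge0 p : S p -> p * p = p -> 0 <= rtr p.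
Proof. by move=> Sp pp; rewrite rtr_idem// ler0n. Qed.

Lemma rtr_idem_eq0 p : S p -> p * p = p -> rtr p = 0 -> p = 0.
Proof.
move=> Sp pp /eqP; rewrite rtr_idem// pnatr_eq0 mxrank_eq0 => /eqP.
exact: lmx_inj0.
Qed.

(** The [d.+1] powers of [x] up to [x ^+ d] are linearly dependent in dimension [d]. *)
Lemma annihilator x : S x ->
  exists2 p : {poly C}, p != 0 & \sum_(i < size p) sc p`_i * x ^+ i = 0.
Proof.
move=> Sx.
have Sxn n : S (x ^+ n).
  elim: n => [|n IH]; first by rewrite expr0; exact: (sub1 subS).
  by rewrite exprS; exact: (subM subS).
pose M : 'M[C]_(d.+1, d) := \matrix_(i < d.+1) basis_coord (x ^+ i).
have : kermx M != 0.
  rewrite kermx_eq0 /row_free; apply/negP => /eqP rM.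
  by have := rank_leq_col M; rewrite rM ltnn.
move=> /rowV0Pn[u /sub_kermxP uM u0].
exists (rVpoly u); first by apply: contra u0 => /eqP p0; rewrite -[u]rVpolyK p0 linear0.
have : lin_comb (u *m M) = 0.
  by rewrite uM lin_comb0.
rewrite mulmx_sum_row lin_comb_sum.
have -> : \sum_(i < d.+1) lin_comb (u 0 i *: row i M) =
          \sum_(i < d.+1) sc (rVpoly u)`_i * x ^+ i.
  apply: eq_bigr => i _; rewrite lin_combZ rowK basis_coordK// coef_rVpoly.
  case: insubP => [j _ ji|]; last by rewrite ltn_ord.
  by congr (sc (u 0 _) * _); exact: val_inj.
move=> uM0; rewrite (big_ord_widen d.+1 (fun i => sc (rVpoly u)`_i * x ^+ i)).
  rewrite -[RHS]uM0 [LHS]big_mkcond; apply: eq_bigr => i _; case: ltnP => // le.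
  by rewrite nth_default// rmorph0 mul0r.
by rewrite /rVpoly; exact: size_poly.
Qed.

End Regular.

Lemma not_uniq_perm (T : eqType) (r : seq T) :
  ~~ uniq r -> exists z r', perm_eq r [:: z, z & r'].
Proof.
elim: r => //= x r IH; rewrite negb_and negbK => /orP[xr|/IH[z [r' rE]]].
  by exists x, (rem x r); rewrite perm_cons perm_to_rem.
exists z, (x :: r'); apply: (@perm_trans _ [:: x, z, z & r']).
  by rewrite perm_cons.
by rewrite -[[:: x, z, z & r']]/([:: x] ++ [:: z; z] ++ r') perm_catCA.
Qed.

(** * Spectral decomposition of self-adjoint elements *)

Section Spectral.
Variables (C : numClosedFieldType) (B : nzRingType).
Variables (sc : {rmorphism C -> B}) (st : B -> B).
Hypothesis alg : star_algebra sc st.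

Definition poly_eval x : {poly C} -> B := horner_morph (fun c => scC alg c x).
HB.instance Definition _ x := GRing.RMorphism.on (poly_eval x).

Lemma poly_evalE x p : poly_eval x p = \sum_(i < size p) sc p`_i * x ^+ i.
Proof.
rewrite /poly_eval /horner_morph horner_coef size_map_poly.
by apply: eq_bigr => i _; rewrite coef_map.
Qed.

Lemma poly_eval_sc x c : poly_eval x c%:P = sc c. Proof. exact: horner_morphC. Qed.
Lemma poly_evalX x : poly_eval x 'X = x. Proof. exact: horner_morphX. Qed.

Lemma st_poly_eval h p : st h = h -> st (poly_eval h p) = poly_eval h (map_poly Num.conj p).
Proof.
move=> sth; rewrite !poly_evalE (st_sum alg) size_map_poly; apply: eq_bigr => i _.
rewrite (stZ alg) coef_map; congr (_ * _).
elim: (i : nat) => [|n IH]; first by rewrite !expr0 (st1 alg).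
by rewrite exprS (stM alg) IH sth -exprSr -exprS.
Qed.

Variable S : B -> Prop.
Hypothesis subS : star_subalgebra sc st S.
Hypothesis finS : finite_span sc S.

Lemma sub_poly_eval x p : S x -> S (poly_eval x p).
Proof.
move=> Sx; rewrite poly_evalE; apply: (sub_sum subS) => i _; apply: (subZ subS).
elim: (i : nat) => [|n IH]; first by rewrite expr0; exact: (sub1 subS).
by rewrite exprS; exact: (subM subS).
Qed.

Lemma poly_eval_annihilator x : S x -> exists2 p, p != 0 & poly_eval x p = 0.
Proof.
move=> Sx; have [d [b [Sb fb spanb]]] := finite_span_basis finS.
have [p p0 px] := annihilator subS spanb Sx.
by exists p => //; rewrite poly_evalE.
Qed.

Hypothesis proper : forall x, S x -> st x * x = 0 -> x = 0.

(** Split an annihilating polynomial of least degree over [C] and let [y] be the value at [h] of the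
    cofactor of a root [z]; minimality gives [y <> 0]. As [h * y = sc z * y], the self-adjoint
    element [st y * h * y] equals [sc z * (st y * y)], and properness makes [z] real. At a double
    root, [st y * y] is a multiple of the annihilating product, so properness gives [y = 0], a
    contradiction. *)
Lemma self_adjoint_annihilator h : S h -> st h = h ->
  exists s : seq C, [/\ uniq s, forall z, z \in s -> z^* = z &
    poly_eval h (\prod_(z <- s) ('X - z%:P)) = 0].
Proof.
move=> Sh sth.
pose Q n := `[< exists p, [/\ p != 0, poly_eval h p = 0 & size p = n] >].
have : exists n, Q n.
  have [p p0 ph] := poly_eval_annihilator Sh.
  by exists (size p); apply/asboolP; exists p.
move=> /ex_minnP[n /asboolP[p [p0 ph pn]] nmin].
have [r pr] := closed_field_poly_normal p.
have l0 : lead_coef p != 0 by rewrite lead_coef_eq0.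
pose m := \prod_(z <- r) ('X - z%:P).
have mh : poly_eval h m = 0.
  apply: (can_inj (fun x => scK sc x l0)); rewrite mulr0 -(poly_eval_sc h) -rmorphM.
  by rewrite mul_polyC -pr.
have min q z : q != 0 -> ('X - z%:P) * q = m -> poly_eval h q <> 0.
  move=> q0 qm qh; have : (n <= size q)%N.
    by apply: nmin; apply/asboolP; exists q.
  rewrite -pn pr size_scale// -/m -qm mulrC size_Mmonic ?monicXsubC//.
  by rewrite size_XsubC addn2 /= ltnn.
have m0 : m != 0 by apply/monic_neq0/monic_prod_XsubC.
have factor z r' : perm_eq r (z :: r') ->
    let q := \prod_(z <- r') ('X - z%:P) in
    [/\ ('X - z%:P) * q = m, poly_eval h q <> 0, S (poly_eval h q) &
        h * poly_eval h q = sc z * poly_eval h q].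
  move=> rr' q; have qm : ('X - z%:P) * q = m.
    by rewrite /m (perm_big _ rr')/= big_cons.
  have q0 : q != 0 by apply: contra_neq m0 => q0; rewrite -qm q0 mulr0.
  split=> //; [exact: min qm | exact: sub_poly_eval|].
  apply/eqP; rewrite -subr_eq0 -mulrBl -[in X in X * _](poly_evalX h).
  by rewrite -(poly_eval_sc h z) -rmorphB -rmorphM qm; apply/eqP; exact: mh.
have real z : z \in r -> z^* = z.
  move=> zr; have [_ y0 Sy hy] := factor _ _ (perm_to_rem zr).
  set y := poly_eval h _ in y0 Sy hy.
  have yhy : st y * h * y = sc z * (st y * y).
    by rewrite -mulrA hy mulrA (scC alg) mulrA.
  have := congr1 st yhy; rewrite (stZ alg) !(stM alg) (stK alg) sth mulrA yhy.
  move=> /eqP; rewrite -subr_eq0 -mulrBl -rmorphB => /eqP zz.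
  apply/eqP/negPn/negP => zz0; apply: y0; apply: proper => //.
  by rewrite -(scK sc (st y * y) (_ : z - z^* != 0)) ?zz ?mulr0// subr_eq0 eq_sym.
exists r; split=> //.
apply/negPn/negP => /not_uniq_perm[z [r' rE]].
have [_ y0 Sy hy] := factor _ _ rE.
apply: y0; rewrite big_cons rmorphM rmorphB /= poly_evalX poly_eval_sc.
apply: proper.
  by apply: (subM subS); [apply: (subB subS) => //; exact: (sub_sc subS)
                          |exact: sub_poly_eval].
have zr : z \in r by rewrite (perm_mem rE) mem_head.
rewrite (stM alg) (stB alg) sth (st_sc alg) (real _ zr).
rewrite -!mulrA [X in _ * X]mulrA [X in _ * X](_ : _ = 0) ?mulr0//.
have := mh; rewrite /m (perm_big _ rE) /= !big_cons !rmorphM !rmorphB /= !poly_evalX !poly_eval_sc.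
by rewrite mulrA.
Qed.

(** The projections are the Lagrange interpolation polynomials [L z] evaluated at [h]. Polynomials
    that agree on [s] take the same value at [h], so each identity is checked at the points of [s]
    only. *)
Lemma spectral h : S h -> st h = h ->
  exists (s : seq C) (P : C -> B), [/\ uniq s,
    forall z, z \in s -> z^* = z, \sum_(z <- s) P z = 1 &
    forall z, z \in s ->
      [/\ S (P z), st (P z) = P z, P z * P z = P z & h * P z = sc z * P z]].
Proof.
move=> Sh sth.
have [s [us reals sh]] := self_adjoint_annihilator Sh sth.
have vanish p q : (forall z, z \in s -> p.[z] = q.[z]) -> poly_eval h p = poly_eval h q.
  move=> pq; apply/eqP; rewrite -subr_eq0 -rmorphB.
  have /dvdpP[k ->] : \prod_(z <- s) ('X - z%:P) %| p - q.
    apply: uniq_roots_dvdp; last by rewrite uniq_rootsE.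
    by apply/allP => z zs; rewrite rootE hornerD hornerN pq// subrr.
  by rewrite rmorphM /= sh mulr0.
pose l z := \prod_(w <- s | w != z) ('X - w%:P).
pose L z := ((l z).[z])^-1 *: l z.
have LE z w : z \in s -> w \in s -> (L z).[w] = (w == z)%:R.
  move=> zs ws; rewrite hornerZ; have [->|wz] := eqVneq w z.
    rewrite mulVf// horner_prod prodf_seq_neq0; apply/allP => u us'.
    by apply/implyP => uz; rewrite hornerXsubC subr_eq0 eq_sym.
  rewrite [X in _ * X](_ : _ = 0) ?mulr0// horner_prod.
  apply/eqP; rewrite prodf_seq_eq0; apply/hasP; exists w => //.
  by rewrite wz hornerXsubC subrr eqxx.
exists s, (fun z => poly_eval h (L z)); split=> //.
  rewrite -rmorph_sum -(rmorph1 (poly_eval h)); apply: vanish => z zs.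
  rewrite horner_sum hornerC (bigD1_seq z)//= LE// eqxx.
  rewrite big_seq_cond big1 ?addr0// => w /andP[ws /negPf wz].
  by rewrite LE// eq_sym wz.
move=> z zs; split; first exact: sub_poly_eval.
- rewrite st_poly_eval//; apply: vanish => w ws.
  have -> : (map_poly Num.conj (L z)).[w] = (map_poly Num.conj (L z)).[w^*] by rewrite reals.
  by rewrite horner_map LE//= conjC_nat.
- rewrite -rmorphM; apply: vanish => w ws.
  by rewrite hornerM LE//; case: eqP => _; rewrite ?mulr1 ?mulr0.
- rewrite -[X in X * _](poly_evalX h) -(poly_eval_sc h) -!rmorphM; apply: vanish => w ws.
  rewrite !hornerM hornerX hornerC LE//.
  by case: eqP => [->|_]; rewrite ?mulr0.
Qed.

End Spectral.

(** * Faithful traces and comparison of projections *)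

Record faithful_trace (C : numClosedFieldType) (B : nzRingType)
    (sc : {rmorphism C -> B}) (st : B -> B) (S : B -> Prop) (T : B -> C) :
    Prop := FaithfulTrace {
  traceD : forall x y, S x -> S y -> T (x + y) = T x + T y;
  traceZ : forall c x, S x -> T (sc c * x) = c * T x;
  traceC : forall x y, S x -> S y -> T (x * y) = T (y * x);
  trace_nat : forall p, S p -> p * p = p -> exists n : nat, T p = n%:R;
  trace_ge0 : forall x, S x -> 0 <= T (st x * x);
  trace_eq0 : forall x, S x -> T (st x * x) = 0 -> x = 0
}.

Section Finite.
Variables (C : numClosedFieldType) (B : nzRingType).
Variables (sc : {rmorphism C -> B}) (st : B -> B).
Hypothesis alg : star_algebra sc st.
Variable S : B -> Prop.
Hypothesis subS : star_subalgebra sc st S.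
Hypothesis finS : finite_span sc S.
Hypothesis proper : forall x, S x -> st x * x = 0 -> x = 0.

Lemma scMM c d u v : sc c * u * (sc d * v) = sc (c * d) * (u * v).
Proof. by rewrite rmorphM -!mulrA; congr (_ * _); rewrite !mulrA (scC alg). Qed.

(** For self-adjoint [h] with spectral projections [P z], the regular trace of [h * h] is the sum of
    [z ^+ 2 * T (P z)], with real [z] and ranks [T (P z)]. Positivity and faithfulness are read off
    there and reach [st y * y] through real and imaginary parts. *)
Lemma trace_exists : exists T, faithful_trace sc st S T.
Proof.
have [d [b [Sb fb spanb]]] := finite_span_basis finS.
pose T := rtr sc b.
have TD x y : S x -> S y -> T (x + y) = T x + T y.
  exact: (rtrD alg subS Sb fb spanb).
have TZ c x : S x -> T (sc c * x) = c * T x by exact: (rtrZ alg subS Sb fb spanb).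
have sq h : S h -> st h = h -> 0 <= T (h * h) /\ (T (h * h) = 0 -> h = 0).
  move=> Sh sth.
  have [s [P [us reals P1 PP]]] := spectral alg subS finS proper Sh sth.
  have hP z : z \in s -> h * P z = sc z * P z by move=> /PP[].
  have SP z : z \in s -> S (P z) by move=> /PP[].
  have PPz z : z \in s -> P z * P z = P z by move=> /PP[].
  have hE : h = \sum_(z <- s | z \in s) sc z * P z.
    by rewrite -big_seq -[LHS]mulr1 -P1 mulr_sumr; apply: eq_big_seq.
  have hhE : T (h * h) = \sum_(z <- s | z \in s) z ^+ 2 * T (P z).
    rewrite [in X in h * X]hE mulr_sumr /T (rtr_sum alg subS Sb fb spanb); last first.
      by move=> z zs; apply: (subM subS) => //; apply: (subZ subS); exact: SP.
    apply: eq_bigr => z zs; rewrite -/T.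
    rewrite mulrA (scC alg) -mulrA hP// mulrA -rmorphM TZ ?expr2//.
    exact: SP.
  have pos z : z \in s -> 0 <= z ^+ 2 * T (P z).
    move=> zs; rewrite mulr_ge0 ?(rtr_idem_ge0 alg subS Sb fb spanb)//; last 2 first.
      exact: SP.
      exact: PPz.
    by rewrite real_exprn_even_ge0//; apply/CrealP; exact: reals.
  rewrite hhE; split; first exact: sumr_ge0.
  move=> /eqP; rewrite psumr_eq0// => /allP T0.
  rewrite hE big1// => z zs; have := T0 _ zs.
  rewrite zs /= mulf_eq0 => /orP[|/eqP].
    by rewrite expf_eq0/= => /eqP->; rewrite rmorph0 mul0r.
  move=> /(rtr_idem_eq0 alg subS Sb fb spanb) -> //; first by rewrite mulr0.
    exact: SP.
  exact: PPz.
have TN x : S x -> T (- x) = - T x.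
  by move=> Sx; rewrite -mulN1r -(rmorphN1 sc) TZ// mulN1r.
(* Up to a commutator, 4 (st y) y is the sum of the squares of y + st y and i (y - st y). *)
have T4 y : S y -> let a := y + st y in let c := sc 'i * (y - st y) in
    [/\ S a, st a = a, S c, st c = c & T (a * a) + T (c * c) = 4 * T (st y * y)].
  move=> Sy a c; have Ssy := sub_st subS Sy.
  split; first exact: (subD subS).
  - by rewrite (stD alg) (stK alg) addrC.
  - by apply: (subZ subS); exact: (subB subS).
  - by rewrite (stZ alg) (stB alg) (stK alg) conjCi rmorphN mulNr -mulrN opprB.
  have Syy := subM subS Sy Sy; have Sys := subM subS Sy Ssy.
  have Ssys := subM subS Ssy Sy; have Sss := subM subS Ssy Ssy.
  have -> : c * c = sc (-1) * ((y - st y) * (y - st y)).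
    by rewrite -sqrCi expr2 rmorphM !mulrA -(mulrA _ (y - _)) (scC alg) !mulrA.
  have D4 u v w x : S u -> S v -> S w -> S x ->
      T (u + v + (w + x)) = T u + T v + (T w + T x).
    by move=> *; rewrite !TD//; apply: (subD subS).
  have Nys := subN subS Sys; have Nsy := subN subS Ssys.
  rewrite TZ; last by apply: (subM subS); exact: (subB subS).
  have -> : (y - st y) * (y - st y) =
      y * y + - (y * st y) + (- (st y * y) + st y * st y).
    by rewrite mulrBl !mulrBr opprD opprK.
  rewrite /a mulrDl !mulrDr !D4// !TN//.
  rewrite -/T [T (y * st y)](rtrC alg subS Sb fb spanb)// -/T.
  ring.
exists T; split=> //.
- by move=> x y; exact: (rtrC alg subS Sb fb spanb).
- by move=> p Sp pp; eexists; exact: (rtr_idem alg subS Sb fb spanb).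
- move=> y Sy; have [Sa sta Sc stc E] := T4 _ Sy.
  have [a0 _] := sq _ Sa sta; have [c0 _] := sq _ Sc stc.
  by rewrite -(pmulr_rge0 _ (_ : 0 < 4)) ?ltr0n// -E addr_ge0.
- move=> y Sy y0; have [Sa sta Sc stc] := T4 _ Sy.
  rewrite y0 mulr0 => /eqP.
  have [a0 a00] := sq _ Sa sta; have [c0 c00] := sq _ Sc stc.
  rewrite paddr_eq0// => /andP[/eqP/a00 ya /eqP/c00 yc].
  have /eqP : y - st y = 0 by rewrite -[LHS](scK sc _ (neq0Ci C)) yc mulr0.
  rewrite subr_eq0 => /eqP yy; move: ya; rewrite -yy -mulr2n -mulr_natl => /eqP.
  rewrite -(rmorph_nat sc) => /eqP y2.
  by rewrite -[LHS](scK sc _ (_ : 2%:R != 0)) ?pnatr_eq0// y2 mulr0.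
Qed.

(** Some eigenvalue [l] of [st z * z] has [sc l * P l <> 0], since otherwise properness gives
    [z = 0]. Its sign comes from the trace: [l * T (P l)] is the trace of
    [st (z * P l) * (z * P l)], and [T (P l)] is positive. *)
Lemma positive_eigenvalue z : S z -> z <> 0 ->
  exists (lam : C) (P : B), [/\ 0 < lam, [/\ S P, st P = P & P * P = P], P <> 0 &
    st z * z * P = sc lam * P].
Proof.
move=> Sz z0; pose h := st z * z.
have Sh : S h by apply: (subM subS) => //; exact: (sub_st subS).
have sth : st h = h by rewrite (stM alg) (stK alg).
have [s [P [us reals P1 PP]]] := spectral alg subS finS proper Sh sth.
have [T [TD TZ TC _ T0 T00]] := trace_exists.
have [l ls lP] : exists2 l, l \in s & sc l * P l <> 0.
  apply/not_exists2P => no; apply/z0/proper => //.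
  rewrite -/h -[LHS]mulr1 -P1 mulr_sumr big_seq big1// => l ls.
  have [_ _ _ ->] := PP _ ls.
  by have [/(_ ls)[]|/contrapT] := no l.
have [SP stP PPP hP] := PP _ ls.
have P0 : P l <> 0 by move=> P0; apply: lP; rewrite P0 mulr0.
exists l, (P l); split=> //.
have l0 : l != 0 by apply/eqP => l0; apply: lP; rewrite l0 rmorph0 mul0r.
have TP : 0 < T (P l).
  rewrite lt0r -{2}PPP -{2}stP T0// andbT; apply/eqP => TP; apply/P0/T00 => //.
  by rewrite stP PPP.
rewrite lt0r l0 /= -(pmulr_lge0 _ TP) -TZ// -hP -PPP mulrA TC//; last first.
  exact: (subM subS).
have -> : P l * (h * P l) = st (z * P l) * (z * P l).
  by rewrite (stM alg) stP !mulrA.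
by apply: T0; exact: (subM subS).
Qed.

(** One eigenspace of the polar decomposition: [w] is [z * P] divided by the square root of the
    eigenvalue. The factors [k] and [y] exhibit [w] as a right multiple and [P] as a left multiple
    of [z], so that they inherit the orthogonality relations of [z]. *)
Lemma partial_isometry z : S z -> z <> 0 ->
  exists w P y k, [/\ [/\ S w, S P, S y & S k], w = z * k, P = y * z, st w * w = P &
    [/\ P * P = P, st P = P & P <> 0]].
Proof.
move=> Sz z0; have [l [P [l0 [SP stP PP] P0 zP]]] := positive_eigenvalue Sz z0.
have ln0 : l != 0 by rewrite gt_eqF.
have sq0 : sqrtC l != 0 by rewrite sqrtC_eq0.
have stz : st (st z * z) = st z * z by rewrite (stM alg) (stK alg).
exists (z * (sc (sqrtC l)^-1 * P)), P, (sc l^-1 * P * st z),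
  (sc (sqrtC l)^-1 * P).
have Sk : S (sc (sqrtC l)^-1 * P) by exact: (subZ subS).
split=> //.
- split=> //; first exact: (subM subS).
  by apply: (subM subS); [exact: (subZ subS) | exact: (sub_st subS)].
- have := congr1 st zP; rewrite (stM alg) stz stP (stZ alg) stP => PzE.
  rewrite -!mulrA PzE (_ : l^* = l) ?scK//.
  by apply/CrealP; rewrite gtr0_real.
- have -> : z * (sc (sqrtC l)^-1 * P) = sc (sqrtC l)^-1 * (z * P).
    by rewrite !mulrA (scC alg).
  rewrite (stZ alg) (_ : _^* = (sqrtC l)^-1); last first.
    by apply/CrealP; rewrite ger0_real// invr_ge0 sqrtC_ge0 ltW.
  rewrite scMM (stM alg) stP -!mulrA (mulrA (st z)) zP.
  rewrite (mulrA P) (scC alg) -mulrA PP mulrA -rmorphM.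
  by rewrite -{3}(sqrtCK l) expr2 mulrACA mulVf// mulr1 rmorph1 mul1r.
Qed.

Lemma proper_eq x y : S x -> S y -> st (x - y) * (x - y) = 0 -> x = y.
Proof.
move=> Sx Sy xy; apply/eqP; rewrite -subr_eq0; apply/eqP/proper => //.
exact: (subB subS).
Qed.

Lemma partial_isometry_source w p : S w -> st w * w = p -> p * p = p -> w * p = w.
Proof.
move=> Sw wp pp; have Sp : S p by rewrite -wp; apply: (subM subS) => //; exact: (sub_st subS).
apply: proper_eq => //; first exact: (subM subS).
have stp : st p = p by rewrite -wp (stM alg) (stK alg).
rewrite (stB alg) (stM alg) stp mulrBl !mulrBr -!mulrA !(mulrA (st w)) wp pp.
by rewrite subrr !pp !subrr.
Qed.

(** Among the partial isometries from below [a] to below [b], take one whose source has the largest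
    trace, an integer at most [T 1]. A nonzero element of the remaining corner would yield, by
    [partial_isometry], a partial isometry orthogonal to [w], and adding it raises that integer. *)
Lemma projection_comparison a b : S a -> st a = a -> a * a = a ->
  S b -> st b = b -> b * b = b ->
  exists w, [/\ S w, w * a = w, b * w = w, st w * w * (st w * w) = st w * w &
    forall x, S x -> (b - w * st w) * x * (a - st w * w) = 0].
Proof.
move=> Sa sta aa Sb stb bb.
have [T [TD TZ TC Tn T0 T00]] := trace_exists.
pose Q n := `[< exists w, [/\ S w, w * a = w, b * w = w,
  st w * w * (st w * w) = st w * w & T (st w * w) = n%:R] >].
have S1 := sub1 subS.
have [N TN] : exists n : nat, T 1 = n%:R by apply: Tn; rewrite ?mulr1.
have Q0 : exists n, Q n.
  exists 0%N; apply/asboolP; exists 0; rewrite (st0 alg) !mulr0 !mul0r.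
  have S0 := sub0 subS; split=> //.
  by have := TZ 0 0 S0; rewrite rmorph0 !mul0r.
have QN n : Q n -> (n <= N)%N.
  move=> /asboolP[w [Sw _ _ ww Tw]]; rewrite -(ler_nat C) -TN -Tw.
  have Sp : S (st w * w) by apply: (subM subS) => //; exact: (sub_st subS).
  have : 0 <= T (1 - st w * w).
    have -> : 1 - st w * w = st (1 - st w * w) * (1 - st w * w).
      rewrite (stB alg) (stM alg) (stK alg) (st1 alg).
      by rewrite mulrBl mul1r mulrBr mulr1 ww subrr subr0.
    by apply: T0; exact: (subB subS).
  rewrite -mulN1r -(rmorphN1 sc) TD//; last exact: (subZ subS).
  by rewrite TZ// mulN1r subr_ge0.
case: (ex_maxnP Q0 QN) => n /asboolP[w [Sw wa bw]].
set p := st w * w => pp Tp nmax; exists w; split=> // x Sx; rewrite -/p.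
have Ssw := sub_st subS Sw; have Sp : S p by exact: (subM subS).
have wp : w * p = w by exact: partial_isometry_source.
have stp : st p = p by rewrite /p (stM alg) (stK alg).
have psw : p * st w = st w by rewrite -stp -(stM alg) wp.
have swb : st w * b = st w by rewrite -stb -(stM alg) bw.
have asw : a * st w = st w by rewrite -sta -(stM alg) wa.
have pa : p * a = p by rewrite /p -mulrA wa.
have ap : a * p = p by rewrite /p mulrA asw.
set z := _ * _ * _; apply: contrapT => z0.
have Sz : S z.
  by do !apply: (subM subS) => //; apply: (subB subS) => //; exact: (subM subS).
have [w1 [P [y [k [[Sw1 SP Sy Sk] w1E PE w1P [PP stP P0]]]]]] := partial_isometry Sz z0.
have ca : (a - p) * a = a - p by rewrite mulrBl aa pa.
have cp : (a - p) * p = 0 by rewrite mulrBl ap pp subrr.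
have bd : b * (b - w * st w) = b - w * st w by rewrite mulrBr bb mulrA bw.
have swd : st w * (b - w * st w) = 0.
  by rewrite mulrBr swb mulrA -/p psw subrr.
have za : z * a = z by rewrite /z -mulrA ca.
have zp : z * p = 0 by rewrite /z -mulrA cp mulr0.
have bz : b * z = z by rewrite /z !mulrA bd.
have swz : st w * z = 0 by rewrite /z !mulrA swd !mul0r.
have w1P1 : w1 * P = w1 by exact: partial_isometry_source.
have Pp : P * p = 0 by rewrite PE -mulrA zp mulr0.
have pP : p * P = 0 by rewrite -stp -stP -(stM alg) Pp (st0 alg).
have Pa : P * a = P by rewrite PE -mulrA za.
have sww1 : st w * w1 = 0 by rewrite w1E mulrA swz mul0r.
have sw1w : st w1 * w = 0 by rewrite -(stK alg w) -(stM alg) sww1 (st0 alg).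
have WE : st (w + w1) * (w + w1) = p + P.
  by rewrite (stD alg) mulrDl !mulrDr sww1 sw1w w1P addr0 add0r.
have [m Tm] := Tn _ SP PP.
have m0 : (0 < m)%N.
  rewrite lt0n; apply/eqP => m0; apply/P0/T00 => //.
  by rewrite stP PP Tm m0.
have : Q (n + m)%N.
  apply/asboolP; exists (w + w1); split.
  - exact: (subD subS).
  - by rewrite mulrDl wa -[in X in _ + X]w1P1 -mulrA Pa w1P1.
  - by rewrite mulrDr bw w1E mulrA bz.
  - by rewrite WE mulrDl !mulrDr pp Pp pP PP addr0 add0r.
  - by rewrite WE TD// Tp Tm natrD.
by move=> /nmax; rewrite -{2}[n]addn0 leq_add2l leqNgt m0.
Qed.

(* If e were nonzero, V would act as a shift, which no nonzero polynomial annihilates. *)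
Lemma shift_trivial V e f : S V -> S e -> S f ->
  st e = e -> e * e = e -> st f = f ->
  st V * V = 1 - e -> V * st V = 1 - f ->
  (forall x, S x -> f * x * e = 0) -> e = 0.
Proof.
move=> SV Se Sf ste ee stf VV VV' fe.
have ef x : S x -> e * x * f = 0.
  move=> Sx; rewrite -[LHS](stK alg) [st (_ * f)](_ : _ = 0) ?(st0 alg)//.
  by rewrite !(stM alg) ste stf mulrA fe//; exact: (sub_st subS).
have Ve : V * e = 0.
  apply: proper; first exact: (subM subS).
  rewrite (stM alg) ste -mulrA (mulrA (st V)) VV mulrBl mul1r ee subrr.
  by rewrite mulr0.
have [p p0 pV] := poly_eval_annihilator alg subS finS SV.
have : e * poly_eval alg V p = 0 by rewrite pV mulr0.
elim/poly_ind: p p0 {pV} => [|p c IH]; first by rewrite eqxx.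
have Sp : S (poly_eval alg V p) by exact: (sub_poly_eval alg subS).
move=> pc0; rewrite rmorphD rmorphM /= poly_evalX poly_eval_sc => epc.
have ce : sc c * e = 0.
  have := congr1 (fun x => x * e) epc; rewrite mul0r mulrDr mulrDl.
  by rewrite -!mulrA Ve !mulr0 add0r mulrA (scC alg) -mulrA ee.
have [c0|c0] := eqVneq c 0; last by rewrite -(scK sc e c0) ce mulr0.
move: pc0 epc; rewrite c0 (rmorph0 sc) polyC0 !addr0 mulf_eq0 negb_or => /andP[p0 _] epV.
apply: IH => //; have := congr1 (fun x => x * st V) epV.
by rewrite mul0r -!mulrA VV' !mulrBr mulr1 mulrA ef// subr0.
Qed.

(** Comparing the complements [a = 1 - e] and [b = 1 - f] gives [w]. Then [v + w] fails to be
    unitary only by the leftovers [a - p] and [b - w * st w], between which every element of [S]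
    vanishes; [shift_trivial] kills both. *)
Lemma complement_equiv e f v : S v -> S e -> S f ->
  st e = e -> e * e = e -> st f = f -> f * f = f ->
  st v * v = e -> v * st v = f ->
  exists w, [/\ S w, st w * w = 1 - e & w * st w = 1 - f].
Proof.
move=> Sv Se Sf ste ee stf ff vE vF; have S1 := sub1 subS.
have ve : v * e = v by exact: partial_isometry_source.
have fv : f * v = v by rewrite -vF -mulrA vE.
have compl x : S x -> st x = x -> x * x = x ->
    [/\ S (1 - x), st (1 - x) = 1 - x & (1 - x) * (1 - x) = 1 - x].
  move=> Sx stx xx; split; first exact: (subB subS).
    by rewrite (stB alg) (st1 alg) stx.
  by rewrite mulrBl mul1r mulrBr mulr1 xx subrr subr0.
have [Sa sta aa] := compl e Se ste ee; have [Sb stb bb] := compl f Sf stf ff.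
have [w [Sw wa bw pp wz]] := projection_comparison Sa sta aa Sb stb bb.
set a := 1 - e in Sa sta aa wa wz *; set b := 1 - f in Sb stb bb bw wz *.
have Ssw := sub_st subS Sw; have Ssv := sub_st subS Sv.
set p := st w * w in pp wz.
have Sp : S p by exact: (subM subS).
have Sq : S (w * st w) by exact: (subM subS).
have wp : w * p = w by exact: partial_isometry_source.
have stp : st p = p by rewrite /p (stM alg) (stK alg).
have we : w * e = 0 by rewrite -wa -mulrA mulrBl mul1r ee subrr mulr0.
have fw : f * w = 0 by rewrite -bw mulrA mulrBr mulr1 ff subrr mul0r.
have svw : st v * w = 0.
  by rewrite -fv (stM alg) stf -mulrA fw mulr0.
have swv : st w * v = 0 by rewrite -(stK alg v) -(stM alg) svw (st0 alg).
have vsw : v * st w = 0.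
  by rewrite -ve -mulrA -ste -(stM alg) we (st0 alg) mulr0.
have wsv : w * st v = 0 by rewrite -(stK alg w) -(stM alg) vsw (st0 alg).
have VV : st (v + w) * (v + w) = 1 - (a - p).
  by rewrite (stD alg) mulrDl !mulrDr svw swv addr0 add0r vE -/p opprB addrC
    /a opprB addrCA subrKC addrC.
have VV' : (v + w) * st (v + w) = 1 - (b - w * st w).
  by rewrite (stD alg) mulrDl !mulrDr vsw wsv addr0 add0r vF opprB addrC
    /b opprB addrCA subrKC addrC.
have ap : a * p = p by rewrite /p mulrA -sta -(stM alg) wa.
have pa : p * a = p by rewrite /p -mulrA wa.
have bq : b * (w * st w) = w * st w by rewrite mulrA bw.
have swb : st w * b = st w by rewrite -stb -(stM alg) bw.
have qb : w * st w * b = w * st w by rewrite -mulrA swb.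
have qq : w * st w * (w * st w) = w * st w.
  by rewrite -mulrA (mulrA (st w)) -/p mulrA wp.
have stq : st (w * st w) = w * st w by rewrite (stM alg) (stK alg).
have idem (x y : B) : x * x = x -> y * y = y -> x * y = y -> y * x = y ->
    (x - y) * (x - y) = x - y.
  by move=> xx yy xy yx; rewrite mulrBl !mulrBr xx xy yx yy subrr subr0.
have a0 : a - p = 0.
  apply: (shift_trivial _ _ _ _ _ _ VV VV' wz) => //;
    try by [exact: (subD subS) | exact: (subB subS)].
  - by rewrite (stB alg) sta stp.
  - exact: idem.
  - by rewrite (stB alg) stb stq.
(* For the adjoint of [v + w] the leftovers exchange roles; the annihilation hypothesis now holds
   because [a - p = 0]. *)
have b0 : b - w * st w = 0.
  apply: (@shift_trivial (st (v + w)) _ (a - p)) => //;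
    try by [exact: (subB subS) | rewrite (stB alg) ?sta ?stb ?stp ?stq].
  - by apply: (sub_st subS); exact: (subD subS).
  - exact: idem.
  - by rewrite (stK alg).
  - by rewrite (stK alg).
  - by move=> x _; rewrite a0 !mul0r.
exists w; split=> //.
  by apply/eqP; rewrite eq_sym -subr_eq0; apply/eqP.
by apply/eqP; rewrite eq_sym -subr_eq0; apply/eqP.
Qed.

End Finite.

(** * Reflection for identities in noncommutative rings *)

Inductive nc_expr :=
  | NcVar of nat | Nc0 | Nc1 | NcAdd of nc_expr & nc_expr | NcOpp of nc_expr
  | NcMul of nc_expr & nc_expr.

Section NcRing.
Variables (B : nzRingType) (env : seq B).

Fixpoint nc_eval (e : nc_expr) : B :=
  match e with
  | NcVar i => env`_i
  | Nc0 => 0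
  | Nc1 => 1
  | NcAdd e1 e2 => nc_eval e1 + nc_eval e2
  | NcOpp e1 => - nc_eval e1
  | NcMul e1 e2 => nc_eval e1 * nc_eval e2
  end.

(** Words with sign plus and words with sign minus are kept apart and never cancelled: an identity
    holds once the two lists of the difference of its sides are permutations of each other. *)
Fixpoint nc_norm (e : nc_expr) : seq (seq nat) * seq (seq nat) :=
  match e with
  | NcVar i => ([:: [:: i]], [::])
  | Nc0 => ([::], [::])
  | Nc1 => ([:: [::]], [::])
  | NcAdd e1 e2 =>
    let (p1, n1) := nc_norm e1 in let (p2, n2) := nc_norm e2 in
    (p1 ++ p2, n1 ++ n2)
  | NcOpp e1 => let (p1, n1) := nc_norm e1 in (n1, p1)
  | NcMul e1 e2 =>
    let (p1, n1) := nc_norm e1 in let (p2, n2) := nc_norm e2 in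
    ([seq m1 ++ m2 | m1 <- p1, m2 <- p2] ++ [seq m1 ++ m2 | m1 <- n1, m2 <- n2],
     [seq m1 ++ m2 | m1 <- p1, m2 <- n2] ++ [seq m1 ++ m2 | m1 <- n1, m2 <- p2])
  end.

Definition nc_sum (s : seq (seq nat)) : B := \sum_(m <- s) \prod_(i <- m) env`_i.

Lemma nc_sum_cat s1 s2 : nc_sum (s1 ++ s2) = nc_sum s1 + nc_sum s2.
Proof. exact: big_cat. Qed.

Lemma nc_sum_mul s1 s2 :
  nc_sum [seq m1 ++ m2 | m1 <- s1, m2 <- s2] = nc_sum s1 * nc_sum s2.
Proof.
rewrite /nc_sum big_allpairs_dep mulr_suml; apply: eq_bigr => m1 _.
by rewrite mulr_sumr; apply: eq_bigr => m2 _; rewrite big_cat.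
Qed.

Lemma nc_normP e : nc_eval e = nc_sum (nc_norm e).1 - nc_sum (nc_norm e).2.
Proof.
have s0 : nc_sum [::] = 0 by rewrite /nc_sum big_nil.
elim: e => [i|||e1 IH1 e2 IH2|e1 IH1|e1 IH1 e2 IH2] /=.
- by rewrite s0 subr0 /nc_sum !big_seq1.
- by rewrite s0 subrr.
- by rewrite s0 subr0 /nc_sum big_seq1 big_nil.
- rewrite IH1 IH2; case: (nc_norm e1) (nc_norm e2) => [p1 n1] [p2 n2] /=.
  by rewrite !nc_sum_cat opprD addrACA.
- by rewrite IH1; case: (nc_norm e1) => [p1 n1] /=; rewrite opprB.
- rewrite IH1 IH2; case: (nc_norm e1) (nc_norm e2) => [p1 n1] [p2 n2] /=.
  rewrite !nc_sum_cat !nc_sum_mul mulrBl !mulrBr opprB opprD.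
  by rewrite addrACA.
Qed.

Lemma nc_ringP e1 e2 :
  let n := nc_norm (NcAdd e1 (NcOpp e2)) in perm_eq n.1 n.2 ->
  nc_eval e1 = nc_eval e2.
Proof.
move=> n /(perm_big _) E; apply/eqP; rewrite -subr_eq0.
by rewrite -[_ - _]/(nc_eval (NcAdd e1 (NcOpp e2))) nc_normP /nc_sum E subrr.
Qed.

End NcRing.

Ltac nc_index x env :=
  lazymatch env with
  | x :: _ => constr:(0%N)
  | _ :: ?env' => let i := nc_index x env' in constr:(i.+1)
  end.

Ltac nc_env t env :=
  lazymatch t with
  | @GRing.mul _ ?a ?b => let env1 := nc_env a env in nc_env b env1
  | @Algebra.add _ ?a ?b => let env1 := nc_env a env in nc_env b env1
  | @Algebra.opp _ ?a => nc_env a env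
  | @GRing.one _ => env
  | @Algebra.zero _ => env
  | _ => match env with
         | _ => let _ := nc_index t env in env
         | _ => constr:(t :: env)
         end
  end.

Ltac nc_reify t env :=
  lazymatch t with
  | @GRing.mul _ ?a ?b =>
    let a' := nc_reify a env in let b' := nc_reify b env in constr:(NcMul a' b')
  | @Algebra.add _ ?a ?b =>
    let a' := nc_reify a env in let b' := nc_reify b env in constr:(NcAdd a' b')
  | @Algebra.opp _ ?a => let a' := nc_reify a env in constr:(NcOpp a')
  | @GRing.one _ => constr:(Nc1)
  | @Algebra.zero _ => constr:(Nc0)
  | _ => let i := nc_index t env in constr:(NcVar i)
  end.

(* Decides identities of noncommutative rings by comparing multisets of monomials. *)
Ltac ncring B :=
  lazymatch goal with
  | |- @eq _ ?x ?y =>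
    let env0 := nc_env x (@nil B) in let env := nc_env y env0 in
    let ex := nc_reify x env in let ey := nc_reify y env in
    exact: (@nc_ringP B env ex ey (erefl true))
  end.

(** * Perturbation of projections in Banach star-algebras *)

(** Axioms shared by the norm of [A] and the entrywise norm of its matrix algebras, which violates
    the C*-identity from size 2 on. *)
Record banach_norm (R : realType) (B : nzRingType) (sc : {rmorphism R[i] -> B})
    (st : B -> B) (nrm : B -> R) : Prop := BanachNorm {
  nrm_eq0 : forall x, nrm x = 0 -> x = 0;
  nrmD : forall x y, nrm (x + y) <= nrm x + nrm y;
  nrmZ : forall c x, nrm (sc c * x) = complex.Re `|c| * nrm x;
  nrmM : forall x y, nrm (x * y) <= nrm x * nrm y;
  nrm_st : forall x, nrm (st x) = nrm x;
  nrm_complete : forall u : nat -> B,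
    (forall e : R, 0 < e -> exists N : nat, forall m n : nat,
      (N <= m)%N -> (N <= n)%N -> nrm (u m - u n) < e) ->
    exists l : B, forall e : R, 0 < e -> exists N : nat, forall n : nat,
      (N <= n)%N -> nrm (u n - l) < e
}.

Lemma geometric_small (R : realType) (e : R) : 0 < e ->
  exists N, forall n, (N <= n)%N -> 2^-1 ^+ n < e.
Proof.
move=> e0; have [N NP] : exists N : nat, e^-1 < N%:R.
  by exists (Num.bound e^-1); apply: archi_boundP; rewrite invr_ge0 ltW.
exists N => n Nn; rewrite exprVn -[e]invrK ltf_pV2 ?posrE ?invr_gt0 ?exprn_gt0//.
apply: (lt_trans NP); rewrite -natrX ltr_nat.
by apply: (leq_ltn_trans Nn); exact: ltn_expl.
Qed.

(** * Inverse square roots by iteration *)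

Section Banach.
Variables (R : realType) (B : nzRingType) (sc : {rmorphism R[i] -> B}).
Variables (st : B -> B) (nrm : B -> R).
Hypothesis alg : star_algebra sc st.
Hypothesis ban : banach_norm sc st nrm.

Lemma Re_norm_real (x : R) : complex.Re `|x%:C%C| = `|x|.
Proof. by rewrite normc_def /= expr0n addr0 sqrtr_sqr. Qed.

Lemma nrmN x : nrm (- x) = nrm x.
Proof.
rewrite -mulN1r -(rmorphN1 sc) (nrmZ ban).
have -> : (-1 : R[i]) = (-1)%:C%C by rewrite rmorphN1.
by rewrite Re_norm_real normrN1 mul1r.
Qed.

Lemma nrm0 : nrm 0 = 0.
Proof.
have := nrmZ ban 0 0; rewrite mulr0 => ->.
have -> : (0 : R[i]) = 0%:C%C by [].
by rewrite Re_norm_real normr0 mul0r.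
Qed.

Lemma nrm_ge0 x : 0 <= nrm x.
Proof. by have := nrmD ban x (- x); rewrite subrr nrm0 nrmN; lra. Qed.

Lemma nrmB x y : nrm (x - y) <= nrm x + nrm y.
Proof. by rewrite -(nrmN y); exact: nrmD ban _ _. Qed.

Definition half x := sc 2^-1 * x.

Lemma nrm_half x : nrm (half x) = nrm x / 2.
Proof.
rewrite (nrmZ ban) mulrC; congr (_ * _).
have -> : (2^-1 : R[i]) = (2^-1)%:C%C by rewrite fmorphV rmorph_nat.
by rewrite Re_norm_real ger0_norm// invr_ge0.
Qed.

Lemma halfD x y : half (x + y) = half x + half y.
Proof. by rewrite /half mulrDr. Qed.

Lemma half2 x : half (x + x) = x.
Proof.
have -> : x + x = sc (1 + 1) * x by rewrite rmorphD rmorph1 mulrDl mul1r.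
by apply: (scK sc x (_ : 2%:R != 0)); rewrite pnatr_eq0.
Qed.

Lemma half_split x : half x + half x = x.
Proof. by rewrite -halfD half2. Qed.

Lemma half_inj : injective half.
Proof. by move=> x y xy; rewrite -(half_split x) xy half_split. Qed.

Lemma halfMl x y : half x * y = half (x * y).
Proof. by rewrite /half mulrA. Qed.

Lemma halfMr x y : x * half y = half (x * y).
Proof. by rewrite /half mulrA (scC alg) mulrA. Qed.

Lemma st_half x : st (half x) = half (st x).
Proof.
rewrite /half (stZ alg) [_^*%R](_ : _ = 2^-1)//.
by apply/CrealP; rewrite ger0_real// invr_ge0.
Qed.

Definition lim_to (u : nat -> B) l := forall e : R, 0 < e ->
  exists N : nat, forall n : nat, (N <= n)%N -> nrm (u n - l) < e.

(** Common form in which commutation, self-adjointness and membership in a subalgebra pass to the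
    limit of an iteration. *)
Definition seq_closed (S : B -> Prop) :=
  forall u l, (forall n, S (u n)) -> lim_to u l -> S l.

Lemma lim_uniq u l l' : lim_to u l -> lim_to u l' -> l = l'.
Proof.
move=> ul ul'; apply/eqP; rewrite -subr_eq0; apply/eqP/(nrm_eq0 ban).
apply/eqP; rewrite eq_le nrm_ge0 andbT leNgt; apply/negP => d0.
have d2 : 0 < nrm (l - l') / 2 by lra.
have [N NP] := ul _ d2; have [N' NP'] := ul' _ d2.
have H := NP _ (leq_maxl N N'); have H' := NP' _ (leq_maxr N N').
set m := maxn N N' in H H'.
have : nrm (l - l') <= nrm (u m - l') + nrm (u m - l).
  have -> : l - l' = (u m - l') - (u m - l) by ncring B.
  exact: nrmB.
lra.
Qed.

Lemma lim_mull u l c : lim_to u l -> lim_to (fun n => c * u n) (c * l).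
Proof.
move=> ul e e0; have c0 := nrm_ge0 c.
have /ul[N NP] : 0 < e / (nrm c + 1) by rewrite divr_gt0//; lra.
exists N => n /NP; rewrite ltr_pdivlMr; last lra.
rewrite -mulrBr => H; apply: le_lt_trans H; apply: le_trans (nrmM ban _ _) _.
by have := nrm_ge0 (u n - l); nra.
Qed.

Lemma lim_mulr u l c : lim_to u l -> lim_to (fun n => u n * c) (l * c).
Proof.
move=> ul e e0; have c0 := nrm_ge0 c.
have /ul[N NP] : 0 < e / (nrm c + 1) by rewrite divr_gt0//; lra.
exists N => n /NP; rewrite ltr_pdivlMr; last lra.
rewrite -mulrBl => H; apply: le_lt_trans H; apply: le_trans (nrmM ban _ _) _.
by have := nrm_ge0 (u n - l); nra.
Qed.

Lemma lim_st u l : lim_to u l -> lim_to (fun n => st (u n)) (st l).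
Proof.
move=> ul e /ul[N NP]; exists N => n /NP.
by rewrite -(stB alg) (nrm_st ban).
Qed.

Lemma closed_comm c : seq_closed (fun x => x * c = c * x).
Proof.
move=> u l uc ul; apply: (lim_uniq (lim_mulr c ul)).
by have := lim_mull c ul; congr lim_to; apply/funext => n.
Qed.

Lemma closed_st : seq_closed (fun x => st x = x).
Proof.
move=> u l us ul; apply: (@lim_uniq u _ l _ ul).
by have := lim_st ul; congr lim_to; apply/funext => n.
Qed.

Lemma lim_nrm_le u l (d : R) : (forall n, nrm (u n) <= d) -> lim_to u l -> nrm l <= d.
Proof.
move=> ud ul; rewrite leNgt; apply/negP => dl.
have /ul[N /(_ N (leqnn _)) NP] : 0 < nrm l - d by lra.
have : nrm l <= nrm (u N) + nrm (u N - l).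
  have {1}-> : l = u N - (u N - l) by ncring B.
  exact: nrmB.
by have := ud N; lra.
Qed.

(** Expanding [(1 + w) * (1 - t) * (1 + w) = 1] and solving for [w + w] gives the fixed-point
    equation of this map; [t] and [w] are not assumed to commute. *)
Definition isqrt_step t w := half (t + w * t + t * w + w * t * w - w * w).

(** With [nrm t <= 8^-1] each of the four products contributes at most [nrm t / 8], so the sum is at
    most [3 / 2] times [nrm t] before halving. *)
Lemma isqrt_step_nrm t w : nrm t <= 8^-1 -> nrm w <= nrm t ->
  nrm (isqrt_step t w) <= nrm t.
Proof.
move=> t8 wt; rewrite nrm_half.
have t0 := nrm_ge0 t; have w0 := nrm_ge0 w.
have h1 := nrmB (t + w * t + t * w + w * t * w) (w * w).
have h2 := nrmD ban (t + w * t + t * w) (w * t * w).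
have h3 := nrmD ban (t + w * t) (t * w).
have h4 := nrmD ban t (w * t).
have h5 := nrmM ban w t; have h6 := nrmM ban t w.
have h7 := nrmM ban (w * t) w; have h8 := nrmM ban w w.
have h9 : nrm w * nrm t <= nrm t * 8^-1 by nra.
have h10 : nrm (w * t) * nrm w <= nrm t * 8^-1 by nra.
have h11 : nrm w * nrm w <= nrm t * 8^-1 by nra.
by lra.
Qed.

Lemma isqrt_step_lip t x y : nrm t <= 8^-1 -> nrm x <= nrm t -> nrm y <= nrm t ->
  nrm (isqrt_step t x - isqrt_step t y) <= 2^-1 * nrm (x - y).
Proof.
move=> t8 xt yt.
have -> : isqrt_step t x - isqrt_step t y = half ((x - y) * t + t * (x - y) +
    ((x - y) * (t * x) + (y * t) * (x - y)) - ((x - y) * x + y * (x - y))).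
  by rewrite /isqrt_step /half -mulrBr; congr (_ * _); ncring B.
rewrite nrm_half mulrC; apply: ler_wpM2l; first by rewrite invr_ge0.
set d := x - y; have d0 := nrm_ge0 d.
have t0 := nrm_ge0 t; have x0 := nrm_ge0 x; have y0 := nrm_ge0 y.
have h1 := nrmB (d * t + t * d + (d * (t * x) + (y * t) * d)) (d * x + y * d).
have h2 := nrmD ban (d * t + t * d) (d * (t * x) + (y * t) * d).
have h3 := nrmD ban (d * t) (t * d).
have h4 := nrmD ban (d * (t * x)) ((y * t) * d).
have h5 := nrmD ban (d * x) (y * d).
have k1 := nrmM ban d t; have k2 := nrmM ban t d.
have k3 := nrmM ban d (t * x); have k4 := nrmM ban (y * t) d.
have k5 := nrmM ban d x; have k6 := nrmM ban y d.
have l1 := nrmM ban t x; have l2 := nrmM ban y t.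
have m1 : nrm (t * x) <= 64^-1 by nra.
have m2 : nrm (y * t) <= 64^-1 by nra.
have n1 : nrm d * nrm t <= nrm d * 8^-1 by nra.
have n3 : nrm d * nrm (t * x) <= nrm d * 64^-1 by nra.
have n4 : nrm (y * t) * nrm d <= nrm d * 64^-1 by nra.
have n5 : nrm d * nrm x <= nrm d * 8^-1 by nra.
have n6 : nrm y * nrm d <= nrm d * 8^-1 by nra.
by lra.
Qed.

(* 1 + w is an inverse square root of 1 - t, found as a contraction fixed point. *)
Lemma inv_sqrt t : nrm t <= 8^-1 ->
  exists w, [/\ nrm w <= nrm t, (1 + w) * (1 - t) * (1 + w) = 1 &
    forall S : B -> Prop, seq_closed S -> S 0 ->
      (forall x, S x -> S (isqrt_step t x)) -> S w].
Proof.
move=> t8; pose u n := iter n (isqrt_step t) 0.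
have t0 := nrm_ge0 t.
have ut n : nrm (u n) <= nrm t.
  elim: n => [|n IH]; first by rewrite nrm0.
  exact: isqrt_step_nrm.
have ulip k n : nrm (u (n + k)%N - u n) <= 2^-1 ^+ n * nrm t.
  elim: n => [|n IH]; first by rewrite subr0 expr0 mul1r.
  rewrite addSn exprS -mulrA.
  by apply: le_trans (isqrt_step_lip t8 (ut _) (ut _)) _; rewrite ler_pM2l ?invr_gt0.
have ulip' m n N : (N <= m)%N -> (N <= n)%N ->
    nrm (u m - u n) <= 2^-1 ^+ N * nrm t + 2^-1 ^+ N * nrm t.
  move=> Nm Nn; have -> : u m - u n = (u m - u N) - (u n - u N) by ncring B.
  apply: le_trans (nrmB _ _) _.
  by rewrite -(subnKC Nm) -(subnKC Nn); apply: lerD; exact: ulip.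
have small (e : R) : 0 < e -> exists N, forall n, (N <= n)%N ->
    2^-1 ^+ n * nrm t + 2^-1 ^+ n * nrm t < e.
  move=> /geometric_small[N NP]; exists N => n /NP nN.
  have : 0 < (2^-1 : R) ^+ n by rewrite exprn_gt0// invr_gt0.
  by nra.
have [w uw] : exists w, lim_to u w.
  apply: (nrm_complete ban) => e /small[N NP]; exists N => m n Nm Nn.
  by apply: le_lt_trans (ulip' _ _ _ Nm Nn) _; exact: NP.
have wt : nrm w <= nrm t := lim_nrm_le ut uw.
have Fw : isqrt_step t w = w.
  have /lim_uniq : lim_to (fun n => u n.+1) (isqrt_step t w).
    move=> e /uw[N NP]; exists N => n /NP Nn.
    apply: le_lt_trans (isqrt_step_lip t8 (ut _) wt) _.
    by have := nrm_ge0 (u n - w); lra.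
  apply=> e /uw[N NP]; exists N => n Nn.
  by apply: NP; exact: leqW.
exists w; split=> //.
  have : t + w * t + t * w + w * t * w - w * w = w + w.
    by apply: half_inj; rewrite half2.
  move=> E; have -> : (1 + w) * (1 - t) * (1 + w) =
      1 + (w + w) + w * w - (t + w * t + t * w + w * t * w) by ncring B.
  by rewrite -E; ncring B.
move=> S Sc S0 SF; apply: Sc uw; elim=> [|n IH] //.
exact: SF.
Qed.

(** Commutation with [c] holds at 0, survives each iteration and passes to the limit; the
    quantification over [S] makes such properties available for [w]. *)
Lemma inv_sqrt_comm t c w : t * c = c * t ->
  (forall S : B -> Prop, seq_closed S -> S 0 ->
      (forall x, S x -> S (isqrt_step t x)) -> S w) -> w * c = c * w.
Proof.
move=> tc wS; apply: (wS (fun x => x * c = c * x)).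
- exact: closed_comm.
- by rewrite mul0r mulr0.
move=> x xc; rewrite /isqrt_step halfMl halfMr; congr half.
have -> : (t + x * t + t * x + x * t * x - x * x) * c =
  t * c + x * (t * c) + t * (x * c) + x * t * (x * c) - x * (x * c) by ncring B.
rewrite tc xc.
have -> : c * t + x * (c * t) + t * (c * x) + x * t * (c * x) - x * (c * x) =
  c * t + (x * c) * t + (t * c) * x + x * (t * c) * x - (x * c) * x by ncring B.
rewrite tc xc.
have -> : c * t + c * x * t + c * t * x + x * (c * t) * x - c * x * x =
  c * t + c * x * t + c * t * x + (x * c) * t * x - c * x * x by ncring B.
by rewrite xc; ncring B.
Qed.

Lemma inv_sqrt_st t w : st t = t ->
  (forall S : B -> Prop, seq_closed S -> S 0 ->
      (forall x, S x -> S (isqrt_step t x)) -> S w) -> st w = w.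
Proof.
move=> stt wS; apply: (wS (fun x => st x = x)).
- exact: closed_st.
- exact: st0 alg.
move=> x sx; rewrite /isqrt_step st_half; congr half.
rewrite (stB alg) !(stD alg) !(stM alg) stt sx mulrA.
by ncring B.
Qed.

End Banach.

(** * Completeness of the complex scalars *)

Lemma real_seq_complete (R : realType) (u : nat -> R) :
  (forall e : R, 0 < e -> exists N : nat, forall m n : nat,
      (N <= m)%N -> (N <= n)%N -> `|u m - u n| < e) ->
  exists l : R, forall e : R, 0 < e -> exists N : nat, forall n : nat,
      (N <= n)%N -> `|u n - l| < e.
Proof.
move=> uc.
have : cvgn u.
  apply/cauchy_cvgP/cauchy_exP => e /= e0; have [N NP] := uc e e0.
  exists (u N); exists N => // n /= Nn; exact: NP.
move=> /cvg_ex[l /cvgrPdistC_lt ul]; exists l => e /ul[N _ NP].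
by exists N => n /NP.
Qed.

Section ComplexNorm.
Variable R : realType.
Implicit Type z : R[i].
Local Notation cabs z := (complex.Re `|z|).

Lemma cabs_ge0 z : 0 <= cabs z.
Proof. by rewrite normc_def /= sqrtr_ge0. Qed.

Lemma Re_le_cabs z : `|complex.Re z| <= cabs z.
Proof.
rewrite normc_def /= -sqrtr_sqr ler_wsqrtr// lerDl.
exact: sqr_ge0.
Qed.

Lemma Im_le_cabs z : `|complex.Im z| <= cabs z.
Proof.
rewrite normc_def /= -sqrtr_sqr ler_wsqrtr// lerDr.
exact: sqr_ge0.
Qed.

Lemma cabs_le z : cabs z <= `|complex.Re z| + `|complex.Im z|.
Proof.
rewrite normc_def /= -[leRHS]ger0_norm ?addr_ge0// -sqrtr_sqr ler_wsqrtr//.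
rewrite sqrrD !real_normK ?num_real//.
have := normr_ge0 (complex.Re z); have := normr_ge0 (complex.Im z); nra.
Qed.

Lemma complex_seq_complete (u : nat -> R[i]) :
  (forall e : R, 0 < e -> exists N : nat, forall m n : nat,
      (N <= m)%N -> (N <= n)%N -> cabs (u m - u n) < e) ->
  exists l : R[i], forall e : R, 0 < e -> exists N : nat, forall n : nat,
      (N <= n)%N -> cabs (u n - l) < e.
Proof.
move=> uc.
have ReB (x y : R[i]) : complex.Re (x - y) = complex.Re x - complex.Re y.
  by case: x y => ? ? [].
have ImB (x y : R[i]) : complex.Im (x - y) = complex.Im x - complex.Im y.
  by case: x y => ? ? [].
have part (P : R[i] -> R) : (forall x y, P (x - y) = P x - P y) ->
    (forall z, `|P z| <= cabs z) -> exists l : R, forall e : R, 0 < e ->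
    exists N : nat, forall n : nat, (N <= n)%N -> `|P (u n) - l| < e.
  move=> PB Ple; apply: real_seq_complete => e /uc[N NP]; exists N => m n Nm Nn.
  by rewrite -PB; exact: le_lt_trans (Ple _) (NP _ _ Nm Nn).
have [a ua] := part _ ReB Re_le_cabs.
have [b ub] := part _ ImB Im_le_cabs.
exists (Complex a b) => e e0; have e2 : 0 < e / 2 by lra.
have [N NP] := ua _ e2; have [M MP] := ub _ e2.
exists (maxn N M) => n; rewrite geq_max => /andP[/NP nN /MP nM].
apply: le_lt_trans (cabs_le _) _; rewrite ReB ImB /=; lra.
Qed.

End ComplexNorm.

(** * Approximation by finite-dimensional subalgebras *)

Section Approximation.
Variables (R : realType) (B : nzRingType) (sc : {rmorphism R[i] -> B}).
Variables (st : B -> B) (nrm : B -> R).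
Hypothesis alg : star_algebra sc st.
Hypothesis ban : banach_norm sc st nrm.

Lemma limB u u' l l' : lim_to nrm u l -> lim_to nrm u' l' ->
  lim_to nrm (fun n => u n - u' n) (l - l').
Proof.
move=> ul ul' e e0; have e2 : 0 < e / 2 by lra.
have [N NP] := ul _ e2; have [M MP] := ul' _ e2.
exists (maxn N M) => n; rewrite geq_max => /andP[/NP nN /MP nM].
have -> : u n - u' n - (l - l') = (u n - l) - (u' n - l') by ncring B.
by have := nrmB ban (u n - l) (u' n - l'); lra.
Qed.

Lemma lim_cauchy u l : lim_to nrm u l -> forall e : R, 0 < e ->
  exists N : nat, forall m n, (N <= m)%N -> (N <= n)%N -> nrm (u m - u n) < e.
Proof.
move=> ul e e0; have e2 : 0 < e / 2 by lra.
have [N NP] := ul _ e2; exists N => m n /NP mN /NP nN.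
have -> : u m - u n = (u m - l) - (u n - l) by ncring B.
by have := nrmB ban (u m - l) (u n - l); lra.
Qed.

(** Induction on [k]. The last vector [x] lies at distance at least [dl > 0] from the span [V] of
    the others, which is closed by induction, so a coefficient [c] satisfies
    [|c| * dl <= nrm (sc c * x - y)] for all [y] in [V]. Along a convergent sequence the
    coefficients of [x] are therefore Cauchy. *)
Lemma span_closed k (b : 'I_k -> B) : free_family sc b ->
  seq_closed nrm (fun x => exists c : 'I_k -> R[i], x = \sum_i sc (c i) * b i).
Proof.
elim: k b => [|k IH] b fb u l uS ul.
  exists (fun=> 0); rewrite big_ord0; apply: (lim_uniq ban ul).
  have u0 n : u n = 0 by have [c ->] := uS n; rewrite big_ord0.
  by move=> e e0; exists 0%N => n _; rewrite u0 subrr (nrm0 ban).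
pose b' i := b (widen_ord (leqnSn k) i); pose x := b ord_max.
pose V y := exists c : 'I_k -> R[i], y = \sum_i sc (c i) * b' i.
have ext (c : 'I_k -> R[i]) d : exists c' : 'I_k.+1 -> R[i],
    [/\ c' ord_max = d, forall i, c' (widen_ord (leqnSn k) i) = c i &
     \sum_i sc (c i) * b' i + sc d * x = \sum_i sc (c' i) * b i].
  pose c' (i : 'I_k.+1) := oapp c d (insub (val i)).
  have c'w i : c' (widen_ord (leqnSn k) i) = c i by rewrite /c' /= valK.
  have c'm : c' ord_max = d by rewrite /c' insubN //= ltnn.
  exists c'; split=> //; rewrite big_ord_recr /= c'm; congr (_ + _).
  by apply: eq_bigr => i _; rewrite c'w.
have fb' : free_family sc b'.
  move=> c c0 i; have [c' [c'm <- E]] := ext c 0; apply: fb.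
  by rewrite -E c0 rmorph0 mul0r addr0.
have Vc : seq_closed nrm V by exact: IH.
have VZ d y : V y -> V (sc d * y).
  move=> [c ->]; exists (fun i => d * c i); rewrite mulr_sumr.
  by apply: eq_bigr => i _; rewrite mulrA rmorphM.
have VB y z : V y -> V z -> V (y - z).
  move=> [c ->] [c' ->]; exists (fun i => c i - c' i); rewrite -sumrB.
  by apply: eq_bigr => i _; rewrite rmorphB mulrBl.
have xV : ~ V x.
  move=> [c xE]; have [c' [c'm _ E]] := ext c (-1).
  have /fb/(_ ord_max)/eqP : \sum_i sc (c' i) * b i = 0.
    by rewrite -E xE rmorphN1 mulN1r subrr.
  by rewrite c'm oppr_eq0 oner_eq0.
have [dl dl0 dist] : exists2 dl : R, 0 < dl & forall y, V y -> dl <= nrm (x - y).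
  apply: contrapT => no; apply: xV.
  have near n : exists y, V y /\ nrm (y - x) < 2^-1 ^+ n.
    apply: contrapT => no'; apply: no; exists (2^-1 ^+ n).
      by rewrite exprn_gt0// invr_gt0.
    move=> y Vy; rewrite leNgt; apply/negP => yx; apply: no'.
    by exists y; rewrite -(nrmN ban) opprB.
  have [y yP] := choice near.
  apply: (Vc y) => [n|e /geometric_small[N NP]]; first by have [] := yP n.
  by exists N => n /NP; apply: lt_trans; have [] := yP n.
have distZ d y : V y -> complex.Re `|d| * dl <= nrm (sc d * x - y).
  move=> Vy; have [->|d0] := eqVneq d 0.
    by rewrite normr0 /= mul0r (nrm_ge0 ban).
  have -> : y = sc d * (sc d^-1 * y) by rewrite mulrA -rmorphM divff// rmorph1 mul1r.
  rewrite -mulrBr (nrmZ ban); apply: ler_wpM2l; first exact: cabs_ge0.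
  by apply: dist; exact: VZ.
have /choice[c uE] : forall n, exists d, V (u n - sc d * x).
  move=> n; have [c ->] := uS n; exists (c ord_max).
  rewrite big_ord_recr /= addrK.
  by exists (fun i => c (widen_ord (leqnSn k) i)).
have [d cd] : exists d, forall e : R, 0 < e -> exists N : nat, forall n : nat,
      (N <= n)%N -> complex.Re `|c n - d| < e.
  apply: complex_seq_complete => e e0.
  have ed : 0 < e * dl by exact: mulr_gt0.
  have [N NP] := lim_cauchy ul ed; exists N => m n Nm Nn.
  have := NP _ _ Nm Nn.
  have := @distZ (c m - c n) _ (VB _ _ (uE n) (uE m)).
  have -> : sc (c m - c n) * x - (u n - sc (c n) * x - (u m - sc (c m) * x)) = u m - u n.
    have -> : sc (c m - c n) = sc (c m) - sc (c n) by exact: rmorphB.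
    by ncring B.
  by move=> h1 h2; rewrite -(ltr_pM2r dl0); exact: le_lt_trans h1 h2.
have clim : lim_to nrm (fun n => sc (c n) * x) (sc d * x).
  move=> e e0; have x0 := nrm_ge0 ban x.
  have /cd[N NP] : 0 < e / (nrm x + 1) by rewrite divr_gt0//; lra.
  exists N => n /NP; rewrite ltr_pdivlMr; last lra.
  rewrite -mulrBl -rmorphB (nrmZ ban).
  by have := cabs_ge0 (c n - d); nra.
have [c' lE] : V (l - sc d * x) by apply: Vc (limB ul clim) => n; exact: uE.
have [c2 [_ _ E]] := ext c' d.
by exists c2; rewrite -E -lE subrK.
Qed.

Lemma finite_closed S : star_subalgebra sc st S -> finite_span sc S ->
  seq_closed nrm S.
Proof.
move=> subS finS; have [d [b [Sb fb spanb]]] := finite_span_basis finS.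
move=> u l uS ul.
have [c ->] := span_closed fb (fun n => spanb _ (uS n)) ul.
by apply: (sub_sum subS) => i _; exact: (subZ subS).
Qed.

Definition is_proj p := st p = p /\ p * p = p.

Lemma isqrt_step_sub S t : star_subalgebra sc st S -> S t ->
  forall x, S x -> S (isqrt_step sc t x).
Proof.
move=> subS St x Sx; apply: (subZ subS).
have M a b : S a -> S b -> S (a * b) by exact: subM subS _ _.
have D a b : S a -> S b -> S (a + b) by exact: subD subS _ _.
by apply: (subB subS); rewrite ?mulrA; repeat first [apply: (D) | apply: (M) | done].
Qed.

(** With [h] the self-adjoint part of [x], the element [k = h + h - 1] is almost a symmetry: its
    square is [1 - t] with [t] small. Multiplying it by the inverse square root of [1 - t] gives a
    self-adjoint [s] with [s * s = 1], hence the projection [half sc (1 + s)]. The norm of [e]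
    enters the constants because it may exceed 1. *)
Lemma near_projection S e x (eta : R) : star_subalgebra sc st S ->
  seq_closed nrm S -> is_proj e -> S x ->
  nrm (x - e) * (8 * (nrm e + 2) ^+ 2 + 1) <= eta ->
  nrm (x - e) * (8 * (nrm e + 2) ^+ 2 + 1) <= 8^-1 ->
  exists p, [/\ S p, is_proj p & nrm (p - e) <= eta].
Proof.
move=> subS clS [ste ee] Sx; set d := nrm (x - e); set K := nrm e => deta d8.
have d0 : 0 <= d := nrm_ge0 ban _; have K0 : 0 <= K := nrm_ge0 ban _.
pose h := half sc (x + st x).
have Sh : S h by apply: (subZ subS); apply: (subD subS) => //; exact: (sub_st subS).
have sth : st h = h by rewrite (st_half alg) (stD alg) (stK alg) addrC.
have he : nrm (h - e) <= d.
  have -> : h - e = half sc ((x - e) + st (x - e)).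
    rewrite (stB alg) ste -[in LHS](half2 sc e) /h /half -mulrBr; congr (_ * _).
    by ncring B.
  rewrite (nrm_half ban); have := nrmD ban (x - e) (st (x - e)).
  by rewrite (nrm_st ban) -/d; lra.
(* [t] is four times [z], that is [1 - k * k]; it vanishes when [h] is idempotent. *)
pose z := h - h * h; pose t := z + z + (z + z); pose k := h + h - 1.
have d1 : d <= 1 by nra.
have nh : nrm h <= K + 1.
  have {1}-> : h = (h - e) + e by ncring B.
  by have := nrmD ban (h - e) e; rewrite -/K; lra.
have h0 := nrm_ge0 ban h.
have nz : nrm z <= d * (2 * K + 2).
  have -> : z = (h - e) - ((h - e) * h + e * (h - e)).
    have -> : (h - e) - ((h - e) * h + e * (h - e)) = h - h * h + (e * e - e) by ncring B.
    by rewrite ee subrr addr0.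
  have h1 := nrmB ban (h - e) ((h - e) * h + e * (h - e)).
  have h2 := nrmD ban ((h - e) * h) (e * (h - e)).
  have h3 := nrmM ban (h - e) h; have h4 := nrmM ban e (h - e).
  have h5 : nrm (h - e) * nrm h <= d * (K + 1).
    by apply: ler_pM => //; exact: nrm_ge0 ban _.
  have h6 : nrm e * nrm (h - e) <= K * d.
    by apply: ler_pM => //; exact: nrm_ge0 ban _.
  lra.
have nt : nrm t <= d * (8 * (K + 1)).
  have h1 := nrmD ban (z + z) (z + z); have h2 := nrmD ban z z.
  rewrite -/t in h1; lra.
have t8 : nrm t <= 8^-1.
  apply: (le_trans nt); apply: le_trans d8; apply: ler_wpM2l => //; nra.
have [w [wt wI wS]] := inv_sqrt ban t8.
have kk : k * k = 1 - t by rewrite /k /t /z; ncring B.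
have kt : k * t = t * k.
  have -> : t = 1 - k * k by rewrite kk; ncring B.
  by ncring B.
have stz : st z = z by rewrite (stB alg) (stM alg) sth.
have stt : st t = t by rewrite /t (stD alg (z + z)) (stD alg z z) stz.
have stk : st k = k by rewrite (stB alg) (stD alg) sth (st1 alg).
have wk : w * k = k * w := inv_sqrt_comm alg ban (esym kt) wS.
have stw : st w = w := inv_sqrt_st alg ban stt wS.
have Sz : S z by apply: (subB subS) => //; exact: (subM subS).
have Szz := subD subS Sz Sz; have St : S t := subD subS Szz Szz.
have S1 := sub1 subS.
have Sw : S w by apply: wS => //; [exact: (sub0 subS) | exact: isqrt_step_sub].
have Sk : S k by apply: (subB subS) => //; exact: (subD subS).
pose s := k * (1 + w).
have Ss : S s by apply: (subM subS) => //; exact: (subD subS).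
have sk : s = (1 + w) * k.
  by rewrite mulrDl wk mul1r /s mulrDr mulr1.
have ss : s * s = 1.
  by rewrite {1}sk /s -mulrA (mulrA k) kk mulrA wI.
have sts : st s = s by rewrite {1}/s (stM alg) stk (stD alg) (st1 alg) stw -sk.
exists (half sc (1 + s)); split.
- by apply: (subZ subS); exact: (subD subS).
- split; first by rewrite (st_half alg) (stD alg) (st1 alg) sts.
  rewrite (halfMl _ (1 + s)) (halfMr alg); congr (half sc _).
  have -> : (1 + s) * (1 + s) = 1 + s + s + s * s by ncring B.
  rewrite ss (_ : _ + 1 = (1 + s) + (1 + s)) ?(half2 sc)//.
  by ncring B.
have -> : half sc (1 + s) - e = half sc (h * w + h * w - w) + (h - e).
  have -> : 1 + s = (h + h) + (h * w + h * w - w) by rewrite /s /k; ncring B.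
  by rewrite halfD (half2 sc); ncring B.
(* The bounds [K + 1] on [nrm h] and [d * (8 * (K + 1))] on [nrm w] account for the factor
   [8 * (K + 2) ^+ 2]; the summand 1 pays for [h - e]. *)
have h1 := nrmD ban (half sc (h * w + h * w - w)) (h - e).
have h2 := nrmB ban (h * w + h * w) w.
have h3 := nrmD ban (h * w) (h * w); have h4 := nrmM ban h w.
rewrite (nrm_half ban) in h1.
have w0 := nrm_ge0 ban w.
have h5 : nrm h * nrm w <= (K + 1) * (d * (8 * (K + 1))).
  by apply: ler_pM => //; exact: le_trans wt nt.
have h6 := le_trans wt nt.
apply: le_trans h1 _; apply: le_trans deta.
have h7 : (K + 1) * (d * (8 * (K + 1))) + d * (8 * (K + 1)) =
    d * (8 * ((K + 1) * (K + 2))) by ring.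
have h8 : d * (8 * ((K + 1) * (K + 2))) <= d * (8 * (K + 2) ^+ 2).
  by apply: ler_wpM2l => //; nra.
lra.
Qed.

(** The element [z] intertwines [p] and [q], and both [st z * z] and [z * st z] equal [1 - t] with
    [t] the square of [p - q]; its polar part [z * (1 + w)] is the unitary. *)
Lemma unitary_of_close p q : is_proj p -> is_proj q -> nrm (p - q) <= 4^-1 ->
  exists u, [/\ st u * u = 1, u * st u = 1 & u * p = q * u].
Proof.
move=> [stp pp] [stq qq] pq4.
pose z := q * p + (1 - q) * (1 - p); pose t := (p - q) * (p - q).
have t8 : nrm t <= 8^-1.
  apply: le_trans (nrmM ban _ _) _; have := nrm_ge0 ban (p - q); nra.
have stz : st z = p * q + (1 - p) * (1 - q).
  by rewrite (stD alg) !(stM alg) !(stB alg) (st1 alg) stp stq.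
have tE : t = p - p * q - q * p + q.
  by rewrite /t mulrBl !mulrBr pp qq; ncring B.
have zz : st z * z = 1 - t.
  rewrite stz; have -> : (p * q + (1 - p) * (1 - q)) * z =
    p * (q * q) * p + p * (q - q * q) * (1 - p) + (1 - p) * (q - q * q) * p +
    (1 - p) * (1 - q - q + q * q) * (1 - p) by rewrite /z; ncring B.
  rewrite qq subrr tE.
  have -> : p * q * p + p * 0 * (1 - p) + (1 - p) * 0 * p +
      (1 - p) * (1 - q - q + q) * (1 - p)
    = 1 - p - p + p * p - q + p * q + q * p by ncring B.
  by rewrite pp; ncring B.
have zz' : z * st z = 1 - t.
  rewrite stz; have -> : z * (p * q + (1 - p) * (1 - q)) =
    q * (p * p) * q + q * (p - p * p) * (1 - q) + (1 - q) * (p - p * p) * q +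
    (1 - q) * (1 - p - p + p * p) * (1 - q) by rewrite /z; ncring B.
  rewrite pp subrr tE.
  have -> : q * p * q + q * 0 * (1 - q) + (1 - q) * 0 * q +
      (1 - q) * (1 - p - p + p) * (1 - q)
    = 1 - q - q + q * q - p + p * q + q * p by ncring B.
  by rewrite qq; ncring B.
have tE1 : t = 1 - st z * z by rewrite zz; ncring B.
have tE2 : t = 1 - z * st z by rewrite zz'; ncring B.
have tz : t * z = z * t by rewrite {1}tE2 tE1; ncring B.
have tp : t * p = p * t.
  rewrite tE.
  have -> : (p - p * q - q * p + q) * p =
    p * p - p * q * p - q * (p * p) + q * p by ncring B.
  have -> : p * (p - p * q - q * p + q) = p * p - (p * p) * q - p * q * p + p * q by ncring B.
  by rewrite pp; ncring B.
have stt : st t = t by rewrite (stM alg) (stB alg) stp stq.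
have [w [_ wI wS]] := inv_sqrt ban t8.
have wz := inv_sqrt_comm alg ban tz wS.
have wp := inv_sqrt_comm alg ban tp wS.
have stw := inv_sqrt_st alg ban stt wS.
have rz : z * (1 + w) = (1 + w) * z.
  have -> : (1 + w) * z = z + w * z by ncring B.
  by rewrite wz; ncring B.
have rz' : (1 + w) * st z = st z * (1 + w).
  have := congr1 st rz; rewrite (stM alg z) (stM alg (1 + w)).
  by rewrite (stD alg 1) (st1 alg) stw.
have zp : z * p = q * z.
  have -> : z * p = q * (p * p) + (1 - q) * (p - p * p) by rewrite /z; ncring B.
  have -> : q * z = (q * q) * p + (q - q * q) * (1 - p) by rewrite /z; ncring B.
  by rewrite pp qq !subrr; ncring B.
exists (z * (1 + w)); rewrite (stM alg) (stD alg) (st1 alg) stw; split.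
- by rewrite mulrA -(mulrA _ (st z)) zz wI.
- by rewrite rz rz' -mulrA (mulrA z) zz' mulrA wI.
- have -> : z * (1 + w) * p = z * p + z * (w * p) by ncring B.
  by rewrite wp (mulrA z p) zp; ncring B.
Qed.

(** Normalizing [y] by the inverse square root of [1 - t], with [t = e - st y * y], makes the source
    exactly [e]. The range could still be smaller than [f]; but the defect [g] kills [y], so
    [g = - (g * ((y - v) * st v))], whose norm is at most [nrm g / 8]. *)
Lemma near_partial_isometry S e f v y : star_subalgebra sc st S ->
  seq_closed nrm S -> is_proj e -> is_proj f -> S e ->
  st v * v = e -> v * st v = f ->
  S y -> f * y = y -> y * e = y -> nrm (y - v) * (2 * nrm v + 1) <= 8^-1 ->
  exists v', [/\ S v', st v' * v' = e & v' * st v' = f].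
Proof.
move=> subS clS [ste ee] [stf ff] Se vE vF Sy fy ye.
set d := nrm (y - v) => dv.
have d0 : 0 <= d := nrm_ge0 ban _; have v0 := nrm_ge0 ban v.
have d1 : d <= 1 by nra.
pose t := e - st y * y.
have t8 : nrm t <= 8^-1.
  have -> : t = - (st v * (y - v) + (st (y - v)) * y).
    by rewrite /t -vE (stB alg); ncring B.
  rewrite (nrmN ban).
  have h1 := nrmD ban (st v * (y - v)) (st (y - v) * y).
  have h2 := nrmM ban (st v) (y - v); have h3 := nrmM ban (st (y - v)) y.
  rewrite !(nrm_st ban) -/d in h2 h3.
  have h4 : nrm y <= d + nrm v.
    have {1}-> : y = (y - v) + v by ncring B.
    exact: nrmD ban _ _.
  by apply: le_trans dv; nra.
have esy : e * st y = st y by rewrite -ste -(stM alg) ye.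
have te : t * e = t by rewrite mulrBl ee -mulrA ye.
have et : e * t = t by rewrite mulrBr ee mulrA esy.
have stt : st t = t by rewrite (stB alg) ste (stM alg) (stK alg).
have [w [_ wI wS]] := inv_sqrt ban t8.
have we : w * e = e * w by apply: (inv_sqrt_comm alg ban _ wS); rewrite te et.
have stw := inv_sqrt_st alg ban stt wS.
have S1 := sub1 subS.
have St : S t by apply: (subB subS) => //; apply: (subM subS) => //; exact: (sub_st subS).
have Sw : S w by apply: wS => //; [exact: (sub0 subS) | exact: isqrt_step_sub].
have re : (1 + w) * e = e * (1 + w) by rewrite mulrDl mulrDr we mul1r mulr1.
pose v' := y * (1 + w).
have str : st (1 + w) = 1 + w by rewrite (stD alg) (st1 alg) stw.
have v'E : st v' * v' = e.
  rewrite (stM alg) str /v' -!mulrA (mulrA (st y)).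
  have -> : st y * y = e * (1 - t) by rewrite mulrBr et mulr1 /t subKr.
  by rewrite -(mulrA e) mulrA re -mulrA (mulrA (1 + w)) wI mulr1.
have v'e : v' * e = v' by rewrite /v' -mulrA re mulrA ye.
have fv' : f * v' = v' by rewrite /v' mulrA fy.
exists v'; split=> //; first by apply: (subM subS) => //; exact: (subD subS).
pose g := f - v' * st v'.
suff g0 : g = 0 by apply/eqP; rewrite eq_sym -subr_eq0 -/g g0.
have gv' : g * v' = 0 by rewrite mulrBl fv' -mulrA v'E v'e subrr.
have gy : g * y = 0.
  by rewrite -[y]mulr1 -wI !mulrA -(mulrA g) gv' !mul0r.
have gf : g * f = g.
  rewrite mulrBl ff -mulrA; congr (_ - _ * _).
  by rewrite -stf -(stM alg) fv'.
have gE : g = - (g * ((y - v) * st v)).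
  have -> : - (g * ((y - v) * st v)) = g * (v * st v) - (g * y) * st v by ncring B.
  by rewrite vF gf gy mul0r subr0.
apply: (nrm_eq0 ban); have g0 := nrm_ge0 ban g.
have h1 := nrmM ban g ((y - v) * st v); have h2 := nrmM ban (y - v) (st v).
have h3 : nrm g = nrm (g * ((y - v) * st v)) by rewrite {1}gE (nrmN ban).
rewrite (nrm_st ban) -/d in h2.
have h4 : nrm ((y - v) * st v) <= 8^-1 by nra.
nra.
Qed.

Variable F : nat -> B -> Prop.
Hypothesis subF : forall n, star_subalgebra sc st (F n).
Hypothesis finF : forall n, finite_span sc (F n).
Hypothesis properF : forall n x, F n x -> st x * x = 0 -> x = 0.
Hypothesis incF : forall n x, F n x -> F n.+1 x.
Hypothesis denseF : forall x (e : R), 0 < e -> exists n y, F n y /\ nrm (y - x) < e.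

Lemma incF_le m n x : (m <= n)%N -> F m x -> F n x.
Proof.
move=> mn; rewrite -(subnKC mn); elim: (n - m)%N => [|k IH]; first by rewrite addn0.
by move=> /IH; rewrite addnS; exact: incF.
Qed.

Lemma approx_projection e : is_proj e -> exists n p u,
  [/\ F n p, is_proj p, st u * u = 1, u * st u = 1 & u * e = p * u].
Proof.
move=> pe; set D := 8 * (nrm e + 2) ^+ 2 + 1.
have D0 : 0 < D by have := nrm_ge0 ban e; rewrite /D; nra.
have /denseF-/(_ e)[n [y [Fy ye]]] : 0 < 8^-1 / D by rewrite divr_gt0// invr_gt0.
have yD : nrm (y - e) * D <= 8^-1 by rewrite -ler_pdivlMr// ltW.
have [p [Fp pp pe8]] := near_projection (subF n) (finite_closed (subF n) (finF n)) pe Fy yD yD.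
have [|u [u1 u2 ue]] := unitary_of_close pe pp.
  by rewrite -(nrmN ban) opprB; lra.
by exists n, p, u.
Qed.

(** Everything is transported into one [F k]: unitaries move [e] and [f] to projections [p] and [q]
    there, and the transported partial isometry [x] is replaced by a nearby one in [F k]. The
    complements are compared in [F k] and the result is conjugated back. *)
Theorem complements_equiv e f v : is_proj e -> is_proj f ->
  st v * v = e -> v * st v = f ->
  exists w, st w * w = 1 - e /\ w * st w = 1 - f.
Proof.
move=> pe pf vE vF.
have [n [p [u [Fp pp u1 u2 ue]]]] := approx_projection pe.
have [m [q [u' [Fq pq u'1 u'2 u'f]]]] := approx_projection pf.
have [ste ee] := pe; have [stf ff] := pf; have [stp pp'] := pp; have [stq qq] := pq.
have pE : p = u * e * st u by rewrite ue -mulrA u2 mulr1.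
have qE : q = u' * f * st u' by rewrite u'f -mulrA u'2 mulr1.
have svF : st v * f * v = e by rewrite -vF -!mulrA (mulrA (st v)) vE ee.
pose x := u' * f * v * st u.
have xE : st x * x = p.
  rewrite /x !(stM alg) stf (stK alg) !mulrA.
  rewrite -(mulrA _ (st u')) u'1 mulr1 -(mulrA _ f f) ff.
  by rewrite -(mulrA u) -(mulrA u) svF pE.
have xF : x * st x = q.
  rewrite /x !(stM alg) stf (stK alg) !mulrA -(mulrA _ (st u)) u1 mulr1.
  by rewrite -(mulrA _ v) vF -(mulrA _ f f) ff -(mulrA _ f f) ff qE.
have qx : q * x = x.
  by rewrite qE /x !mulrA -(mulrA _ (st u')) u'1 mulr1 -(mulrA _ f f) ff.
have xp : x * p = x by rewrite -xE mulrA xF qx.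
(* Compressing an approximant [y] to [q * y * p] multiplies its distance to [x] by at most [M]. *)
pose M := nrm q * nrm p + 1; pose D := M * (2 * nrm x + 1).
have x0 := nrm_ge0 ban x.
have M0 : 1 <= M by rewrite lerDr mulr_ge0// (nrm_ge0 ban).
have D0 : 0 < D by rewrite mulr_gt0//; lra.
have /denseF-/(_ x)[l [y [Fy yx]]] : 0 < 8^-1 / D by rewrite divr_gt0// invr_gt0.
have yD : nrm (y - x) * D <= 8^-1 by rewrite -ler_pdivlMr// ltW.
pose k := maxn (maxn n m) l.
have Fp' : F k p by apply: incF_le Fp; rewrite !leq_max leqnn.
have Fq' : F k q by apply: incF_le Fq; rewrite !leq_max leqnn orbT.
have Fy' : F k y by apply: incF_le Fy; rewrite leq_max leqnn orbT.
have [||||x' [Fx x'E x'F]] := near_partial_isometry (subF k)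
    (finite_closed (subF k) (finF k)) pp pq Fp' xE xF (y := q * y * p).
- by do !apply: (subM (subF k)).
- by rewrite !mulrA qq.
- by rewrite -mulrA pp'.
- have -> : q * y * p - x = q * (y - x) * p by rewrite mulrBr mulrBl qx xp.
  apply: le_trans yD; rewrite /D mulrA; apply: ler_wpM2r; first lra.
  have h1 := nrmM ban (q * (y - x)) p; have h2 := nrmM ban q (y - x).
  have := nrm_ge0 ban (y - x); have := nrm_ge0 ban p; have := nrm_ge0 ban q.
  rewrite /M; nra.
have [w [Fw wE wF]] := complement_equiv alg (subF k) (finF k) (@properF k)
  Fx Fp' Fq' stp pp' stq qq x'E x'F.
have conj (a b U : B) : st U * U = 1 -> U * a = b * U -> st U * (1 - b) * U = 1 - a.
  move=> U1 Ua; rewrite mulrBr mulrBl mulr1 U1 -mulrA -Ua mulrA U1 mul1r.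
  by [].
exists (st u' * w * u); rewrite !(stM alg) (stK alg); split.
  rewrite !mulrA -(mulrA _ u') u'2 mulr1 -(mulrA _ (st w)) wE.
  exact: conj.
rewrite !mulrA -(mulrA _ u) u2 mulr1 -(mulrA _ w) wF.
exact: conj.
Qed.

(** Let [c] be the complement of [q + r]. Then [u * r + c] is a partial isometry from [r + c], whose
    complement is [q], to [f + c], whose complement is [u * p * st u]; the latter is equivalent to
    [p] through [u]. Thus the statement on complements gives cancellation. *)
Theorem orthogonal_cancellation p q r v : is_proj p -> is_proj q -> is_proj r ->
  p * r = 0 -> q * r = 0 -> st v * v = p + r -> v * st v = q + r ->
  exists y, [/\ st y * y = p, y * st y = q, y * p = y & q * y = y].
Proof.
move=> [stp pp] [stq qq] [str rr] pr qr v1E v1F.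
have rp : r * p = 0 by rewrite -str -stp -(stM alg) pr (st0 alg).
have rq : r * q = 0 by rewrite -str -stq -(stM alg) qr (st0 alg).
have pj a b : is_proj a -> is_proj b -> a * b = 0 -> b * a = 0 -> is_proj (a + b).
  move=> [sta aa] [stb bb] ab ba; split; first by rewrite (stD alg) sta stb.
  by rewrite mulrDl !mulrDr aa ab ba bb addr0 add0r.
have [sts ss] := pj p r (conj stp pp) (conj str rr) pr rp.
have [stt tt] := pj q r (conj stq qq) (conj str rr) qr rq.
set s := p + r in sts ss v1E; set t := q + r in stt tt v1F.
(* Properness is at hand only in the [F n], so [v * s = v] is not known; cutting by [s] enforces it
   for [u]. *)
pose u := v * s.
have uE : st u * u = s by rewrite (stM alg) sts mulrA -(mulrA s) v1E !ss.
have uF : u * st u = t.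
  by rewrite (stM alg) sts mulrA -(mulrA v) ss -v1E mulrA v1F -mulrA v1F tt.
have us : u * s = u by rewrite /u -mulrA ss.
have tu : t * u = u by rewrite -uF -mulrA uE us.
have ut : st u * t = st u by rewrite -stt -(stM alg) tu.
have rs : r * s = r by rewrite mulrDr rp rr add0r.
have sr : s * r = r by rewrite mulrDl pr rr add0r.
have rt : r * t = r by rewrite mulrDr rq rr add0r.
have tr : t * r = r by rewrite mulrDl qr rr add0r.
have ps : p * s = p by rewrite mulrDr pr pp addr0.
have sp : s * p = p by rewrite mulrDl rp pp addr0.
pose c := 1 - t.
have stc : st c = c by rewrite (stB alg) (st1 alg) stt.
have cc : c * c = c by rewrite mulrBl mul1r mulrBr mulr1 tt subrr subr0.
have cu : c * u = 0 by rewrite mulrBl mul1r tu subrr.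
have uc : st u * c = 0 by rewrite mulrBr mulr1 ut subrr.
have rc : r * c = 0 by rewrite mulrBr mulr1 rt subrr.
have cr : c * r = 0 by rewrite mulrBl mul1r tr subrr.
pose f := u * r * st u.
have stf : st f = f by rewrite /f (stM alg (u * r)) (stM alg u) (stK alg) str mulrA.
have ff : f * f = f.
  have -> : f * f = u * (r * (st u * u) * r) * st u by rewrite /f; ncring B.
  by rewrite uE rs rr.
have fc : f * c = 0 by rewrite /f -mulrA uc mulr0.
have cf : c * f = 0.
  have -> : c * f = (c * u) * (r * st u) by rewrite /f; ncring B.
  by rewrite cu mul0r.
have [w [wE wF]] : exists w, st w * w = 1 - (r + c) /\ w * st w = 1 - (f + c).
  apply: (@complements_equiv _ _ (u * r + c)).
  - exact: pj.
  - exact: pj.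
  - rewrite (stD alg) stc (stM alg) str.
    have -> : (r * st u + c) * (u * r + c) =
      r * (st u * u) * r + r * (st u * c) + (c * u) * r + c * c by ncring B.
    by rewrite uE uc cu cc rs rr mulr0 mul0r !addr0.
  - rewrite (stD alg) stc (stM alg) str.
    have -> : (u * r + c) * (r * st u + c) =
      u * (r * r) * st u + u * (r * c) + (c * r) * st u + c * c by ncring B.
    by rewrite rr rc cr cc mulr0 mul0r !addr0.
have wE' : st w * w = q by rewrite wE /c /t; ncring B.
have wF' : w * st w = u * p * st u.
  rewrite wF /f.
  have -> : c = 1 - u * st u by rewrite uF.
  have -> : 1 - (u * r * st u + (1 - u * st u)) = (u - u * r) * st u by ncring B.
  by rewrite -{1}us /s; congr (_ * _); ncring B.
have stup : st (u * p) = p * st u by rewrite (stM alg) stp.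
pose y := st w * (u * p).
have yE : st y * y = p.
  rewrite (stM alg) (stK alg) stup.
  have -> : p * st u * w * (st w * (u * p)) = p * st u * (w * st w) * u * p by ncring B.
  rewrite wF'; have -> : p * st u * (u * p * st u) * u * p =
    p * (st u * u) * p * (st u * u) * p by ncring B.
  by rewrite uE ps pp ps pp.
have yF : y * st y = q.
  rewrite (stM alg) (stK alg) stup.
  have -> : st w * (u * p) * (p * st u * w) = st w * (u * (p * p) * st u) * w by ncring B.
  rewrite pp -wF'; have -> : st w * (w * st w) * w = st w * w * (st w * w) by ncring B.
  by rewrite wE' qq.
have yp : y * p = y by rewrite /y -!mulrA pp.
by exists y; split=> //; rewrite -yF -mulrA yE yp.
Qed.

End Approximation.

(** * Cancellation for AF algebras *)

Section MatrixAlgebra.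
Variables (R : realType) (A : cstarAlgType R).

Lemma cstar_star_algebra : star_algebra (in_alg A) (@star R A).
Proof.
split.
- by move=> c x; rewrite mulr_algl mulr_algr.
- exact: starK.
- exact: starD.
- exact: starM.
- by move=> c; rewrite /= starZ star1.
Qed.

Lemma cstar_norm : banach_norm (in_alg A) (@star R A) (@cnorm R A).
Proof.
have ge0 (x : A) : 0 <= cnorm x.
  have := cnormD_le x (- x); rewrite subrr.
  have -> : cnorm (0 : A) = 0.
    by have := cnormZ 0 (0 : A); rewrite scale0r normr0 /= mul0r.
  have -> : cnorm (- x) = cnorm x.
    have -> : - x = (-1)%:C%C *: x by rewrite rmorphN1 scaleN1r.
    by rewrite cnormZ Re_norm_real normrN1 mul1r.
  by lra.
(* The C*-identity bounds the square of [cnorm x] by [cnorm (star x) * cnorm x]. *)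
have le (x : A) : cnorm x <= cnorm (star x).
  have x0 := ge0 x; have [x00|x00] := eqVneq (cnorm x) 0; first by rewrite x00.
  have xp : 0 < cnorm x by rewrite lt0r x00.
  rewrite -(ler_pM2r xp); have := cnorm_starM x; rewrite expr2 => <-.
  exact: cnormM_le.
split.
- exact: cnorm0_eq0.
- exact: cnormD_le.
- by move=> c x; rewrite mulr_algl cnormZ.
- exact: cnormM_le.
- by move=> x; apply: le_anti; rewrite le andbT -{2}[x]starK le.
- exact: cnorm_complete.
Qed.

Variable n : nat.
Notation M := 'M[A]_n.+1.
Definition mx_sc : {rmorphism R[i] -> M} :=
  (@scalar_mx A n.+1 \o in_alg A : {rmorphism R[i] -> M}).

Lemma mx_scE c (x : M) : mx_sc c * x = \matrix_(i, j) (c *: x i j).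
Proof.
by apply/matrixP => i j; rewrite /= -[_ * x]/(_ *m x) mul_scalar_mx !mxE mulr_algl.
Qed.

Lemma mx_star_algebra : star_algebra mx_sc (@star_mx R A n.+1 n.+1).
Proof.
split.
- move=> c x; rewrite mx_scE; apply/matrixP => i j; rewrite !mxE (bigD1 j)//=.
  rewrite big1 ?addr0 => [|k /negPf kj]; first by rewrite mxE eqxx mulr_algr.
  by rewrite mxE kj mulr0.
- exact: star_mxK.
- by move=> x y; apply/matrixP => i j; rewrite !mxE starD.
- by move=> x y; exact: star_mxM.
- move=> c; apply/matrixP => i j; rewrite !mxE eq_sym.
  by case: eqP => _; rewrite ?mulr1n ?mulr0n ?star0// starZ star1.
Qed.

(** Elementary substitute for the C*-norm of the matrix algebra: no representation of [A] has to be
    built, and completeness is checked entrywise. *)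
Definition mx_norm1 (x : M) : R := \sum_i \sum_j cnorm (x i j).

Lemma cnorm_ge0 (x : A) : 0 <= cnorm x.
Proof. exact: nrm_ge0 cstar_norm x. Qed.

Lemma cnorm_le_mx (x : M) i j : cnorm (x i j) <= mx_norm1 x.
Proof.
rewrite /mx_norm1 (bigD1 i)//= (bigD1 j)//= -addrA lerDl addr_ge0//.
  by apply: sumr_ge0 => k _; exact: cnorm_ge0.
by apply: sumr_ge0 => k _; apply: sumr_ge0 => l _; exact: cnorm_ge0.
Qed.

Lemma mx_norm1_lt (x : M) (e : R) :
  (forall i j, cnorm (x i j) < e) -> mx_norm1 x < (n.+1 * n.+1)%:R * e.
Proof.
move=> xe; have -> : (n.+1 * n.+1)%:R * e = \sum_(i < n.+1) \sum_(j < n.+1) e.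
  by rewrite !sumr_const !card_ord -mulrnA mulr_natl.
apply: ltr_sum; first by apply/hasP; exists ord0; rewrite ?mem_index_enum.
move=> i _; apply: ltr_sum => //.
by apply/hasP; exists ord0; rewrite ?mem_index_enum.
Qed.

Lemma mx_norm1_banach : banach_norm mx_sc (@star_mx R A n.+1 n.+1) mx_norm1.
Proof.
have := cstar_norm => -[n0 nD nZ nM nst nc]; split.
- move=> x x0; apply/matrixP => i j; rewrite mxE; apply: n0; apply/eqP.
  by rewrite eq_le cnorm_ge0 andbT -x0 cnorm_le_mx.
- move=> x y; rewrite -big_split ler_sum// => i _.
  by rewrite -big_split ler_sum// => j _; rewrite mxE.
- move=> c x; rewrite mx_scE /mx_norm1 mulr_sumr; apply: eq_bigr => i _.
  by rewrite mulr_sumr; apply: eq_bigr => j _; rewrite mxE cnormZ.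
- move=> x y; rewrite /mx_norm1 mulr_suml; apply: ler_sum => i _.
  apply: (@le_trans _ _ (\sum_k \sum_j cnorm (x i j) * cnorm (y j k))).
    apply: ler_sum => k _; rewrite mxE.
    elim/big_ind2: _ => [|a b c d ab cd|j _]; last exact: nM.
      by rewrite (nrm0 cstar_norm).
    by apply: le_trans (nD _ _) _; exact: lerD.
  rewrite exchange_big /= mulr_suml; apply: ler_sum => j _.
  rewrite -mulr_sumr; apply: ler_wpM2l; first exact: cnorm_ge0.
  rewrite [leRHS](bigD1 j)//= lerDl; apply: sumr_ge0 => k _.
  by apply: sumr_ge0 => l _; exact: cnorm_ge0.
- move=> x; rewrite /mx_norm1 exchange_big; apply: eq_bigr => i _.
  by apply: eq_bigr => j _; rewrite mxE nst.
move=> u uc.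
have /choice[l lP] : forall ij : 'I_n.+1 * 'I_n.+1, exists l : A,
    forall e : R, 0 < e -> exists N : nat, forall m : nat,
      (N <= m)%N -> cnorm (u m ij.1 ij.2 - l) < e.
  move=> [i j]; apply: nc => e /uc[N NP]; exists N => m k Nm Nk /=.
  apply: le_lt_trans (NP _ _ Nm Nk).
  by have := cnorm_le_mx (u m - u k) i j; rewrite !mxE.
exists (\matrix_(i, j) l (i, j)) => e e0.
have d0 : 0 < e / (n.+1 * n.+1)%:R by rewrite divr_gt0// ltr0n.
have /choice[N NP] : forall ij : 'I_n.+1 * 'I_n.+1, exists N : nat, forall m : nat,
      (N <= m)%N -> cnorm (u m ij.1 ij.2 - l ij) < e / (n.+1 * n.+1)%:R.
  by move=> ij; exact: lP.
exists (\max_ij N ij)%N => m Nm.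
rewrite -[e](@divfK _ (n.+1 * n.+1)%:R) ?pnatr_eq0// mulrC; apply: mx_norm1_lt.
move=> i j; rewrite !mxE; apply: (NP (i, j)).
exact: leq_trans (leq_bigmax (i, j)) Nm.
Qed.

Section Sub.
Variable F : set A.
Hypothesis fF : findim_cstar_subalg F.

Lemma findim_star_subalgebra : star_subalgebra (in_alg A) (@star R A) F.
Proof.
case: fF => F1 FD FZ FM Fs _; split=> //.
by move=> c; exact: FZ.
Qed.

Lemma findim_finite_span : finite_span (in_alg A) F.
Proof.
case: fF => _ _ _ _ _ [k [b bP]]; exists 'I_k, b => x /bP[c ->].
by exists c; apply: eq_bigr => i _; rewrite mulr_algl.
Qed.

Definition mx_over (x : M) := forall i j, F (x i j).

Lemma mx_star_subalgebra : star_subalgebra mx_sc (@star_mx R A n.+1 n.+1) mx_over.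
Proof.
have subF := findim_star_subalgebra.
case: fF => F1 FD FZ FM Fs _; split.
- move=> c i j; rewrite !mxE; case: eqP => _; rewrite ?mulr1n ?mulr0n.
    exact: FZ.
  exact: sub0 subF.
- by move=> x y Fx Fy i j; rewrite mxE; exact: FD.
- move=> x y Fx Fy i j; rewrite mxE; apply: (sub_sum subF) => k _.
  exact: FM.
- by move=> x Fx i j; rewrite mxE; exact: Fs.
Qed.

Lemma mx_finite_span : finite_span mx_sc mx_over.
Proof.
case: findim_finite_span => I [b bP].
exists ('I_n.+1 * 'I_n.+1 * I)%type.
exists (fun p => \matrix_(i, j) (if (i == p.1.1) && (j == p.1.2) then b p.2 else 0)).
move=> x Fx.
have /choice[c cP] : forall ij : 'I_n.+1 * 'I_n.+1, exists c : I -> R[i],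
    x ij.1 ij.2 = \sum_k in_alg A (c k) * b k by move=> [i j]; exact: bP.
exists (fun p => c p.1 p.2); apply/matrixP => i j.
rewrite summxE; under eq_bigr => p _ do rewrite mx_scE !mxE.
rewrite -(pair_bigA _ (fun ij k =>
  c ij k *: (if (i == ij.1) && (j == ij.2) then b k else 0))) /=.
rewrite (bigD1 (i, j))//= [X in _ + X]big1 ?addr0.
  have /= -> := cP (i, j); apply: eq_bigr => k _.
  by rewrite !eqxx /= mulr_algl.
move=> [i' j'] ij; rewrite big1// => k _ /=.
case: ifP => [/andP[/eqP ii /eqP jj]|_]; last by rewrite scaler0.
by rewrite ii jj eqxx in ij.
Qed.

Lemma findim_proper x : F x -> star x * x = 0 -> x = 0.
Proof.
move=> _ x0; apply: (@cnorm0_eq0 R A).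
by apply/eqP; rewrite -[_ == 0](expf_eq0 _ 2) -cnorm_starM x0 (nrm0 cstar_norm).
Qed.

(** The diagonal entry [j] of [star_mx x * x] is a sum of terms [star (x k j) * x k j]; a faithful
    trace on [F] turns its vanishing into that of each term. *)
Lemma mx_proper x : mx_over x -> star_mx x * x = 0 -> x = 0.
Proof.
move=> Fx x0; have subF := findim_star_subalgebra.
have [T [TD TZ _ _ T0 T00]] := trace_exists cstar_star_algebra subF
  findim_finite_span findim_proper.
have Fxx i j : F (star (x i j) * x i j).
  by apply: (subM subF) => //; exact: (sub_st subF).
have T_0 : T 0 = 0.
  by have := TZ 0 0 (sub0 subF); rewrite rmorph0 !mul0r.
apply/matrixP => i j; rewrite mxE; apply: T00 => //.
have := congr1 (fun y : M => T (y j j)) x0; rewrite !mxE T_0.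
have -> : \sum_k star_mx x j k * x k j = \sum_k star (x k j) * x k j.
  by apply: eq_bigr => k _; rewrite mxE.
have -> : T (\sum_k star (x k j) * x k j) = \sum_k T (star (x k j) * x k j).
  suff [] : F (\sum_k star (x k j) * x k j) /\
    T (\sum_k star (x k j) * x k j) = \sum_k T (star (x k j) * x k j) by [].
  elim/big_rec2: _ => [|k y1 y2 _ [Fy <-]].
    by split=> //; exact: sub0 subF.
  by split; [exact: (subD subF) | rewrite TD].
move=> /eqP; rewrite psumr_eq0 => [/allP/(_ i)|k _]; last exact: T0.
by rewrite mem_index_enum => /(_ isT) /eqP.
Qed.

End Sub.

Hypothesis AF : is_AF A.

Theorem mx_orthogonal_cancellation (p q r v : M) :
  is_proj (@star_mx R A _ _) p -> is_proj (@star_mx R A _ _) q ->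
  is_proj (@star_mx R A _ _) r ->
  p * r = 0 -> q * r = 0 -> star_mx v * v = p + r -> v * star_mx v = q + r ->
  exists y, [/\ star_mx y * y = p, y * star_mx y = q, y * p = y & q * y = y].
Proof.
move=> pp pq pr pr0 qr0 vE vF; have [F [fF incF denseF]] := AF.
apply: (orthogonal_cancellation mx_star_algebra mx_norm1_banach
  (F := fun k => mx_over (F k)) _ _ _ _ _ pp pq pr pr0 qr0 vE vF).
- by move=> k; exact: mx_star_subalgebra.
- by move=> k; exact: mx_finite_span.
- by move=> k x; exact: mx_proper.
- by move=> k x Fx i j; exact/incF.
move=> x e e0.
have d0 : 0 < e / (n.+1 * n.+1)%:R by rewrite divr_gt0// ltr0n.
have /choice[h hP] : forall ij : 'I_n.+1 * 'I_n.+1, exists ky : nat * A,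
    F ky.1 ky.2 /\ cnorm (ky.2 - x ij.1 ij.2) < e / (n.+1 * n.+1)%:R.
  move=> [i j]; have [k [y [Fy yx]]] := denseF (x i j) _ d0.
  by exists (k, y); rewrite -(nrmN cstar_norm) opprB.
have incF_le k l y : (k <= l)%N -> F k y -> F l y.
  move=> kl; rewrite -(subnKC kl); elim: (l - k)%N => [|m IH]; first by rewrite addn0.
  by move=> /IH; rewrite addnS; exact: incF.
exists (\max_ij (h ij).1)%N, (\matrix_(i, j) (h (i, j)).2); split.
  move=> i j; rewrite mxE; have [+ _] := hP (i, j); apply: incF_le.
  exact: (leq_bigmax (i, j)).
rewrite -[e](@divfK _ (n.+1 * n.+1)%:R) ?pnatr_eq0// mulrC; apply: mx_norm1_lt.
by move=> i j; rewrite !mxE; have [] := hP (i, j).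
Qed.

End MatrixAlgebra.

(** * Cancellation in V(A) and passage to K_0 *)

Section Cancellation.
Variables (R : realType) (A : cstarAlgType R).

Lemma star_col_mx m1 m2 n (a : 'M[A]_(m1, n)) (b : 'M[A]_(m2, n)) :
  star_mx (col_mx a b) = row_mx (star_mx a) (star_mx b).
Proof.
apply/matrixP => i j; rewrite mxE.
by case: (split_ordP j) => j' ->; rewrite ?(row_mxEl, row_mxEr) ?(col_mxEu, col_mxEd) mxE.
Qed.

Lemma star_row_mx m n1 n2 (a : 'M[A]_(m, n1)) (b : 'M[A]_(m, n2)) :
  star_mx (row_mx a b) = col_mx (star_mx a) (star_mx b).
Proof. by rewrite -[RHS]star_mxK star_col_mx !star_mxK. Qed.

Lemma joint_isometries m n k : exists N (J1 : 'M[A]_(N.+1, m))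
    (J2 : 'M[A]_(N.+1, n)) (J3 : 'M[A]_(N.+1, k)),
  [/\ star_mx J1 *m J1 = 1%:M, star_mx J2 *m J2 = 1%:M, star_mx J3 *m J3 = 1%:M,
      star_mx J1 *m J3 = 0 & star_mx J2 *m J3 = 0].
Proof.
(* The additional first row makes the size a successor even if [m], [n] and [k] are all 0. *)
pose J1 : 'M[A]_(1 + (m + n + k), m) := col_mx 0 (col_mx (col_mx 1%:M 0) 0).
pose J2 : 'M[A]_(1 + (m + n + k), n) := col_mx 0 (col_mx (col_mx 0 1%:M) 0).
pose J3 : 'M[A]_(1 + (m + n + k), k) := col_mx 0 (col_mx 0 1%:M).
exists (m + n + k)%N, J1, J2, J3.
suff : [/\ star_mx J1 *m J1 = 1%:M, star_mx J2 *m J2 = 1%:M, star_mx J3 *m J3 = 1%:M,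
      star_mx J1 *m J3 = 0 & star_mx J2 *m J3 = 0] by [].
by split; rewrite !star_col_mx !star_mx0 ?star_mx1 !mul_row_col
  !(mulmx0, mul0mx, mulmx1, addr0, add0r).
Qed.

Lemma isometry_conj_proj m N (J : 'M[A]_(N.+1, m)) (x : 'M[A]_m) :
  star_mx J *m J = 1%:M -> star_mx x = x /\ x *m x = x ->
  is_proj (@star_mx R A N.+1 N.+1) (J *m x *m star_mx J).
Proof.
move=> JJ [sx xx]; split; first by rewrite !star_mxM star_mxK sx mulmxA.
rewrite -[_ * _]/(_ *m _) -!mulmxA (mulmxA (star_mx J)) JJ mul1mx.
by rewrite (mulmxA x) xx.
Qed.

(** The isometries turn block sums into orthogonal sums [P + S] and [Q + S] in a single square
    matrix algebra, where orthogonal cancellation applies. The relations [y * P = y] and [Q * y = y]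
    let [y] absorb the range projections of [J1] and [J2] when it is compressed back. *)
Theorem mxmvn_cancel (p q r : mxprojection A) : is_AF A ->
  mxmvn (mxp_sum p r) (mxp_sum q r) -> mxmvn p q.
Proof.
move=> AF [V []]; case: p q r V => m p pP [n q qP] [k r rP] /= V VE VF.
have [N [J1 [J2 [J3 [J11 J22 J33 J13 J23]]]]] := joint_isometries m n k.
have J31 : star_mx J3 *m J1 = 0.
  by rewrite -(star_mxK J1) -star_mxM J13 star_mx0.
have J32 : star_mx J3 *m J2 = 0.
  by rewrite -(star_mxK J2) -star_mxM J23 star_mx0.
pose P := J1 *m p *m star_mx J1; pose Q := J2 *m q *m star_mx J2.
pose S := J3 *m r *m star_mx J3.
have PP : is_proj (@star_mx R A _ _) P := isometry_conj_proj J11 pP.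
have QP : is_proj (@star_mx R A _ _) Q := isometry_conj_proj J22 qP.
have SP : is_proj (@star_mx R A _ _) S := isometry_conj_proj J33 rP.
have PS : P * S = 0.
  by rewrite -[P * S]/(P *m S) /P /S -!mulmxA (mulmxA (star_mx J1)) J13 mul0mx !mulmx0.
have QS : Q * S = 0.
  by rewrite -[Q * S]/(Q *m S) /Q /S -!mulmxA (mulmxA (star_mx J2)) J23 mul0mx !mulmx0.
pose K1 := row_mx J1 J3; pose K2 := row_mx J2 J3.
have K11 : star_mx K1 *m K1 = 1%:M.
  by rewrite star_row_mx mul_col_row J11 J13 J31 J33 -scalar_mx_block.
have K22 : star_mx K2 *m K2 = 1%:M.
  by rewrite star_row_mx mul_col_row J22 J23 J32 J33 -scalar_mx_block.
pose U : 'M[A]_N.+1 := K2 *m V *m star_mx K1.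
have UE : star_mx U * U = P + S.
  rewrite -[_ * U]/(_ *m U) /U !star_mxM star_mxK -!mulmxA (mulmxA (star_mx K2)) K22 mul1mx.
  rewrite (mulmxA (star_mx V)) VE star_row_mx mul_block_col !mul0mx addr0 add0r.
  by rewrite mul_row_col !mulmxA.
have UF : U * star_mx U = Q + S.
  rewrite -[U * _]/(U *m _) /U !star_mxM star_mxK -!mulmxA (mulmxA (star_mx K1)) K11 mul1mx.
  rewrite (mulmxA V) VF star_row_mx mul_block_col !mul0mx addr0 add0r.
  by rewrite mul_row_col !mulmxA.
have [y [yE yF yP Qy]] := mx_orthogonal_cancellation AF PP QP SP PS QS UE UF.
have {}yE : star_mx y *m y = P by []. have {}yF : y *m star_mx y = Q by [].
have {}yP : y *m P = y by []. have {}Qy : Q *m y = y by [].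
have Jy : J2 *m star_mx J2 *m y = y.
  by rewrite -{1}Qy /Q !mulmxA -(mulmxA J2 (star_mx J2)) J22 mulmx1 -/Q.
have yJ : y *m (J1 *m star_mx J1) = y.
  by rewrite -{1}yP /P -!mulmxA (mulmxA (star_mx J1) J1) J11 mul1mx !mulmxA
    -(mulmxA y) -(mulmxA y) -/P yP.
exists (star_mx J2 *m y *m J1); rewrite !star_mxM star_mxK /=; split.
  rewrite !mulmxA -(mulmxA _ J2) -(mulmxA _ (J2 *m _)) Jy -(mulmxA _ _ y) yE.
  by rewrite /P !mulmxA J11 mul1mx -mulmxA J11 mulmx1.
rewrite !mulmxA -(mulmxA _ J1) -(mulmxA _ y) yJ -(mulmxA _ y) yF.
by rewrite /Q !mulmxA J22 mul1mx -mulmxA J22 mulmx1.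
Qed.

Theorem Vmon_cancel (a b c : Vmon A) : is_AF A -> a + c = b + c -> a = b.
Proof.
move=> AF; rewrite -(Vcl_repr a) -(Vcl_repr b) -(Vcl_repr c).
rewrite -![Vcl _ + Vcl _]/(Vadd _ _) !Vadd_cl => /VclP pq.
by apply/VclP; exact: mxmvn_cancel pq.
Qed.

Lemma groth_in_inj : is_AF A -> injective (@groth_in (Vmon A)).
Proof.
move=> AF a b /gclP[r /=]; rewrite !addr0; exact: Vmon_cancel.
Qed.

Lemma groth_inD (M : nmodType) (a b : M) : groth_in (a + b) = groth_in a + groth_in b.
Proof.
by rewrite -[RHS]/(gadd _ _) /groth_in gadd_cl /= addr0.
Qed.

Definition mxp_of_subproof (p : projection A) :
  star_mx ((proj_val p)%:M : 'M[A]_1) = (proj_val p)%:M /\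
  ((proj_val p)%:M : 'M[A]_1) *m (proj_val p)%:M = (proj_val p)%:M.
Proof.
case: p => p [/= ps pp]; split; last by rewrite -scalar_mxM pp.
by apply/matrixP => i j; rewrite !ord1 !mxE eqxx !mulr1n.
Qed.

Definition mxp_of (p : projection A) := MxProjection (mxp_of_subproof p).

Lemma mx11_star (x : A) : star_mx (x%:M : 'M[A]_1) = (star x)%:M.
Proof. by apply/matrixP => i j; rewrite !ord1 !mxE eqxx !mulr1n. Qed.

Lemma mxp_of_mvn p q : mxmvn (mxp_of p) (mxp_of q) <-> mvn p q.
Proof.
split=> [[v /= []]|[v [vp vq]]].
  rewrite [v]mx11_scalar mx11_star -!scalar_mxM => /matrixP/(_ 0 0) + /matrixP/(_ 0 0).
  by rewrite !mxE !mulr1n; exists (v 0 0).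
by exists v%:M; rewrite /= mx11_star -!scalar_mxM vp vq.
Qed.

Definition vcl (x : mvn_class A) : Vmon A := Vcl (mxp_of (repr x)).

Lemma vcl_cl p : vcl (mvn_cl p) = Vcl (mxp_of p).
Proof.
apply/VclP/mxp_of_mvn/mvn_clP; exact: reprK.
Qed.

Lemma vcl_inj : injective vcl.
Proof.
move=> x y /VclP/mxp_of_mvn/mvn_clP; rewrite /mvn_cl !reprK; exact.
Qed.

Lemma vcl_ortho (p q r : projection A) : proj_val p * proj_val q = 0 ->
  proj_val r = proj_val p + proj_val q ->
  vcl (mvn_cl p) + vcl (mvn_cl q) = vcl (mvn_cl r).
Proof.
move=> pq rE; rewrite !vcl_cl -[_ + _]/(Vadd _ _) Vadd_cl; apply/VclP.
case: p q r pq rE => p [sp pp] [q [sq qq]] [r [sr rr]] /= pq rE.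
have qp : q * p = 0 by rewrite -sq -sp -starM pq star0.
exists (row_mx p%:M q%:M : 'M[A]_(1, 1 + 1)) => /=.
rewrite star_row_mx !mx11_star sp sq mul_col_row mul_row_col -!scalar_mxM.
by rewrite pp qq pq qp !raddf0 -raddfD rE.
Qed.

(** An equivalence from the block sum of representatives of [a] and [b] to [q] is a one-row matrix.
    Its blocks [v] and [w] have these representatives as sources, and their range projections are
    orthogonal with sum [q]. *)
Lemma vcl_split (q : projection A) (a b : Vmon A) : a + b = vcl (mvn_cl q) ->
  exists p p' : projection A, [/\ a = vcl (mvn_cl p), b = vcl (mvn_cl p'),
    proj_val p + proj_val p' = proj_val q & proj_val p * proj_val p' = 0].
Proof.
case: q => q [sq qq].
rewrite vcl_cl -(Vcl_repr a) -(Vcl_repr b) -[_ + _]/(Vadd _ _) Vadd_cl.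
move=> /VclP; case: (repr a) (repr b) => m x [sx xx] [n y [sy yy]] [V []] /=.
pose D := block_mx x 0 0 y; rewrite -/D => VE VF.
have sD : star_mx D = D by rewrite star_block_mx !star_mx0 sx sy.
have DD : D *m D = D.
  by rewrite mulmx_block !(mulmx0, mul0mx, addr0, add0r) xx yy.
(* Cutting by [D] secures [W *m D = W], from which [v *m x = v] and [w *m y = w] follow. *)
pose W : 'M[A]_(1, m + n) := V *m D.
have WE : star_mx W *m W = D.
  by rewrite star_mxM sD -mulmxA (mulmxA (star_mx V)) VE DD.
have WF : W *m star_mx W = q%:M.
  rewrite star_mxM sD -mulmxA (mulmxA D) DD -VE !mulmxA VF -mulmxA VF.
  by rewrite -scalar_mxM qq.
have WD : W *m D = W by rewrite /W -mulmxA DD.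
pose v := lsubmx W; pose w := rsubmx W.
have Wvw : W = row_mx v w by rewrite hsubmxK.
move: WE WF WD; rewrite Wvw star_row_mx mul_col_row mul_row_col.
move=> /eq_block_mx[vv vw wv ww] vF.
rewrite mul_row_block !mulmx0 addr0 add0r => /eq_row_mx[vx wy].
have E (k : nat) (u : 'M[A]_(1, k)) z : star_mx z = z -> u *m z = u -> star_mx u *m u = z ->
    star ((u *m star_mx u) 0 0) = (u *m star_mx u) 0 0 /\
    (u *m star_mx u) 0 0 * (u *m star_mx u) 0 0 = (u *m star_mx u) 0 0.
  move=> sz uz uu; have s : star_mx (u *m star_mx u) = u *m star_mx u.
    by rewrite star_mxM star_mxK.
  split; first by have := congr1 (fun M : 'M[A]_1 => M 0 0) s; rewrite mxE.
  have M1 (M : 'M[A]_1) : M *m M = M -> M 0 0 * M 0 0 = M 0 0.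
    by move=> /(congr1 (fun M : 'M[A]_1 => M 0 0)); rewrite mxE big_ord1.
  by apply: M1; rewrite -mulmxA (mulmxA (star_mx u)) uu mulmxA uz.
pose p := Projection (E _ v x sx vx vv); pose p' := Projection (E _ w y sy wy ww).
exists p, p'; rewrite !vcl_cl; split.
- apply/VclP; exists v; rewrite /= vv; split=> //.
  by rewrite [LHS]mx11_scalar.
- apply/VclP; exists w; rewrite /= ww; split=> //.
  by rewrite [LHS]mx11_scalar.
- have : (v *m star_mx v + w *m star_mx w) 0 0 = q by rewrite vF mxE eqxx.
  by rewrite mxE.
- rewrite /=; have : (v *m star_mx v) *m (w *m star_mx w) = 0.
    by rewrite -mulmxA (mulmxA (star_mx v)) vw mul0mx mulmx0.
  by move=> /(congr1 (fun M : 'M[A]_1 => M 0 0)); rewrite mxE big_ord1 [in RHS]mxE.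
Qed.

End Cancellation.

(** * Piecewise linear functions with integer coefficients *)

(* Splits on the innermost minima and maxima first. *)
Ltac case_minmax :=
  repeat match goal with
  | |- context [Order.min ?a ?b] =>
    lazymatch constr:((a, b)) with
    | context [Order.min] => fail
    | context [Order.max] => fail
    | _ => case: (leP a b) => ?
    end
  | |- context [Order.max ?a ?b] =>
    lazymatch constr:((a, b)) with
    | context [Order.min] => fail
    | context [Order.max] => fail
    | _ => case: (leP a b) => ?
    end
  end; lra.

Section PiecewiseLinear.
Variable R : realType.
Notation I := (@unit_interval R).
Implicit Types (f g : I -> R) (x y : I).

Lemma unit_itvP x : 0 <= set_val x <= 1.
Proof. by have /set_mem := valP x; rewrite /unit_interval /= in_itv. Qed.

Lemma unit_itv_elt (r : R) : 0 <= r <= 1 -> exists x : I, set_val x = r.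
Proof.
move=> r01; have rI : r \in @unit_interval R.
  by rewrite inE /unit_interval /= in_itv.
by exists (SigSub rI).
Qed.

Lemma unit_itv_inj x y : set_val x = set_val y -> x = y.
Proof. exact: val_inj. Qed.

Definition affine_on f (s t : R) (a b : int) :=
  forall x, s <= set_val x <= t -> f x = a%:~R * set_val x + b%:~R.

(** Closing under concatenation, instead of indexing a partition, turns common refinements into
    nested inductions; [pl_partition] recovers the form used in [M1]. *)
Inductive pl f : R -> R -> Prop :=
| pl_affine s t a b : s <= t -> affine_on f s t a b -> pl f s t
| pl_cat s m t : pl f s m -> pl f m t -> pl f s t.

Lemma pl_le f s t : pl f s t -> s <= t.
Proof. by elim=> // {}s m {}t _ sm _; exact: le_trans. Qed.

Lemma pl_sub f s t s' t' : pl f s t -> s <= s' -> s' <= t' -> t' <= t -> pl f s' t'.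
Proof.
move=> fst; elim: fst s' t' => {s t}[s t a b st fab|s m t _ IH1 _ IH2] s' t' ss' st' tt'.
  apply: (pl_affine (a := a) (b := b)) => // x /andP[xs xt]; apply: fab.
  by apply/andP; split; lra.
have [tm|mt] := leP t' m; first exact: IH1.
have [ms|sm] := leP m s'; first by apply: IH2.
by apply: (@pl_cat _ _ m); [apply: IH1 | apply: IH2] => //; lra.
Qed.

Lemma pl_partition f s t : pl f s t -> exists (n : nat) (p : nat -> R),
  [/\ p 0%N = s, p n = t, forall i, (i < n)%N -> p i <= p i.+1 &
      forall i, (i < n)%N -> exists a b, affine_on f (p i) (p i.+1) a b].
Proof.
elim=> {s t}[s t a b st fab|s m t _ [n [p [p0 pn pm pf]]] _ [k [q [q0 qk qm qf]]]].
  exists 1%N, (fun i => if i == 0%N then s else t); split=> // [[|i]//|[|//] _].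
  by exists a, b.
pose w i := if (i <= n)%N then p i else q (i - n)%N.
have wp i : (i <= n)%N -> w i = p i by rewrite /w => ->.
have wq i : (n <= i)%N -> w i = q (i - n)%N.
  move=> ni; rewrite /w; case: leqP => // le.
  have -> : i = n by apply/eqP; rewrite eqn_leq le ni.
  by rewrite subnn q0 pn.
exists (n + k)%N, w; split.
- by rewrite wp.
- by rewrite wq ?leq_addr// addKn.
- move=> i ink; have [lin|nli] := ltnP i n; first by rewrite !wp ?pm// ltnW.
  by rewrite (wq i)// (wq i.+1) ?leqW// subSn// qm// ltn_subLR.
- move=> i ink; have [lin|nli] := ltnP i n.
    by rewrite !wp//; [exact: pf | exact: ltnW].
  by rewrite (wq i)// (wq i.+1) ?leqW// subSn//; apply: qf; rewrite ltn_subLR.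
Qed.

Lemma M1_pl f : M1 f <-> continuous f /\ pl f 0 1.
Proof.
split=> [[cf [n [p [p0 pn pm pf]]]]|[cf /pl_partition[n [p [p0 pn pm pf]]]]]; split=> //.
  have P k : (k < n)%N -> pl f (p 0%N) (p k.+1).
    elim: k => [|k IH] kn.
      by have [a [b fab]] := pf _ kn; apply: (pl_affine (pm _ kn) fab).
    apply: (@pl_cat _ _ (p k.+1)); first exact/IH/ltnW.
    by have [a [b fab]] := pf _ kn; apply: (pl_affine (pm _ kn) fab).
  case: n => [|n] in pn pm pf P *.
    by have := oner_neq0 R; rewrite -pn p0 eqxx.
  by rewrite -p0 -pn; apply: P.
by exists n, p; split=> // i /pf.
Qed.

Lemma pl_min_affine f g s t a b c d : s <= t ->
  affine_on f s t a b -> affine_on g s t c d ->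
  pl (fun x => Num.min (f x) (g x)) s t.
Proof.
wlog ca : f g a b c d / (c <= a)%R.
  move=> H st fab gcd; have [ca|ac] := leP c a; first exact: (H f g a b c d).
  have -> : (fun x => Num.min (f x) (g x)) = (fun x => Num.min (g x) (f x)).
    by apply/funext => x; rewrite minC.
  by apply: (H g f c d a b) => //; exact: ltW.
move=> st fab gcd.
have minl u v : s <= u -> u <= v -> v <= t ->
    (forall r, u <= r <= v -> a%:~R * r + b%:~R <= c%:~R * r + d%:~R :> R) ->
    pl (fun x => Num.min (f x) (g x)) u v.
  move=> su uv vt le; apply: (pl_affine (a := a) (b := b)) => // x /[dup] /le {}le /andP[ux xv].
  by rewrite min_l fab ?gcd//; apply/andP; split; lra.
have minr u v : s <= u -> u <= v -> v <= t ->
    (forall r, u <= r <= v -> c%:~R * r + d%:~R <= a%:~R * r + b%:~R :> R) ->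
    pl (fun x => Num.min (f x) (g x)) u v.
  move=> su uv vt le; apply: (pl_affine (a := c) (b := d)) => // x /[dup] /le {}le /andP[ux xv].
  by rewrite min_r gcd ?fab//; apply/andP; split; lra.
have [ac|ac] := eqVneq a c.
  have [bd|db] := leP (b%:~R : R) d%:~R.
    by apply: minl => // r _; rewrite ac; lra.
  by apply: minr => // r _; rewrite ac; lra.
have dac : 0 < a%:~R - c%:~R :> R by rewrite subr_gt0 ltr_int lt_neqAle eq_sym ac.
(* Abscissa where the two lines cross; [f] is the lower one to its left because [c < a]. *)
pose m : R := (d%:~R - b%:~R) / (a%:~R - c%:~R).
have mE : m * (a%:~R - c%:~R) = d%:~R - b%:~R by rewrite divfK// gt_eqF.
have lem (r : R) : r <= m -> a%:~R * r + b%:~R <= c%:~R * r + d%:~R.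
  by rewrite -(ler_pM2r dac) mE; lra.
have gem (r : R) : m <= r -> c%:~R * r + d%:~R <= a%:~R * r + b%:~R.
  by rewrite -(ler_pM2r dac) mE; lra.
have [ms|sm] := leP m s.
  by apply: minr => // r /andP[sr _]; apply: gem; lra.
have [tm|mt] := leP t m.
  by apply: minl => // r /andP[_ rt]; apply: lem; lra.
apply: (@pl_cat _ _ m); [apply: minl => // | apply: minr => //]; try lra.
  by move=> r /andP[_ rm]; apply: lem.
by move=> r /andP[rm _]; apply: gem.
Qed.

Lemma pl_min f g s t : pl f s t -> pl g s t ->
  pl (fun x => Num.min (f x) (g x)) s t.
Proof.
elim=> {s t}[s t a b st fab gst|s m t fsm IH1 fmt IH2 gst]; last first.
  have sm := pl_le fsm; have mt := pl_le fmt.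
  by apply: (@pl_cat _ _ m); [apply: IH1 | apply: IH2]; apply: pl_sub gst _ _ _.
elim: gst fab => {s t st}[s t c d st gcd fab|s m t gsm IH1 gmt IH2 fab].
  exact: pl_min_affine fab gcd.
have sm := pl_le gsm; have mt := pl_le gmt.
apply: (@pl_cat _ _ m); [apply: IH1 | apply: IH2] => x /andP[xl xr];
  by apply: fab; apply/andP; split; lra.
Qed.

Lemma M1_min f g : M1 f -> M1 g -> M1 (fun x => Num.min (f x) (g x)).
Proof.
move=> /M1_pl[cf fpl] /M1_pl[cg gpl]; apply/M1_pl; split; last exact: pl_min.
by move=> x; apply: continuous_min; [exact: cf | exact: cg].
Qed.

Lemma M1_val : M1 (fun x : I => set_val x).
Proof.
apply/M1_pl; split; first exact: initial_continuous.
apply: (pl_affine (a := 1) (b := 0)) => // x _.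
by rewrite mul1r addr0.
Qed.

Lemma increasing_expanding f s t : pl f s t -> 0 <= s -> t <= 1 ->
  (forall x y, set_val x < set_val y -> f x < f y) ->
  forall x y, s <= set_val x -> set_val x <= set_val y -> set_val y <= t ->
    set_val y - set_val x <= f y - f x.
Proof.
elim=> {s t}[s t a b st fab|s m t fsm IH1 fmt IH2] s0 t1 finc x y sx xy yt.
  move: xy; rewrite le_eqVlt => /orP[/eqP/unit_itv_inj->|xy].
    by rewrite !subrr.
  have := finc _ _ xy; rewrite !fab; try (by apply/andP; split; lra).
  move=> axy; have a0 : 0 < a%:~R * (set_val y - set_val x) by lra.
  have a1 : 1 <= a%:~R :> R.
    by move: a0; rewrite pmulr_lgt0 ?subr_gt0// ltr0z ler1z gtz0_ge1.
  nra.
have sm := pl_le fsm; have mt := pl_le fmt.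
have m01 : 0 <= m <= 1 by apply/andP; split; lra.
have [z zm] := unit_itv_elt m01.
have [ym|my] := leP (set_val y) m; first by apply: IH1 => //; lra.
have [mx|xm] := leP m (set_val x); first by apply: IH2 => //; lra.
have h1 : set_val z - set_val x <= f z - f x by apply: IH1 => //; lra.
have h2 : set_val y - set_val z <= f y - f z by apply: IH2 => //; lra.
lra.
Qed.

(** Expansion between 0 and [x] gives [x <= f x], expansion between [x] and 1 gives [f x <= x],
    because the values stay in the unit interval. *)
Lemma increasing_identity f : M1 f -> (forall x, 0 <= f x <= 1) ->
  (forall x y, set_val x < set_val y -> f x < f y) -> f = (fun x => set_val x).
Proof.
move=> /M1_pl[_ fpl] f01 finc; apply/funext => x.
have ex := increasing_expanding fpl (lexx _) (lexx _) finc.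
have /andP[x0 x1] := unit_itvP x.
have [|z0 z0E] := @unit_itv_elt 0; first by rewrite lexx ler01.
have [|z1 z1E] := @unit_itv_elt 1; first by rewrite lexx ler01.
have h0 : set_val x - set_val z0 <= f x - f z0 by apply: ex; lra.
have h1 : set_val z1 - set_val x <= f z1 - f x by apply: ex; lra.
by have := f01 z0; have := f01 z1; lra.
Qed.

(** Composition with the retraction [c] of the line onto the interval extends [f] to a continuous
    function on [R], to which the monotonicity of continuous injections on an interval applies. *)
Lemma injective_monotone f : continuous f -> injective f ->
  (forall x y, set_val x < set_val y -> f x < f y) \/
  (forall x y, set_val x < set_val y -> f y < f x).
Proof.
move=> cf finj.
have cl01 (r : R) : 0 <= Num.max 0 (Num.min r 1) <= 1.
  by rewrite le_max lexx /= ge_max ler01 ge_min lexx orbT.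
have [c cE] := choice (fun r => unit_itv_elt (cl01 r)).
have cK x : c (set_val x) = x.
  apply: unit_itv_inj; rewrite cE; have /andP[x0 x1] := unit_itvP x.
  by rewrite min_l// max_r.
pose h r := f (c r).
have ch : continuous h.
  move=> r; apply: (@continuous_comp _ _ _ c f); last exact: cf.
  apply: continuous_comp_initial => {}r.
  have -> : set_val \o c = (fun r : R => Num.max 0 (Num.min r 1)).
    by apply/funext => u; exact: cE.
  apply: (@continuous_max _ _ (cst 0) (fun r : R => Num.min r 1)); first exact: cvg_cst.
  by apply: (@continuous_min _ _ id (cst 1)); [exact: cvg_id | exact: cvg_cst].
have : {in `[0, 1]%R &, injective h}.
  move=> u v; rewrite !in_itv /= => u01 v01 /finj cuv.
  have [x xE] := unit_itv_elt u01; have [y yE] := unit_itv_elt v01.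
  by move: cuv; rewrite -xE -yE !cK => ->.
move=> /(itv_continuous_inj_mono (continuous_subspaceT ch)) [hm|hm]; [left|right].
  move=> x y xy; rewrite -(cK x) -(cK y) -/(h _) -/(h (set_val y)).
  by apply: hm => //; rewrite in_itv /= unit_itvP.
move=> x y xy; rewrite -(cK x) -(cK y) -/(h _) -/(h (set_val y)).
by apply: hm => //; rewrite in_itv /= unit_itvP.
Qed.

Definition clamp (r : R) := Num.max 0 (Num.min 1 r).

Lemma clamp_id r : 0 <= r <= 1 -> clamp r = r.
Proof. by move=> /andP[r0 r1]; rewrite /clamp min_r// max_r. Qed.

Lemma clamp_ge1 r : 1 <= r -> clamp r = 1.
Proof. by move=> r1; rewrite /clamp min_l// max_r. Qed.

Lemma clamp_le0 r : r <= 0 -> clamp r = 0.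
Proof. by move=> r0; rewrite /clamp; case_minmax. Qed.

Lemma clamp_le r r' : r <= r' -> clamp r <= clamp r'.
Proof.
move=> rr'; rewrite /clamp ge_max le_max lexx /= le_max; apply/orP; right.
by rewrite le_min !ge_min lexx rr' orbT.
Qed.

(** * McNaughton's theorem in one variable *)

Section McNaughton.
Variable G : (I -> R) -> Prop.
Hypothesis G01 : forall f, G f -> forall x, 0 <= f x <= 1.
Hypothesis G0 : G (fun=> 0).
Hypothesis Gval : G (fun x => set_val x).
Hypothesis GC : forall f, G f -> G (fun x => 1 - f x).
Hypothesis GD : forall f g, G f -> G g -> G (fun x => Num.min (f x + g x) 1).

Lemma G_ext f g : f =1 g -> G f -> G g.
Proof. by move=> /funext->. Qed.

Lemma G1 : G (fun=> 1).
Proof. by apply: G_ext (GC G0) => x; rewrite subr0. Qed.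

(** The MV-algebra term for the join: truncated difference of [f] and [g], then truncated sum with
    [g]. *)
Lemma G_max f g : G f -> G g -> G (fun x => Num.max (f x) (g x)).
Proof.
move=> Gf Gg; apply: G_ext (GD (GC (GD (GC Gf) Gg)) Gg) => x.
have := G01 Gf x; have := G01 Gg x => /andP[g0 g1] /andP[f0 f1].
by rewrite /=; case_minmax.
Qed.

Lemma G_min f g : G f -> G g -> G (fun x => Num.min (f x) (g x)).
Proof.
move=> Gf Gg; apply: G_ext (GC (G_max (GC Gf) (GC Gg))) => x /=.
by case_minmax.
Qed.

Lemma G_luk f g : G f -> G g -> G (fun x => Num.max 0 (f x + g x - 1)).
Proof.
move=> Gf Gg; apply: G_ext (GC (GD (GC Gf) (GC Gg))) => x /=.
by case_minmax.
Qed.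

(** Raises the slope of a truncated line [l] by one when [r] is the variable: truncated sum of
    [clamp l] and [r], then Lukasiewicz product with [clamp (l + 1)]. The product corrects the range
    [l < 0], the only one where the sum may be wrong. *)
Lemma clamp_step (l r : R) : 0 <= r <= 1 ->
  Num.max 0 (Num.min (clamp l + r) 1 + clamp (l + 1) - 1) = clamp (l + r).
Proof.
move=> /andP[r0 r1]; have [l1|l1] := leP 1 l.
  by rewrite !clamp_ge1; [case_minmax| lra..].
have [l0|l0] := leP 0 l.
  rewrite (@clamp_ge1 (l + 1)); last lra.
  rewrite (@clamp_id l); last by rewrite l0 ltW.
  by rewrite /clamp; case_minmax.
rewrite (@clamp_le0 l); last lra.
have [lN1|lN1] := leP l (- 1).
  by rewrite !clamp_le0; [case_minmax| lra..].
rewrite (@clamp_id (l + 1)); last by apply/andP; split; lra.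
rewrite add0r min_l// /clamp (@min_r _ _ 1 (l + r)); last lra.
by congr (Num.max 0 _); ring.
Qed.

(** Induction on a natural slope, for all [b] at once since the step uses [b] and [b + 1]. Negative
    slopes follow from [1 - clamp r = clamp (1 - r)]. *)
Lemma G_line (a b : int) : G (fun x => clamp (a%:~R * set_val x + b%:~R)).
Proof.
have P n : forall b : int, G (fun x => clamp (n%:R * set_val x + b%:~R)).
  elim: n => [|n IH] {}b.
    have [b0|b0] := leP b 0.
      apply: G_ext G0 => x; rewrite mul0r add0r /clamp.
      have : b%:~R <= 0 :> R by rewrite lerz0.
      by move=> ?; rewrite min_r ?max_l//; lra.
    apply: G_ext G1 => x; rewrite mul0r add0r /clamp.
    have : 1 <= b%:~R :> R by rewrite ler1z.
    by move=> ?; rewrite min_l ?max_r.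
  apply: G_ext (G_luk (GD (IH b) Gval) (IH (b + 1))) => x /=.
  rewrite rmorphD rmorph1 addrA clamp_step ?unit_itvP//; congr clamp.
  by rewrite -natr1; ring.
case: a => n; first exact: P.
apply: G_ext (GC (P n.+1 (1 - b))) => x /=.
rewrite NegzE rmorphB rmorphN rmorph1 /= -pmulrn.
set u := n.+1%:R * _; have -> : - n.+1%:R * set_val x = - u by rewrite mulNr.
rewrite /clamp.
by case_minmax.
Qed.

Definition has_separator f (P Q : R * R) := exists2 g, G g &
  (forall x, P.1 <= set_val x <= P.2 -> f x <= g x) /\
  (forall x, Q.1 <= set_val x <= Q.2 -> g x <= f x).

Variable f : I -> R.
Hypothesis f01 : forall x, 0 <= f x <= 1.

(** The choice [n * (s - t) > 2] leaves room for an integer between [n * t + 1] and [n * s]. *)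
Lemma steep_line (t s : R) : t < s -> exists (n : nat) (b : int),
  1 <= b%:~R - n%:R * t /\ b%:~R - n%:R * s <= 0.
Proof.
move=> ts; have d0 : 0 < s - t by lra.
have nP : 2 / (s - t) < (Num.bound (2 / (s - t)))%:R.
  by apply: archi_boundP; rewrite divr_ge0// ltW.
set n := Num.bound _ in nP; rewrite ltr_pdivrMr// in nP.
exists n, (Num.ceil (n%:R * t + 1)).
have := ceil_itv (n%:R * t + 1) => /andP.
rewrite rmorphB rmorph1 => -[h1 h2]; split; lra.
Qed.

(** Pieces with a gap between them are separated by a steep truncated line, equal to 1 on the left
    piece and to 0 on the right one. Adjacent pieces are separated by the line of one of them,
    chosen by comparing the slopes. *)
Lemma has_separator_lr s t s' t' a b a' b' : 0 <= s -> s <= t -> t <= s' -> s' <= t' ->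
  t' <= 1 -> affine_on f s t a b -> affine_on f s' t' a' b' ->
  has_separator f (s, t) (s', t').
Proof.
move=> s0 st ts' st' t1 fab fab'; rewrite /has_separator /=.
have [ts|] := ltP t s'.
  have [n [c [c1 c0]]] := steep_line ts.
  exists (fun x => clamp ((- n%:Z)%:~R * set_val x + c%:~R)).
    exact: G_line.
  have n0 : 0 <= n%:R :> R by [].
  split=> x /andP[xl xr]; rewrite rmorphN /= -pmulrn mulNr /clamp; have /andP[f0 f1] := f01 x.
    rewrite min_l; first by rewrite max_r.
    by nra.
  rewrite min_r; first by rewrite max_l//; nra.
  by nra.
move=> s't; have {s't ts'}ts' : t = s' by lra.
have t01 : 0 <= t <= 1 by apply/andP; split; lra.
have [z zt] := unit_itv_elt t01.
have E1 : f z = a%:~R * t + b%:~R by rewrite fab zt//; apply/andP; split; lra.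
have E2 : f z = a'%:~R * t + b'%:~R by rewrite fab' zt//; apply/andP; split; lra.
have [aa|aa] := leP a a'; [exists (fun x => clamp (a%:~R * set_val x + b%:~R))
  |exists (fun x => clamp (a'%:~R * set_val x + b'%:~R))]; try exact: G_line; split=> x xst.
- by rewrite -fab// clamp_id.
- rewrite -[leRHS]clamp_id//; apply: clamp_le; rewrite fab'//.
  move: aa xst; rewrite -(ler_int R) => aa /andP[h1 h2]; nra.
- rewrite -[leLHS]clamp_id//; apply: clamp_le; rewrite fab//.
  move: aa xst; rewrite -(ltr_int R) => aa /andP[h1 h2]; nra.
- by rewrite -fab'// clamp_id.
Qed.

(** Mirror image of the previous case: the steep line is replaced by 1 minus it. *)
Lemma has_separator_rl s t s' t' a b a' b' : 0 <= s' -> s' <= t' -> t' <= s -> s <= t ->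
  t <= 1 -> affine_on f s t a b -> affine_on f s' t' a' b' ->
  has_separator f (s, t) (s', t').
Proof.
move=> s0 st ts' st' t1 fab fab'; rewrite /has_separator /=.
have [ts|] := ltP t' s.
  have [n [c [c1 c0]]] := steep_line ts.
  exists (fun x => clamp (n%:~R * set_val x + (1 - c)%:~R)).
    exact: G_line.
  have n0 : 0 <= n%:R :> R by [].
  split=> x /andP[xl xr]; rewrite rmorphB rmorph1 -pmulrn /clamp; have /andP[f0 f1] := f01 x.
    rewrite min_l; first by rewrite max_r.
    by nra.
  rewrite min_r; first by rewrite max_l//; nra.
  by nra.
move=> s't; have {s't ts'}ts' : t' = s by lra.
have t01 : 0 <= s <= 1 by apply/andP; split; lra.
have [z zt] := unit_itv_elt t01.
have E1 : f z = a%:~R * s + b%:~R by rewrite fab zt//; apply/andP; split; lra.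
have E2 : f z = a'%:~R * s + b'%:~R by rewrite fab' zt//; apply/andP; split; lra.
have [aa|aa] := leP a' a; [exists (fun x => clamp (a%:~R * set_val x + b%:~R))
  |exists (fun x => clamp (a'%:~R * set_val x + b'%:~R))]; try exact: G_line; split=> x xst.
- by rewrite -fab// clamp_id.
- rewrite -[leRHS]clamp_id//; apply: clamp_le; rewrite fab'//.
  move: aa xst; rewrite -(ler_int R) => aa /andP[h1 h2]; nra.
- rewrite -[leLHS]clamp_id//; apply: clamp_le; rewrite fab//.
  move: aa xst; rewrite -(ltr_int R) => aa /andP[h1 h2]; nra.
- by rewrite -fab'// clamp_id.
Qed.

(* f is the supremum over i of the infimum over j of functions of G lying above f
   on the i-th piece and below f on the j-th. *)
Theorem mcnaughton : M1 f -> G f.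
Proof.
move=> [_ [n [p [p0 pn pm pf]]]].
have mono i j : (i <= j)%N -> (j <= n)%N -> p i <= p j.
  move=> ij; rewrite -(subnKC ij); elim: (j - i)%N => [|k IH]; first by rewrite addn0.
  rewrite addnS => ikn; apply: le_trans (pm _ ikn); apply: IH; exact: ltnW.
pose P i := (p i, p i.+1).
have sep i j : (i < n)%N -> (j < n)%N -> has_separator f (P i) (P j).
  move=> lin ljn; have [a [b fab]] := pf _ lin; have [c [d fcd]] := pf _ ljn.
  have i0 : 0 <= p i by rewrite -p0 mono// ltnW.
  have j0 : 0 <= p j by rewrite -p0 mono// ltnW.
  have i1 : p i.+1 <= 1 by rewrite -pn mono.
  have j1 : p j.+1 <= 1 by rewrite -pn mono.
  have [ij|ji|ij] := ltngtP i j.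
  - by apply: (has_separator_lr i0 (pm _ lin) _ (pm _ ljn) j1 fab fcd);
      apply: mono => //; exact: ltnW.
  - by apply: (has_separator_rl j0 (pm _ ljn) _ (pm _ lin) i1 fab fcd);
      apply: mono => //; exact: ltnW.
  rewrite -ij; exists (fun x => clamp (a%:~R * set_val x + b%:~R)); first exact: G_line.
  by split=> x xi; rewrite -fab// clamp_id.
have inf i m : (i < n)%N -> (m <= n)%N -> exists2 g, G g &
    (forall x, p i <= set_val x <= p i.+1 -> f x <= g x) /\
    (forall j x, (j < m)%N -> p j <= set_val x <= p j.+1 -> g x <= f x).
  move=> lin; elim: m => [|m IH] mn.
    by exists (fun=> 1); [exact: G1 | split=> // x _; have /andP[] := f01 x].
  have [g Gg [g1 g2]] := IH (ltnW mn); have [h Gh [/= h1 h2]] := sep _ _ lin mn.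
  exists (fun x => Num.min (g x) (h x)); first exact: G_min.
  split=> [x xi|j x]; first by rewrite le_min g1// h1.
  rewrite ltnS leq_eqVlt => /orP[/eqP->|jm] xj; rewrite ge_min; apply/orP.
    by right; exact: h2.
  by left; exact: g2 xj.
have sup m : (m <= n)%N -> exists2 g, G g &
    (forall i x, (i < m)%N -> p i <= set_val x <= p i.+1 -> f x <= g x) /\
    (forall j x, (j < n)%N -> p j <= set_val x <= p j.+1 -> g x <= f x).
  elim: m => [|m IH] mn.
    by exists (fun=> 0); [exact: G0 | split=> // j x _ _; have /andP[] := f01 x].
  have [g Gg [g1 g2]] := IH (ltnW mn); have [h Gh [h1 h2]] := inf _ _ mn (leqnn n).
  exists (fun x => Num.max (g x) (h x)); first exact: G_max.
  split=> [i x|j x jn xj].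
    rewrite ltnS leq_eqVlt => /orP[/eqP->|im] xi; rewrite le_max; apply/orP.
      by right; exact: h1.
    by left; exact: g1 xi.
  by rewrite ge_max (g2 j)// (h2 j).
have [g Gg [g1 g2]] := sup n (leqnn n).
apply: G_ext Gg => x; have /andP[x0 x1] := unit_itvP x.
have [i lin xi] : exists2 i, (i < n)%N & p i <= set_val x <= p i.+1.
  have : exists i, (p i <= set_val x) && (i <= n)%N by exists 0%N; rewrite p0 x0.
  move=> H; have B i : (p i <= set_val x) && (i <= n)%N -> (i <= n)%N by case/andP.
  case: (ex_maxnP H B) => i /andP[pi lin] imax.
  have [ni|ni] := ltnP i n.
    exists i => //; rewrite pi /= leNgt; apply/negP => lt.
    by have := imax i.+1; rewrite (ltW lt) ni ltnn => /(_ isT).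
  (* No later node bounds [x] here; then [x] is 1 and belongs to the last piece, of index [n.-1]. *)
  have iE : i = n by apply/eqP; rewrite eqn_leq lin ni.
  have n0 : (0 < n)%N.
    by rewrite lt0n; apply/eqP => n0; have := oner_neq0 R; rewrite -pn n0 p0 eqxx.
  have x1E : set_val x = 1 by apply: le_anti; rewrite x1 -pn -iE pi.
  exists n.-1; first by rewrite prednK.
  by rewrite prednK// x1E pn lexx andbT -pn mono// leq_pred.
by apply: le_anti; rewrite (g1 i)// (g2 i).
Qed.

End McNaughton.
End PiecewiseLinear.

(** * The Elliott monoid of the Farey algebra *)

(** The range of [D] is the free MV-algebra on one generator; generators and automorphisms are
    studied from this record alone. *)
Record unit_interval_model (R : realType) (T : Type) (E : inv_monoid_ops T)
    (D : T -> @unit_interval R -> R) : Prop := UnitIntervalModel {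
  model_inj : injective D;
  model_M1 : forall x, M1 (D x);
  model_01 : forall x t, 0 <= D x t <= 1;
  model_surj : forall f, M1 f -> (forall t, 0 <= f t <= 1) -> exists x, D x = f;
  model_zero : D (im_zero E) = (fun=> 0);
  model_star : forall x, D (im_star E x) = (fun t => 1 - D x t);
  model_add : forall x y, D (im_add E x y) = (fun t => Num.min (D x t + D y t) 1)
}.

(** * Generators and automorphisms of the model *)

Section Model.
Variables (R : realType) (T : Type) (E : inv_monoid_ops T).
Variable D : T -> @unit_interval R -> R.
Hypothesis mD : unit_interval_model E D.

Let D_inj := model_inj mD.

Lemma model_starK x : im_star E (im_star E x) = x.
Proof.
apply: D_inj; rewrite !(model_star mD); apply/funext => t.
by rewrite opprB addrC subrK.
Qed.

Lemma generator_star x : im_generator E x -> im_generator E (im_star E x).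
Proof.
move=> gx S SE Sx; apply: gx => //; rewrite -(model_starK x).
by case: SE => _ + _; exact.
Qed.

Lemma identity_generates x : D x = (fun t => set_val t) -> im_generator E x.
Proof.
move=> Dx S [S0 SC SD] Sx; apply/seteqP; split=> // y _.
pose G f := exists2 z, S z & D z = f.
have [z Sz /D_inj<-//] : G (D y).
apply: mcnaughton; last exact: model_M1 mD _.
- by move=> f [z _ <-]; exact: model_01 mD _.
- by exists (im_zero E) => //; exact: model_zero mD.
- by exists x.
- by move=> f [z Sz <-]; exists (im_star E z); [exact: SC|exact: model_star mD _].
- move=> f g [z Sz <-] [w Sw <-]; exists (im_add E z w); first exact: SD.
  exact: model_add mD _ _.
- exact: model_01 mD _.
Qed.

Lemma generatorP x : im_generator E x <->
  D x = (fun t => set_val t) \/ D x = (fun t => 1 - set_val t).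
Proof.
split=> [gx|[Dx|Dx]]; last 2 first.
- exact: identity_generates.
- rewrite -(model_starK x); apply/generator_star/identity_generates.
  by rewrite (model_star mD) Dx; apply/funext => t; rewrite subKr.
have [y yE] := model_surj mD (M1_val R) (@unit_itvP R).
have xinj : injective (D x).
  (* Failure to separate [s] from [t] is preserved by the operations, so it would pass from [x] to
     [y], whose function is the identity. *)
  move=> s t Dst; pose S z := D z s = D z t.
  have : S y.
    have -> : S = setT; last by [].
    apply: gx => //; split; rewrite /S.
    - by rewrite (model_zero mD).
    - by move=> z Sz; rewrite (model_star mD) Sz.
    - by move=> z w Sz Sw; rewrite (model_add mD) Sz Sw.
  by rewrite /S yE => /unit_itv_inj.
have [cx _] := model_M1 mD x.
have [inc|dec] := injective_monotone cx xinj.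
  by left; apply: increasing_identity inc; [exact: model_M1 mD _ | exact: model_01 mD _].
right; have : D (im_star E x) = (fun t => set_val t).
  apply: increasing_identity; [exact: model_M1 mD _ | exact: model_01 mD _|].
  by move=> s t /dec st; rewrite (model_star mD) ler_ltB.
rewrite (model_star mD) => /funeqP Dx; apply/funext => t.
by rewrite -Dx subKr.
Qed.

Lemma generator_cases x y : im_generator E x -> im_generator E y ->
  y = x \/ y = im_star E x.
Proof.
move=> /generatorP gx /generatorP gy.
have C : forall f : @unit_interval R -> R, f = (fun t => 1 - (1 - f t)).
  by move=> f; apply/funext => t; rewrite subKr.
by case: gx gy => Dx [] Dy; [left|right|right|left]; apply: D_inj;
  rewrite ?(model_star mD) Dx Dy// -C.
Qed.

Lemma star_neq_generator x : im_generator E x -> im_star E x <> x.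
Proof.
have [|z zE] := @unit_itv_elt R 0; first by rewrite lexx ler01.
move=> /generatorP gx /(congr1 (fun x => D x z)); rewrite (model_star mD).
by case: gx => ->; rewrite zE; lra.
Qed.

Lemma automorphism_eq x h h' : im_generator E x ->
  im_automorphism E h -> im_automorphism E h' -> h x = h' x -> h = h'.
Proof.
move=> gx [_ h0 hs ha] [_ h0' hs' ha'] hx; apply/funext => y.
pose S z := h z = h' z.
have ST : S = setT.
  apply: gx => //; split; rewrite /S; first by rewrite h0 h0'.
    by move=> z Sz; rewrite hs hs' Sz.
  by move=> z w Sz Sw; rewrite ha ha' Sz Sw.
by rewrite -/(S y) ST.
Qed.

(** That the range of [D] is stable under composition with the reflection [r] is not checked on
    pieces: the elements for which it holds form a submonoid containing the generator, since
    reflecting [D x] gives [1 - D x]. *)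
Lemma reflection_automorphism x : im_generator E x ->
  exists2 h, im_automorphism E h & h x = im_star E x.
Proof.
have flip01 (t : @unit_interval R) : 0 <= 1 - set_val t <= 1.
  by have := unit_itvP t; lra.
have [r rE] := choice (fun t => unit_itv_elt (flip01 t)).
have rK t : r (r t) = t by apply: unit_itv_inj; rewrite !rE subKr.
move=> gx; have := gx => /generatorP Dx.
have /choice[h hE] : forall y, exists z, D z = D y \o r.
  move=> y; pose S y := exists z, D z = D y \o r.
  suff ST : S = setT by rewrite -/(S y) ST.
  apply: gx.
    split; rewrite /S.
    - by exists (im_zero E); rewrite (model_zero mD).
    - by move=> z [w wE]; exists (im_star E w); rewrite !(model_star mD) wE.
    - move=> z z' [w wE] [w' wE']; exists (im_add E w w').
      by rewrite !(model_add mD) wE wE'.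
  exists (im_star E x); rewrite (model_star mD); apply/funext => t /=.
  by case: Dx => ->; rewrite rE.
have hK : involutive h.
  by move=> y; apply: D_inj; rewrite !hE; apply/funext => t /=; rewrite rK.
exists h; last first.
  apply: D_inj; rewrite hE (model_star mD); apply/funext => t /=.
  by case: Dx => ->; rewrite rE.
split; first exact: inv_bij.
- by apply: D_inj; rewrite hE (model_zero mD).
- by move=> y; apply: D_inj; rewrite !(hE, model_star mD).
- by move=> y z; apply: D_inj; rewrite !(hE, model_add mD).
Qed.

End Model.

(** * Identification of the Elliott monoid *)

Section Farey.
Variables (R : realType) (A : cstarAlgType R).
Hypothesis hA : is_farey_algebra A.
Variable E : inv_monoid_ops (mvn_class A).
Hypothesis hE : is_elliott_monoid E.

Lemma mvn_clE (x : mvn_class A) : exists p, x = mvn_cl p.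
Proof. by exists (repr x); rewrite /mvn_cl reprK. Qed.

Theorem farey_model : exists D, unit_interval_model (R := R) E D.
Proof.
have [AF [phi [phiD phi_inj phiM1 phi_pos phi1]]] := hA.
have phi0 : phi 0 = (fun=> 0).
  apply: (@addrI _ (phi 0)); rewrite -phiD addr0.
  by apply/funext => t; rewrite /GRing.add /= addr0.
have phiE x y t : phi (x + y) t = phi x t + phi y t by rewrite phiD.
have phiM x : M1 (phi x) by rewrite -phiM1; exists x.
pose D x := phi (groth_in (vcl x)).
have D_inj : injective D by move=> x y /phi_inj/(groth_in_inj AF)/vcl_inj.
have D1 : D (mvn_cl (proj1 A)) = (fun=> 1).
  rewrite -phi1 /D /K0_unit vcl_cl; congr (phi (groth_in _)).
  by apply/VclP; exists 1%:M; rewrite /= star_mx1 mul1mx.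
have Dortho (p q r : projection A) : proj_val p * proj_val q = 0 ->
    proj_val r = proj_val p + proj_val q ->
    forall t, D (mvn_cl r) t = D (mvn_cl p) t + D (mvn_cl q) t.
  by move=> pq rE t; rewrite /D -(vcl_ortho pq rE) groth_inD phiE.
have D0 : D (mvn_cl (proj0 A)) = (fun=> 0).
  apply/funext => t; have := @Dortho (proj0 A) (proj0 A) (proj0 A).
  by rewrite /= mulr0 addr0 => /(_ erefl erefl t); lra.
have D_ge0 x t : 0 <= D x t.
  by move: t; apply/phi_pos; exists (vcl x).
have DC (p : projection A) t : D (mvn_cl (projC p)) t = 1 - D (mvn_cl p) t.
  have := @Dortho p (projC p) (proj1 A).
  rewrite /= mulrBr mulr1; case: (projP p) => _ ->; rewrite subrr addrC subrK.
  by move=> /(_ erefl erefl t); rewrite D1; lra.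
have D_le1 x t : D x t <= 1.
  by have [p ->] := mvn_clE x; have := D_ge0 (mvn_cl (projC p)) t; rewrite DC; lra.
(* Both [f] and its difference from the function of [q] come from positive elements of [K0], so
   cancellation gives an equation in V(A), which [vcl_split] realizes inside [q]. *)
have split_class (q : projection A) f : M1 f -> (forall t, 0 <= f t <= D (mvn_cl q) t) ->
    exists p p' : projection A, [/\ D (mvn_cl p) = f,
      proj_val p + proj_val p' = proj_val q & proj_val p * proj_val p' = 0].
  move=> Mf f01; have [k _ kf] : range phi f by rewrite phiM1.
  have /phi_pos[a kE] : forall t, 0 <= phi k t.
    by move=> t; rewrite kf; have /andP[] := f01 t.
  have [b bE] : K0_ge0 (groth_in (vcl (mvn_cl q)) - k).
    apply/phi_pos => t; have := phiE (groth_in (vcl (mvn_cl q)) - k) k t.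
    by rewrite subrK kf -/(D _); have := f01 t; lra.
  have /(groth_in_inj AF)/vcl_split[p [p' [ap bp pp' ort]]] :
      groth_in (a + b) = groth_in (vcl (mvn_cl q)).
    by rewrite groth_inD -bE -kE addrC subrK.
  by exists p, p'; split=> //; rewrite /D -ap -kE.
have D_surj f : M1 f -> (forall t, 0 <= f t <= 1) -> exists x, D x = f.
  move=> Mf f01; have [|p [_ [pf _ _]]] := split_class (proj1 A) f Mf.
    by rewrite D1.
  by exists (mvn_cl p).
have D_M1 x : M1 (D x) by exact: phiM.
have le_D x y : mvn_le x y -> forall t, D x t <= D y t.
  move=> [p [q [-> -> qp]]] t.
  case: (projP p) (projP q) => sp pp [sq qq].
  have pq : proj_val p * proj_val q = proj_val p.
    by rewrite -[in LHS]sp -sq -starM qp sp.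
  have cP : star (proj_val q - proj_val p) = proj_val q - proj_val p /\
      (proj_val q - proj_val p) * (proj_val q - proj_val p) = proj_val q - proj_val p.
    by rewrite starD starN sp sq mulrBl !mulrBr pp qq pq qp subrr subr0.
  have := @Dortho p (Projection cP) q; rewrite /= mulrBr pq pp subrr addrC subrK.
  by move=> /(_ erefl erefl t) ->; rewrite lerDl.
have D_le x y : (forall t, D x t <= D y t) -> mvn_le x y.
  have [q ->] := mvn_clE y => le.
  have [|p [p' [/D_inj px pp' ort]]] := split_class q (D x) (D_M1 x).
    by move=> t; rewrite D_ge0 le.
  exists p, q; split=> //; rewrite -pp' mulrDl; case: (projP p) (projP p') => sp -> [sp' _].
  by rewrite -[X in _ + X]starK starM sp sp' ort star0 addr0.
have Dstar x t : D (im_star E x) t = 1 - D x t.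
  by have [p ->] := mvn_clE x; rewrite (elliott_star hE) DC.
(* [x] is realized by [p] and, since [D y <= 1 - D x], [y] by a projection [r] below the complement
   [p'] of [p]. These are orthogonal, so an axiom of the Elliott monoid computes their sum. *)
have Dadd_le1 x y : (forall t, D x t + D y t <= 1) ->
    forall t, D (im_add E x y) t = D x t + D y t.
  move=> le t; have [|p [p' [/D_inj px pp' ort]]] := split_class (proj1 A) (D x) (D_M1 x).
    by move=> u; rewrite D1 D_ge0 D_le1.
  have p'E u : D (mvn_cl p') u = 1 - D x u.
    by have := Dortho _ _ _ ort (esym pp') u; rewrite D1 px; lra.
  have [|r [r' [/D_inj ry rr' ort']]] := split_class p' (D y) (D_M1 y).
    by move=> u; rewrite p'E D_ge0 /=; have := le u; lra.
  have [[sp pp] [sr rr] [sr' _]] := And3 (projP p) (projP r) (projP r').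
  have r'r : proj_val r' * proj_val r = 0.
    by rewrite -sr' -sr -starM ort' star0.
  have pr : proj_val p * proj_val r = 0.
    have {1}-> : proj_val r = proj_val p' * proj_val r by rewrite -rr' mulrDl rr r'r addr0.
    by rewrite mulrA ort mul0r.
  have rp : proj_val r * proj_val p = 0 by rewrite -sr -sp -starM pr star0.
  have qP : star (proj_val p + proj_val r) = proj_val p + proj_val r /\
      (proj_val p + proj_val r) * (proj_val p + proj_val r) = proj_val p + proj_val r.
    by rewrite starD sp sr mulrDl !mulrDr pp pr rp rr addr0 add0r.
  rewrite -px -ry (elliott_add_ortho hE (r := Projection qP) pr erefl).
  exact: Dortho.
have y_le_add x y t : D y t <= D (im_add E x y) t.
  have [q yq] := mvn_clE y.
  have e0 : im_add E (mvn_cl (proj0 A)) y = y.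
    rewrite yq; apply: (elliott_add_ortho hE); first by rewrite /= mul0r.
    by rewrite /= add0r.
  rewrite -{1}e0; apply: le_D; apply: (elliott_add_mono hE); apply: D_le => u.
  by rewrite D0.
exists D; split=> //.
- by move=> x t; rewrite D_ge0 D_le1.
- by rewrite (elliott_zero hE).
- by move=> x; apply/funext => t; exact: Dstar.
move=> x y; apply/funext => t.
pose z := im_add E x y.
(* Lower bound: [y] is replaced by its minimum [y'] with [im_star E x], for which the sum with [x]
   is not truncated, and monotonicity concludes. *)
apply/le_anti/andP; split; last first.
  pose f u := Num.min (D y u) (D (im_star E x) u).
  have [|y' y'E] := D_surj f (M1_min (D_M1 y) (D_M1 _)).
    by move=> u; rewrite /f le_min ge_min !D_ge0 D_le1.
  have : D (im_add E x y') t <= D z t.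
    apply: le_D; rewrite /z !(elliott_addC hE x); apply: (elliott_add_mono hE).
    by apply: D_le => u; rewrite y'E /f ge_min lexx.
  rewrite Dadd_le1 y'E /f => [|u]; rewrite Dstar; case_minmax.
rewrite le_min D_le1 andbT.
(* Upper bound: adding [im_star E z] to [z] gives 1, so [im_star E x] lies below
   [im_add E y (im_star E z)] by leastness. The latter sum is not truncated since [D y <= D z], and
   the inequality becomes [D z <= D x + D y]. *)
have le : 1 - D x t <= D (im_add E y (im_star E z)) t.
  have : im_add E x (im_add E y (im_star E z)) = mvn_cl (proj1 A).
    rewrite (elliott_addA hE) -/z; have [p ->] := mvn_clE z.
    by rewrite (elliott_star hE) (elliott_starP hE).
  have [p ->] := mvn_clE x; have [q ->] := mvn_clE (im_add E y (im_star E z)).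
  by move=> /(elliott_star_least hE)/le_D; rewrite -DC; exact.
move: le; rewrite Dadd_le1 => [|u]; rewrite Dstar; first by rewrite -/z; lra.
by have := y_le_add x y u; rewrite -/z; lra.
Qed.

End Farey.

Theorem theorem3p2 (R : realType) (A : cstarAlgType R)
    (hA : is_farey_algebra A)
    (E : inv_monoid_ops (mvn_class A)) (hE : is_elliott_monoid E) :
  [/\ exists x : mvn_class A, im_generator E x,
      forall p q : projection A,
        im_generator E (mvn_cl p) -> im_generator E (mvn_cl q) ->
        exists! h : mvn_class A -> mvn_class A,
          im_automorphism E h /\ h (mvn_cl p) = mvn_cl q
    & forall p : projection A, im_generator E (mvn_cl p) ->
        [/\ im_generator E (mvn_cl (projC p)),
            mvn_cl (projC p) <> mvn_cl p
          & forall q : projection A, im_generator E (mvn_cl q) ->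
              mvn_cl q = mvn_cl p \/ mvn_cl q = mvn_cl (projC p)]].
Proof.
have [D mD] := farey_model hA hE.
split.
- have [x xE] := model_surj mD (M1_val R) (@unit_itvP R).
  by exists x; apply: (identity_generates mD).
- move=> p q gp gq; case: (generator_cases mD gp gq) => qE.
    exists id; split; first by rewrite qE; split=> //; split=> //; exists id.
    move=> h [ah hp]; apply: (automorphism_eq gp _ ah); last by rewrite hp qE.
    by split=> //; exists id.
  have [h ah hp] := reflection_automorphism mD gp.
  exists h; split; first by rewrite qE.
  by move=> h' [ah' hp']; apply: (automorphism_eq gp ah ah'); rewrite hp hp' qE.
- move=> p gp; rewrite -(elliott_star hE); split.
  + exact: generator_star mD _ gp.
  + exact: star_neq_generator mD _ gp.
  + by move=> q gq; exact: generator_cases mD _ _ gp gq.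
Qed.
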